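(* Let $m,r\ge1$ and let $g:\mathbb{R}_y\times\mathbb{R}^m_t\to\mathbb{C}^{r\times r}$ be a metric of the form $$g(y,t)=e^{-\varphi(y,t)}A(y),$$ where $\varphi:\mathbb{R}\times\mathbb{R}^m\to\mathbb{R}$ is convex and $A:\mathbb{R}\to\mathbb{C}^{r\times r}$ is a metric on $\mathbb{R}$ such that $\Theta^A=\frac{d}{dy}\big(A^{-1}\frac{dA}{dy}\big)$ is negative definite. Assume that the (elementwise) integrals $$\tilde g(t)=\int_{\mathbb{R}}e^{-\varphi(y,t)}A(y)\,dy$$ converge for all $t\in\mathbb{R}^m$. Then $\tilde g$ is log concave in the sense of Nakano.
   Context: A matrix-valued function $g:\mathbb{R}^N\to\mathbb{C}^{r\times r}$ is called a metric if (i) each matrix element of $g$ is twice differentiable, and (ii) $g(x)$ is a hermitian, strictly positive definite matrix for every $x\in\mathbb{R}^N$. For a metric $g$ put $$\Theta^g_{jk}:=\frac{\partial}{\partial x_k}\Big(g^{-1}\frac{\partial g}{\partial x_j}\Big),\qquad j,k=1,\dots,N,$$ where differentiation is elementwise, juxtaposition is matrix multiplication and $g^{-1}$ is the matrix inverse (for $N=1$ write $\Theta^g=\Theta^g_{11}$). For $u,v\in\mathbb{C}^r$ set $(u,v)_g:=v^*gu$, where $v^*$ is the conjugate transpose of $v$. The metric $g$ is log concave in the sense of Nakano if for every $N$-tuple of vectors $\{u_j\}_{j=1}^N\subset\mathbb{C}^r$ $$\sum_{j,k=1}^N\big(\Theta^g_{jk}u_j,u_k\big)_g\le 0$$ at every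 point of $\mathbb{R}^N$. Negative definiteness of $\Theta^A$ is understood with respect to the inner product $(\cdot,\cdot)_A$ and in the non-strict sense: $(\Theta^Au,u)_A\le 0$ for all $u\in\mathbb{C}^r$ at every point of $\mathbb{R}$.
   Formalization: The formal statement additionally assumes that the entries of $\tilde g$ are twice differentiable; convergence of the integrals does not imply this, and without it $\tilde g$ is not a metric and $\Theta^{\tilde g}$ is undefined. *)

(* Defs.v *)
From HB Require Import structures.
From mathcomp Require Import all_boot all_order all_algebra complex.
From mathcomp Require Import all_classical all_reals all_analysis.
Set Implicit Arguments.
Unset Strict Implicit.
Unset Printing Implicit Defensive.
Import Order.TTheory GRing.Theory Num.Theory numFieldNormedType.Exports.
Local Open Scope classical_set_scope.
Local Open Scope ring_scope.
Local Open Scope complex_scope.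
Local Open Scope sesquilinear_scope.

(* [complex R] carries no structure of normed module over [R] here, so calculus
   on complex matrices is done on the real and imaginary parts of the entries. *)

Definition re_entry (R : realType) (T : Type) (r : nat) (g : T -> 'M[R[i]]_r)
  (a b : 'I_r) : T -> R := fun x => complex.Re (g x a b).

Definition im_entry (R : realType) (T : Type) (r : nat) (g : T -> 'M[R[i]]_r)
  (a b : 'I_r) : T -> R := fun x => complex.Im (g x a b).

(* [differentiable] is Frechet differentiability. When [V] is finite
   dimensional, differentiability of ['d f] amounts to that of ['D_v f] for
   every direction [v]. *)
Definition twice_differentiable (R : realType) (V : normedModType R)
    (f : V -> R) : Prop :=
  (forall x, differentiable f x) /\ (forall v x, differentiable ('D_v f) x).

Definition mx_twice_differentiable (R : realType) (V : normedModType R)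
    (r : nat) (g : V -> 'M[R[i]]_r) : Prop :=
  forall a b, twice_differentiable (re_entry g a b) /\
              twice_differentiable (im_entry g a b).

Definition mx_derive (R : realType) (V : normedModType R) (r : nat)
    (v : V) (g : V -> 'M[R[i]]_r) (x : V) : 'M[R[i]]_r :=
  \matrix_(a, b) ('D_v (re_entry g a b) x +i* 'D_v (im_entry g a b) x).

(* (u, v)_h = v^* h u, linear in the first argument *)
Definition mx_inner (R : realType) (r : nat) (h : 'M[R[i]]_r)
    (u v : 'cV[R[i]]_r) : R[i] :=
  (v ^t* *m h *m u) 0 0.

Definition mx_metric (R : realType) (V : normedModType R) (r : nat)
    (g : V -> 'M[R[i]]_r) : Prop :=
  [/\ mx_twice_differentiable g,
      forall x, g x \is hermsymmx &
      forall x (u : 'cV[R[i]]_r), u != 0 -> 0 < mx_inner (g x) u u].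

(* Theta^g_{jk} is [Theta g e_j e_k]: the inner derivative is along the first
   direction, the outer one along the second. *)
Definition Theta (R : realType) (V : normedModType R) (r : nat)
    (g : V -> 'M[R[i]]_r) (v w : V) : V -> 'M[R[i]]_r :=
  mx_derive w (fun x => invmx (g x) *m mx_derive v g x).

(* [x <= 0] in [R[i]] says that [x] is real and nonpositive. *)
Definition nakano_log_concave (R : realType) (N r : nat)
    (g : 'rV[R]_N -> 'M[R[i]]_r) : Prop :=
  mx_metric g /\
  forall (u : 'I_N -> 'cV[R[i]]_r) (x : 'rV[R]_N),
    \sum_(j < N) \sum_(k < N)
      mx_inner (g x) (Theta g (delta_mx 0 j) (delta_mx 0 k) x *m u j) (u k)
    <= 0.

Definition mx_integrable (R : realType) (r : nat) (h : R -> 'M[R[i]]_r) :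
    Prop :=
  forall a b,
    (@lebesgue_measure R).-integrable setT (EFin \o re_entry h a b) /\
    (@lebesgue_measure R).-integrable setT (EFin \o im_entry h a b).

Definition mx_integral (R : realType) (r : nat) (h : R -> 'M[R[i]]_r) :
    'M[R[i]]_r :=
  \matrix_(a, b) ((\int[@lebesgue_measure R]_y re_entry h a b y) +i*
                  (\int[@lebesgue_measure R]_y im_entry h a b y)).

(* Main.v *)
Require Import Defs.
From HB Require Import structures.
From mathcomp Require Import all_boot all_order all_algebra complex.
From mathcomp Require Import all_classical all_reals all_analysis.
From mathcomp Require Import ring lra.
Set Implicit Arguments.
Unset Strict Implicit.
Unset Printing Implicit Defensive.
Import Order.TTheory GRing.Theory Num.Theory numFieldNormedType.Exports.
Local Open Scope classical_set_scope.
Local Open Scope ring_scope.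
Local Open Scope complex_scope.

(* At a point [t], Nakano log concavity of [G] says that
     sum_jk u_k^* (d_j d_k G) u_j <= w^* G^-1 w,   w = sum_j (d_j G) u_j.
   When [phi] is smooth and [y] ranges over a compact interval, expanding the
   derivatives of [exp (- phi)] under the integral turns this inequality for the
   marginal into a Brascamp-Lieb inequality for the function
   [f = sum_j (d phi / d t_j) u_j] with respect to the matrix-valued measure
   [exp (- phi) A dy]. In one variable the latter follows by solving
   [f - v = - (exp (- phi) A)^-1 (exp (- phi) A alpha)'] for [alpha], with [v] the
   mean of [f].
   A general convex [phi] is approximated by log-sum-exp functions of finitely
   many of its tangent affine functions, and [R] by compact intervals. The
   marginals then converge only locally uniformly. Their first derivatives
   converge too, because [x^* G(t)^-1 x] is a convex function of each [t_j] for
   every approximant. The left-hand side of the inequality is the divergence of a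
   vector field built from first derivatives, and a bound on a divergence passes
   to uniform limits, after averaging over a fine grid. *)

(** The inequality is [g Theta_jk = d_k d_j g - (d_k g) g^-1 (d_j g)] summed against the [u_j]. The
    marginal is twice differentiable by assumption only: no bound justifies differentiating under
    the integral over the whole line, so its derivatives have no formula and all that is known of
    them must come from values of the approximants. Second derivatives of the approximants are not
    known to converge, but they enter the inequality linearly, while the nonlinear term contains
    first derivatives only. Convexity of [x^T G^-1 x] comes from the inequality itself: with
    [y = G^-1 x] and [w = (d_j G) y], the second derivative along [t_j] is
    [2 w^T G^-1 w - y^T (d_j^2 G) y], and the case of one vector bounds it below by [w^T G^-1 w].
    Log-sum-exp weights are chosen because their derivatives are averages and covariances of the
    slopes of the affine functions: joint convexity of [phi] in [(y, t)] becomes Jensen's inequality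
    for a finite average. The analysis is done for real symmetric matrices; a hermitian matrix is
    treated as a real one of twice the size. *)

Section BilinearForms.
Context {R : realFieldType} {n : nat}.
Implicit Types (M S : 'M[R]_n) (u v : 'cV[R]_n).

Definition bform u M v : R := (u^T *m M *m v) 0 0.

Lemma bformE u M v : bform u M v = \sum_a \sum_b u a 0 * M a b * v b 0.
Proof.
rewrite /bform mxE exchange_big; apply: eq_bigr => b _ /=.
by rewrite mxE big_distrl; apply: eq_bigr => a _; rewrite mxE.
Qed.

Lemma bformDl u u' M v : bform (u + u') M v = bform u M v + bform u' M v.
Proof. by rewrite /bform linearD !mulmxDl mxE. Qed.

Lemma bformDr u M v v' : bform u M (v + v') = bform u M v + bform u M v'.
Proof. by rewrite /bform mulmxDr mxE. Qed.

Lemma bformNl u M v : bform (- u) M v = - bform u M v.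
Proof. by rewrite /bform linearN !mulNmx mxE. Qed.

Lemma bformNr u M v : bform u M (- v) = - bform u M v.
Proof. by rewrite /bform mulmxN mxE. Qed.

Lemma bformZl k u M v : bform (k *: u) M v = k * bform u M v.
Proof. by rewrite /bform linearZ -!scalemxAl mxE. Qed.

Lemma bformZr k u M v : bform u M (k *: v) = k * bform u M v.
Proof. by rewrite /bform -!scalemxAr mxE. Qed.

Lemma bform0l M v : bform 0 M v = 0.
Proof. by rewrite /bform trmx0 !mul0mx mxE. Qed.

Lemma bform0r M u : bform u M 0 = 0.
Proof. by rewrite /bform mulmx0 mxE. Qed.

Lemma bform_suml (I : finType) (F : I -> 'cV[R]_n) M v :
  bform (\sum_i F i) M v = \sum_i bform (F i) M v.
Proof.
apply: (big_morph (fun u => bform u M v)); last exact: bform0l.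
by move=> u u'; apply: bformDl.
Qed.

Lemma bform_sumr (I : finType) (F : I -> 'cV[R]_n) M u :
  bform u M (\sum_i F i) = \sum_i bform u M (F i).
Proof.
apply: (big_morph (fun v => bform u M v)); last exact: bform0r.
by move=> v v'; apply: bformDr.
Qed.

Lemma bformDm u M M' v : bform u (M + M') v = bform u M v + bform u M' v.
Proof. by rewrite /bform mulmxDr mulmxDl mxE. Qed.

Lemma bformNm u M v : bform u (- M) v = - bform u M v.
Proof. by rewrite /bform mulmxN mulNmx mxE. Qed.

Lemma bformZm k u M v : bform u (k *: M) v = k * bform u M v.
Proof. by rewrite /bform -scalemxAr -scalemxAl mxE. Qed.

Lemma bform_tr u M v : bform u M v = bform v M^T u.
Proof.
by rewrite /bform -[in RHS](trmxK u) -!trmx_mul mulmxA [in RHS]mxE.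
Qed.

Lemma bformC u M v : M^T = M -> bform u M v = bform v M u.
Proof. by move=> MT; rewrite bform_tr MT. Qed.

Lemma bform_mulr u M M' v : bform u (M *m M') v = bform u M (M' *m v).
Proof. by rewrite /bform !mulmxA. Qed.

Lemma bform_mull u M M' v : bform u (M *m M') v = bform (M^T *m u) M' v.
Proof. by rewrite /bform trmx_mul trmxK !mulmxA. Qed.

(** Symmetry is a separate clause because, over the reals, positivity of the quadratic form does not
    imply it. *)
Definition posdef M := M^T = M /\ forall u, u != 0 -> 0 < bform u M u.

Lemma posdef_ge0 M u : posdef M -> 0 <= bform u M u.
Proof.
move=> [_ Mp]; have [->|u0] := eqVneq u 0; last exact/ltW/Mp.
by rewrite bform0l.
Qed.

(** A nonzero vector of the left kernel would annihilate the quadratic form. *)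
Lemma posdef_unit M : posdef M -> M \in unitmx.
Proof.
move=> [MT Mp]; rewrite -row_free_unit -kermx_eq0; apply/eqP/row_matrixP => i.
rewrite row0; apply/eqP/negPn/negP => ri0.
have := Mp (row i (kermx M))^T.
rewrite /bform trmxK -row_mul mulmx_ker row0 mul0mx mxE ltxx => H.
suff : false by []; apply: H.
by apply: contra ri0 => /eqP/(congr1 trmx); rewrite trmxK trmx0 => ->.
Qed.

Lemma posdef_scale k M : 0 < k -> posdef M -> posdef (k *: M).
Proof.
move=> k0 [MT Mp]; split; first by rewrite linearZ /= MT.
by move=> u u0; rewrite bformZm mulr_gt0 ?Mp.
Qed.

Lemma posdef_inv_tr M : posdef M -> (invmx M)^T = invmx M.
Proof. by move=> [MT _]; rewrite trmx_inv MT. Qed.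

Lemma bform_invmx M u : posdef M ->
  bform u (invmx M) u = bform (invmx M *m u) M (invmx M *m u).
Proof.
move=> Mp; rewrite -bform_mulr mulmxV ?posdef_unit//.
by rewrite -[X in X *m u](posdef_inv_tr Mp) -bform_mull mulmx1.
Qed.

Lemma posdef_inv_ge0 M u : posdef M -> 0 <= bform u (invmx M) u.
Proof. by move=> Mp; rewrite bform_invmx// posdef_ge0. Qed.

(** Positivity at [e a + e b] and [e a - e b]. In the approximation of the marginal it lets the
    nonnegative diagonal entries dominate all the others. *)
Lemma posdef_entry M a b : posdef M -> `|M a b| <= M a a + M b b.
Proof.
move=> Mp; pose e i : 'cV[R]_n := delta_mx i 0.
have eE i j : bform (e i) M (e j) = M i j.
  by rewrite /bform trmx_delta -rowE -colE !mxE.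
have Msym : M b a = M a b by rewrite -[in LHS]Mp.1 mxE.
have h1 := posdef_ge0 (e a + e b) Mp; have h2 := posdef_ge0 (e a - e b) Mp.
have ha := posdef_ge0 (e a) Mp; have hb := posdef_ge0 (e b) Mp.
move: h1 h2 ha hb; rewrite !(bformDl, bformDr, bformNl, bformNr) !eE Msym.
by move=> h1 h2 ha hb; rewrite ler_norml; apply/andP; split; lra.
Qed.

Lemma posdef_diag_ge0 M a : posdef M -> 0 <= M a a.
Proof.
move=> Mp; have := posdef_ge0 (delta_mx a 0) Mp.
by rewrite /bform trmx_delta -rowE -colE !mxE.
Qed.
End BilinearForms.

(* [P] stands for a property such as continuity, differentiability at a point or
   uniform convergence. *)
Section ClosedPredicates.
Context {R : realType} {X : Type} (P : (X -> R) -> Prop).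
Hypothesis Pcst : forall c, P (fun=> c).
Hypothesis PD : forall f g, P f -> P g -> P (fun x => f x + g x).
Hypothesis PM : forall f g, P f -> P g -> P (fun x => f x * g x).

Lemma closed_sum (I : Type) (r : seq I) (Q : pred I) (F : I -> X -> R) :
  (forall i, P (F i)) -> P (fun x => \sum_(i <- r | Q i) F i x).
Proof.
move=> PF; elim: r => [|i r IH].
  by rewrite (_ : (fun=> _) = fun=> 0)//; apply/funext => x; rewrite big_nil.
rewrite (_ : (fun=> _) = fun x => (if Q i then F i x else 0) +
    \sum_(i <- r | Q i) F i x).
  by apply: PD => //; case: (Q i).
by apply/funext => x; rewrite big_cons; case: (Q i); rewrite ?add0r.
Qed.

Lemma closed_prod (I : Type) (r : seq I) (F : I -> X -> R) :
  (forall i, P (F i)) -> P (fun x => \prod_(i <- r) F i x).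
Proof.
move=> PF; elim: r => [|i r IH].
  by rewrite (_ : (fun=> _) = fun=> 1)//; apply/funext => x; rewrite big_nil.
rewrite (_ : (fun=> _) = fun x => F i x * \prod_(i <- r) F i x).
  exact: PM.
by apply/funext => x; rewrite big_cons.
Qed.

Lemma closed_mulmx p q s (F : X -> 'M[R]_(p, q)) (G : X -> 'M[R]_(q, s)) :
  (forall a b, P (fun x => F x a b)) -> (forall a b, P (fun x => G x a b)) ->
  forall a b, P (fun x => (F x *m G x) a b).
Proof.
move=> PF PG a b; rewrite (_ : (fun=> _) = fun x => \sum_j F x a j * G x j b).
  by apply: closed_sum => j; apply: PM.
by apply/funext => x; rewrite mxE.
Qed.

Lemma closed_det n (F : X -> 'M[R]_n) :
  (forall a b, P (fun x => F x a b)) -> P (fun x => \det (F x)).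
Proof. by move=> PF; apply: closed_sum => s; apply: PM => //; apply: closed_prod. Qed.

(** By the cofactor formula an entry of the inverse is a polynomial in the entries of [F] times the
    reciprocal of the determinant, the only quotient for which [P] has to be supplied. *)
Lemma closed_invmx n (F : X -> 'M[R]_n) :
  (forall a b, P (fun x => F x a b)) -> (forall x, F x \in unitmx) ->
  P (fun x => (\det (F x))^-1) -> forall a b, P (fun x => invmx (F x) a b).
Proof.
move=> PF Fu Pdet a b.
rewrite (_ : (fun=> _) = fun x => (\det (F x))^-1 *
    ((-1) ^+ (b + a) * \det (row' b (col' a (F x))))).
  apply: PM => //; apply: PM => //; apply: closed_det => i j.
  by rewrite (_ : (fun=> _) = fun x => F x (lift b i) (lift a j))//;
    apply/funext => x; rewrite !mxE.
by apply/funext => x; rewrite /invmx Fu !mxE.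
Qed.
End ClosedPredicates.

(** * Directional derivatives of matrix-valued maps *)

Section Derive.
Context {R : realType} {V : normedModType R}.
Implicit Types (f g : V -> R) (x v : V).

Lemma is_deriveDf f g df dg x v : is_derive x v f df -> is_derive x v g dg ->
  is_derive x v (fun z => f z + g z) (df + dg).
Proof. exact: is_deriveD. Qed.

Lemma is_deriveBf f g df dg x v : is_derive x v f df -> is_derive x v g dg ->
  is_derive x v (fun z => f z - g z) (df - dg).
Proof. exact: is_deriveB. Qed.

Lemma is_deriveMf f g df dg x v : is_derive x v f df -> is_derive x v g dg ->
  is_derive x v (fun z => f z * g z) (f x * dg + df * g x).
Proof.
move=> hf hg; have := is_deriveM hf hg; congr is_derive.
by rewrite [df * _]mulrC.
Qed.

Lemma is_derive_sumf n (F : 'I_n -> V -> R) dF x v :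
  (forall i, is_derive x v (F i) (dF i)) ->
  is_derive x v (fun z => \sum_i F i z) (\sum_i dF i).
Proof.
move=> h; rewrite (_ : (fun=> _) = \sum_i F i); first exact: is_derive_sum.
by apply/funext => z; rewrite fct_sumE.
Qed.

Lemma is_deriveVf f df x v : f x != 0 -> is_derive x v f df ->
  is_derive x v (fun z => (f z)^-1) (- df / (f x) ^+ 2).
Proof.
move=> fx0 [hf <-]; split; first exact: derivableV.
by rewrite deriveV// scaleNr mulNr [in RHS]mulrC.
Qed.

Definition mxder {p q} (F : V -> 'M[R]_(p, q)) (dF : 'M[R]_(p, q)) x v : Prop :=
  forall a b, is_derive x v (fun z => F z a b) (dF a b).

Lemma mxder_cst p q (M : 'M[R]_(p, q)) x v : mxder (fun=> M) 0 x v.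
Proof. by move=> a b; rewrite mxE; exact: is_derive_cst. Qed.

Lemma mxderD p q (F G : V -> 'M[R]_(p, q)) dF dG x v :
  mxder F dF x v -> mxder G dG x v -> mxder (fun z => F z + G z) (dF + dG) x v.
Proof.
move=> hF hG a b; rewrite mxE.
rewrite (_ : (fun=> _) = fun z => F z a b + G z a b).
  exact: is_deriveDf.
by apply/funext => z; rewrite mxE.
Qed.

Lemma mxderZ p q (f : V -> R) (F : V -> 'M[R]_(p, q)) df dF x v :
  is_derive x v f df -> mxder F dF x v ->
  mxder (fun z => f z *: F z) (f x *: dF + df *: F x) x v.
Proof.
move=> hf hF a b; rewrite !mxE.
rewrite (_ : (fun=> _) = fun z => f z * F z a b).
  exact: is_deriveMf.
by apply/funext => z; rewrite mxE.
Qed.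

Lemma mxderM p q s (F : V -> 'M[R]_(p, q)) (G : V -> 'M[R]_(q, s)) dF dG x v :
  mxder F dF x v -> mxder G dG x v ->
  mxder (fun z => F z *m G z) (F x *m dG + dF *m G x) x v.
Proof.
move=> hF hG a b; rewrite !mxE -big_split/=.
rewrite (_ : (fun=> _) = fun z => \sum_j F z a j * G z j b).
  by apply: is_derive_sumf => j; exact: is_deriveMf.
by apply/funext => z; rewrite mxE.
Qed.

Lemma mxder_tr p q (F : V -> 'M[R]_(p, q)) dF x v :
  mxder F dF x v -> mxder (fun z => (F z)^T) dF^T x v.
Proof.
move=> hF a b; rewrite mxE (_ : (fun=> _) = fun z => F z b a)//.
by apply/funext => z; rewrite mxE.
Qed.

(** Turns an identity between functions, such as symmetry, into the same identity between their
    derivatives. *)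
Lemma mxder_unique p q (F : V -> 'M[R]_(p, q)) dF dF' x v :
  mxder F dF x v -> mxder F dF' x v -> dF = dF'.
Proof.
by move=> h h'; apply/matrixP => a b; have [_ <-] := h a b; have [_ <-] := h' a b.
Qed.

Lemma mxder_inv n (F : V -> 'M[R]_n) dF x v : (forall z, F z \in unitmx) ->
  mxder F dF x v ->
  mxder (fun z => invmx (F z)) (- (invmx (F x) *m dF *m invmx (F x))) x v.
Proof.
move=> Fu hF.
pose P (f : V -> R) : Prop := derivable f x v.
have Pc c : P (fun=> c) by exact: derivable_cst.
have PD f g : P f -> P g -> P (fun z => f z + g z) by exact: derivableD.
have PM f g : P f -> P g -> P (fun z => f z * g z) by exact: derivableM.
have PF a b : P (fun z => F z a b) by case: (hF a b).
have Pdet := @closed_det R V P Pc PD PM n F PF.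
have Pdetinv : P (fun z => (\det (F z))^-1).
  by apply: derivableV Pdet; have := Fu x; rewrite unitmxE unitfE.
have D a b := @closed_invmx R V P Pc PD PM n F PF Fu Pdetinv a b.
pose dH : 'M[R]_n := \matrix_(a, b) 'D_v (fun z => invmx (F z) a b) x.
have hH : mxder (fun z => invmx (F z)) dH x v.
  by move=> a b; rewrite mxE; apply: derivableP; exact: D.
(* The cofactor formula has given existence of the derivative [dH]; its value follows by
   differentiating [F *m invmx F = 1]. *)
have E : F x *m dH + dF *m invmx (F x) = 0.
  apply: mxder_unique (mxderM hF hH) _.
  rewrite (_ : (fun=> _) = fun=> 1%:M); first exact: mxder_cst.
  by apply/funext => z; rewrite mulmxV.
suff -> : - (invmx (F x) *m dF *m invmx (F x)) = dH by [].
move/(congr1 (fun M => invmx (F x) *m M)): E.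
by rewrite mulmxDr mulKmx// mulmx0 mulmxA => /eqP; rewrite addr_eq0 => /eqP ->.
Qed.

Lemma mxder_bform n (f g : V -> 'cV[R]_n) (M : V -> 'M[R]_n) df dg dM x v :
  mxder f df x v -> mxder M dM x v -> mxder g dg x v ->
  is_derive x v (fun z => bform (f z) (M z) (g z))
    (bform df (M x) (g x) + bform (f x) dM (g x) + bform (f x) (M x) dg).
Proof.
move=> hf hM hg.
have := mxderM (mxderM (mxder_tr hf) hM) hg.
move=> /(_ 0 0); congr is_derive.
rewrite mulmxDl !mxE /bform !mxE addrC; congr (_ + _).
by rewrite addrC.
Qed.
End Derive.

(** * Calculus and integration on the real line *)

Section RealCalculus.
Context {R : realType}.
Implicit Types (f g df : R -> R) (a b : R).

Lemma derivable_continuous f (x l : R) : is_derive x 1 f l -> {for x, continuous f}.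
Proof.
by move=> [h _]; apply: differentiable_continuous; apply/derivable1_diffP.
Qed.

Lemma mvt f df a b : a < b ->
  (forall x, a <= x <= b -> is_derive x 1 f (df x)) ->
  exists2 c, a < c < b & f b - f a = df c * (b - a).
Proof.
move=> ab h; have [||c] := @MVT R f df a b ab.
- by move=> x; rewrite in_itv/= => /andP[ax xb]; apply: h; rewrite !ltW.
- apply: derivable_within_continuous => x; rewrite in_itv/= => xab.
  by have [] := h x xab.
- by rewrite in_itv/= => cab; exists c.
Qed.

Lemma mvt_le f df a b : a <= b ->
  (forall x, a <= x <= b -> is_derive x 1 f (df x)) ->
  (forall x, a <= x <= b -> 0 <= df x) -> f a <= f b.
Proof.
rewrite le_eqVlt => /predU1P[->//|ab] h h0; rewrite -subr_ge0.
have [c /andP[ac cb] ->] := mvt ab h.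
by rewrite mulr_ge0 ?h0 ?subr_ge0 ?ltW.
Qed.

Definition mxcont {T : topologicalType} {p q} (F : T -> 'M[R]_(p, q)) :=
  forall i j, continuous (fun y => F y i j).

Section ContinuousMatrices.
Context {T : topologicalType}.

Let P (f : T -> R) : Prop := continuous f.

Let P_cst c : P (fun=> c).
Proof. exact: cst_continuous. Qed.

Let P_add (f g : T -> R) : P f -> P g -> P (fun z => f z + g z).
Proof. by move=> cf cg z; exact: (cvgD (cf z) (cg z)). Qed.

Let P_mul (f g : T -> R) : P f -> P g -> P (fun z => f z * g z).
Proof. by move=> cf cg z; exact: (cvgM (cf z) (cg z)). Qed.

Lemma continuous_sumf (I : Type) (r : seq I) (F : I -> T -> R) :
  (forall i, continuous (F i)) -> continuous (fun z => \sum_(i <- r) F i z).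
Proof.
exact: (@closed_sum R T P P_cst P_add).
Qed.

Lemma mxcontM p q s (F : T -> 'M[R]_(p, q)) (G : T -> 'M[R]_(q, s)) :
  mxcont F -> mxcont G -> mxcont (fun y => F y *m G y).
Proof.
exact: (@closed_mulmx R T P P_cst P_add P_mul).
Qed.

Lemma continuous_det n (F : T -> 'M[R]_n) :
  mxcont F -> continuous (fun y => \det (F y)).
Proof.
exact: (@closed_det R T P P_cst P_add P_mul).
Qed.

Lemma mxcont_invmx n (F : T -> 'M[R]_n) : (forall y, F y \in unitmx) ->
  mxcont F -> mxcont (fun y => invmx (F y)).
Proof.
move=> Fu cF; apply: (@closed_invmx R T P P_cst P_add P_mul n F cF Fu) => y.
have Fy : \det (F y) != 0 by rewrite -unitfE -unitmxE.
exact: (cvgV Fy (@continuous_det n F cF y)).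
Qed.

Lemma mxcontZ p q (k : T -> R) (F : T -> 'M[R]_(p, q)) :
  continuous k -> mxcont F -> mxcont (fun y => k y *: F y).
Proof.
move=> ck cF i j; rewrite (_ : (fun=> _) = fun y => k y * F y i j).
  by move=> x; apply: cvgM; [exact: ck|exact: cF].
by apply/funext => x; rewrite mxE.
Qed.

Lemma mxcont_cst p q (M : 'M[R]_(p, q)) : mxcont (fun _ : T => M).
Proof. by move=> i j; exact: cst_continuous. Qed.

Lemma mxcont_tr p q (F : T -> 'M[R]_(p, q)) :
  mxcont F -> mxcont (fun y => (F y)^T).
Proof.
move=> cF i j; rewrite (_ : (fun=> _) = fun y => F y j i); first exact: cF.
by apply/funext => x; rewrite mxE.
Qed.

Lemma continuous_bform n (u v : T -> 'cV[R]_n) (M : T -> 'M[R]_n) :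
  mxcont u -> mxcont M -> mxcont v ->
  continuous (fun y => bform (u y) (M y) (v y)).
Proof.
by move=> cu cM cv; have := mxcontM (mxcontM (mxcont_tr cu) cM) cv; exact.
Qed.

End ContinuousMatrices.

Lemma mxder_cont p q (F dF : R -> 'M[R]_(p, q)) :
  (forall y, mxder F (dF y) y 1) -> mxcont F.
Proof. by move=> dFE i j y; apply: derivable_continuous (dFE y i j). Qed.

Lemma continuous_slice (V T : topologicalType) (F : R * V -> T) t :
  continuous F -> continuous (fun y => F (y, t)).
Proof.
move=> cF y; have h : (fun y : R => (y, t)) @ y --> (y, t).
  exact: (cvg_pair (@cvg_id _ (nbhs y)) (cvg_cst t)).
exact: (cvg_comp _ _ h (cF (y, t))).
Qed.

Definition integ a b f := \int[@lebesgue_measure R]_(x in `[a, b]) f x.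

Lemma continuous_integrable_itv a b f : continuous f ->
  (@lebesgue_measure R).-integrable `[a, b] (EFin \o f).
Proof.
move=> cf; apply: continuous_compact_integrable; first exact: segment_compact.
exact: continuous_subspaceT.
Qed.

Lemma integD a b f g : continuous f -> continuous g ->
  integ a b (fun x => f x + g x) = integ a b f + integ a b g.
Proof.
by move=> cf cg; apply: RintegralD => //; exact: continuous_integrable_itv.
Qed.

Lemma integZ a b f k : continuous f ->
  integ a b (fun x => k * f x) = k * integ a b f.
Proof.
by move=> cf; apply: RintegralZl => //; exact: continuous_integrable_itv.
Qed.

Lemma integB a b f g : continuous f -> continuous g ->
  integ a b (fun x => f x - g x) = integ a b f - integ a b g.
Proof.
by move=> cf cg; apply: RintegralB => //; exact: continuous_integrable_itv.
Qed.

Lemma eq_integ a b f g : (forall x, a <= x <= b -> f x = g x) ->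
  integ a b f = integ a b g.
Proof.
move=> fg; apply: eq_Rintegral => x; rewrite inE/= in_itv/=; exact: fg.
Qed.

Lemma le_integ a b f g : continuous f -> continuous g ->
  (forall x, a <= x <= b -> f x <= g x) -> integ a b f <= integ a b g.
Proof.
move=> cf cg fg; apply: le_Rintegral => //; exact: continuous_integrable_itv.
Qed.

Lemma integ_norm a b f : continuous f ->
  `|integ a b f| <= integ a b (fun x => `|f x|).
Proof.
by move=> cf; apply: le_normr_Rintegral => //; exact: continuous_integrable_itv.
Qed.

Lemma integ_sum a b n (F : 'I_n -> R -> R) : (forall i, continuous (F i)) ->
  integ a b (fun x => \sum_i F i x) = \sum_i integ a b (F i).
Proof.
elim: n F => [|n IH] F cF.
  rewrite big_ord0 (_ : (fun=> _) = fun=> 0 * 0).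
    by rewrite integZ ?mul0r//; exact: cst_continuous.
  by apply/funext => x; rewrite big_ord0 mul0r.
rewrite big_ord_recl -IH// -integD//; last by apply: continuous_sumf => i; exact: cF.
by apply: eq_integ => x _; rewrite big_ord_recl.
Qed.

Lemma primitive a b f : a < b -> continuous f ->
  exists2 F, (forall x, a <= x <= b -> is_derive x 1 F (f x)) &
    integ a b f = F b - F a.
Proof.
(* Starting at [a - 1], and allowing [x] up to [b + 1], makes both ends of [[a, b]] interior points,
   so the derivatives there are two-sided. *)
move=> ab cf; pose F x := \int[@lebesgue_measure R]_(t in `[a - 1, x]) f t.
have dF x : a <= x <= b -> derivable F x 1 /\ derive1 F x = f x.
  move=> /andP[ax xb]; apply: (@continuous_FTC1_closed R f (a - 1) x (b + 1)).
  - by lra.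
  - exact: continuous_integrable_itv.
  - by lra.
  - exact: cf.
exists F => [x /dF[d1 d2]|].
  by split; [exact: d1|rewrite -derive1E; exact: d2].
rewrite /integ /Rintegral (@continuous_FTC2 R f F a b ab)//.
- exact: continuous_subspaceT.
- split.
  + by move=> x; rewrite in_itv/= => /andP[ax xb]; have [] := dF x; rewrite ?ltW.
  + apply: cvg_at_right_filter; apply: differentiable_continuous.
    by apply/derivable1_diffP; have [] := dF a; rewrite ?lexx ?ltW.
  + apply: cvg_at_left_filter; apply: differentiable_continuous.
    by apply/derivable1_diffP; have [] := dF b; rewrite ?lexx ?ltW.
- by move=> x; rewrite in_itv/= => /andP[ax xb]; have [] := dF x; rewrite ?ltW.
Qed.

Lemma integ_gt0 a b f : a < b -> continuous f ->
  (forall x, a <= x <= b -> 0 < f x) -> 0 < integ a b f.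
Proof.
move=> ab cf f0; have [F dF ->] := primitive ab cf.
have [c /andP[ac cb] ->] := mvt ab dF.
by rewrite mulr_gt0 ?f0 ?subr_gt0// !ltW.
Qed.

Lemma integ_ge0 a b f : (forall x, a <= x <= b -> 0 <= f x) -> 0 <= integ a b f.
Proof.
by move=> f0; apply: Rintegral_ge0 => x /=; rewrite in_itv/=; exact: f0.
Qed.

Definition integ_mx a b {p q} (F : R -> 'M[R]_(p, q)) : 'M[R]_(p, q) :=
  \matrix_(i, j) integ a b (fun y => F y i j).

Lemma integ_mulmx a b p q s (A : 'M[R]_(p, q)) (F : R -> 'M[R]_(q, s)) :
  mxcont F -> integ_mx a b (fun y => A *m F y) = A *m integ_mx a b F.
Proof.
move=> cF; apply/matrixP => i j; rewrite !mxE.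
under eq_bigr => k _ do rewrite mxE -integZ//.
rewrite -integ_sum; last by move=> k x; apply: cvgM; [exact: cvg_cst|exact: cF].
by apply: eq_integ => x _; rewrite mxE.
Qed.

Lemma integ_mulmxr a b p q s (A : 'M[R]_(q, s)) (F : R -> 'M[R]_(p, q)) :
  mxcont F -> integ_mx a b (fun y => F y *m A) = integ_mx a b F *m A.
Proof.
move=> cF; apply/matrixP => i j; rewrite !mxE.
under eq_bigr => k _ do rewrite mxE mulrC -integZ//.
rewrite -integ_sum; last by move=> k x; apply: cvgM; [exact: cvg_cst|exact: cF].
by apply: eq_integ => x _; rewrite mxE; apply: eq_bigr => k _; rewrite mulrC.
Qed.

Lemma integ_bform a b n (F : R -> 'M[R]_n) u v : mxcont F ->
  integ a b (fun y => bform u (F y) v) = bform u (integ_mx a b F) v.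
Proof.
move=> cF; rewrite /bform -integ_mulmx// -integ_mulmxr; last first.
  by apply: mxcontM => //; exact: mxcont_cst.
by rewrite mxE.
Qed.

Lemma posdef_integ a b n (F : R -> 'M[R]_n) : a < b -> mxcont F ->
  (forall y, a <= y <= b -> posdef (F y)) -> posdef (integ_mx a b F).
Proof.
move=> ab cF Fp; split.
  apply/matrixP => i j; rewrite !mxE; apply: eq_integ => x /Fp[FT _].
  by rewrite -[in LHS]FT mxE.
move=> u u0; rewrite -integ_bform//; apply: integ_gt0 => //.
  by apply: continuous_bform => //; exact: mxcont_cst.
by move=> x /Fp[_]; exact.
Qed.
End RealCalculus.

(** * The one-dimensional Brascamp-Lieb inequality *)

Section BrascampLieb.
Context {R : realType} {n : nat}.
Variables (a b : R) (S S1 B1 : R -> 'M[R]_n) (psi phi1 phi2 : R -> R).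
Variables (f f1 : R -> 'cV[R]_n) (q : R -> R).
Hypothesis ab : a < b.
Hypothesis Sp : forall y, posdef (S y).
Hypothesis dS : forall y : R, mxder S (S1 y) y 1.
Hypothesis dB : forall y : R, mxder (fun y => invmx (S y) *m S1 y) (B1 y) y 1.
Hypothesis B1_le0 : forall y u, bform u (S y) (B1 y *m u) <= 0.
Hypothesis psi_gt0 : forall y, 0 < psi y.
Hypothesis dpsi : forall y : R, is_derive y 1 psi (- phi1 y * psi y).
Hypothesis dphi1 : forall y : R, is_derive y 1 phi1 (phi2 y).
Hypothesis df : forall y : R, mxder f (f1 y) y 1.
(** With [phi1] and [phi2] the first two derivatives of [phi = - ln psi], the next hypothesis is a
    form without division of [f1^T S f1 / phi2 <= q], the integrand of the Brascamp-Lieb bound. It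
    makes sense where [phi2] vanishes. *)
Hypothesis cq : continuous q.
Hypothesis q_ge : forall y u,
  0 <= q y - 2 * bform u (S y) (f1 y) + phi2 y * bform u (S y) u.

Let M := integ_mx a b (fun y => psi y *: S y).
Let p := integ_mx a b (fun y => psi y *: (S y *m f y)).

Let cpsi : continuous psi.
Proof. by move=> y; exact: derivable_continuous (dpsi y). Qed.
Let cS : mxcont S. Proof. exact: mxder_cont dS. Qed.
Let cf : mxcont f. Proof. exact: mxder_cont df. Qed.

Let S1T y : (S1 y)^T = S1 y.
Proof.
have h := mxder_tr (dS y); apply: (mxder_unique h).
by rewrite (_ : (fun z => (S z)^T) = S)//; apply/funext => z; rewrite (Sp z).1.
Qed.

Let cpsiS : mxcont (fun y => psi y *: S y).
Proof. exact: mxcontZ. Qed.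

Let Mp : posdef M.
Proof. by apply: posdef_integ => // y _; apply: posdef_scale. Qed.

Let v := invmx M *m p.
Let sigma y := f y - v.

Let dsigma y : mxder sigma (f1 y) y 1.
Proof.
by rewrite -[f1 y]addr0; apply: mxderD => //; exact: mxder_cst.
Qed.

Let csigma : mxcont sigma.
Proof. exact: mxder_cont dsigma. Qed.

Let integ_sigma : integ_mx a b (fun y => psi y *: (S y *m sigma y)) = 0.
Proof.
transitivity (p - M *m v); last by rewrite /v mulKVmx ?subrr// posdef_unit.
rewrite /p /M -integ_mulmxr//.
apply/matrixP => i j; rewrite !mxE -integB; last first.
- by apply: mxcontM => //; exact: mxcont_cst.
- by apply: mxcontZ => //; exact: mxcontM.
by apply: eq_integ => y _; rewrite mulmxBr scalerBr -scalemxAl !mxE.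
Qed.

(* [N] vanishes at both ends since [v] is the mean of [f]. *)
Let exN : exists N : R -> 'cV[R]_n, [/\ N a = 0, N b = 0 &
  forall y, a <= y <= b -> mxder N (psi y *: (S y *m sigma y)) y 1].
Proof.
have cE : mxcont (fun y => psi y *: (S y *m sigma y)).
  by apply: mxcontZ => //; exact: mxcontM.
have h (i : 'I_n) : {F : R -> R |
    (forall y, a <= y <= b -> is_derive y 1 F ((psi y *: (S y *m sigma y)) i 0)) /\
    F b - F a = 0}.
  apply/cid; have [F dF FE] := primitive ab (cE i 0); exists F; split=> //.
  by rewrite -FE; have := congr1 (fun K : 'cV[R]_n => K i 0) integ_sigma; rewrite !mxE.
exists (fun y => \col_i (sval (h i) y - sval (h i) a)); split.
- by apply/colP => i; rewrite !mxE subrr.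
- by apply/colP => i; rewrite !mxE; case: (h i) => F [].
move=> y yab i j; rewrite ord1.
rewrite (_ : (fun=> _) = fun y => sval (h i) y - sval (h i) a); last first.
  by apply/funext => z; rewrite mxE.
rewrite -[X in is_derive _ _ _ X]subr0; apply: is_deriveBf.
by case: (h i) => F [dF _] /=; exact: dF.
Qed.

(** Since [p = M v], the right-hand side is [v^T M v], and the claim is the variance estimate that
    bounds the integral of [psi * (f - v)^T S (f - v)] by that of [psi * q]. In the application [p]
    becomes a combination of first derivatives of the marginal. *)
Lemma brascamp_lieb :
  integ a b (fun y => psi y * (bform (f y) (S y) (f y) - q y)) <=
  bform p (invmx M) p.
Proof.
have [N [Na Nb dN]] := exN.
(* With [C = (psi S)^-1 (psi S)'], the function [al] solves [al' = - sigma - C al]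
   and [N = - psi S al]. The claim amounts to [0 <= int tau], and below
   [tau + r' >= 0] pointwise while [r] vanishes at both ends. Differentiating [r]
   avoids integrating [B1], which need not be integrable. *)
pose C y := invmx (S y) *m S1 y - (phi1 y)%:M.
pose al y := - (psi y)^-1 *: (invmx (S y) *m N y).
pose tau y := psi y * (q y - bform (sigma y) (S y) (sigma y)).
pose r y := bform (N y) 1%:M (sigma y *+ 2 + C y *m al y).
have Su y : S y \in unitmx by exact: posdef_unit.
have psi_neq0 y : psi y != 0 by rewrite gt_eqF.
have NE y : N y = - psi y *: (S y *m al y).
  by rewrite /al -scalemxAr scalerA mulrNN mulfV// scale1r mulKVmx.
have dC (y : R) : mxder C (B1 y - (phi2 y)%:M) y 1.
  apply: mxderD => //; rewrite -raddfN.
  move=> i j; rewrite mxE; have := @is_deriveN _ _ _ _ _ _ _ (dphi1 y).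
  have -> : (fun z => (- (phi1 z)%:M : 'M[R]_n) i j) = fun z => - phi1 z *+ (i == j).
    by apply/funext => z; rewrite !mxE mulNrn.
  case: (i == j) => [//|_]; rewrite mulr0n.
  by rewrite (_ : (fun=> _) = fun=> 0)//; exact: is_derive_cst.
have dal (y : R) : a <= y <= b -> mxder al (- sigma y - C y *m al y) y 1.
  move=> yab.
  have d1 : is_derive y 1 (fun y => - (psi y)^-1) (- phi1 y / psi y).
    have := is_deriveN (is_deriveVf (psi_neq0 y) (dpsi y)); congr is_derive.
    by field.
  have := mxderZ d1 (mxderM (mxder_inv Su (dS y)) (dN y yab)).
  congr mxder; rewrite /C /al; set HN := invmx (S y) *m N y.
  rewrite -scalemxAr mulKmx// mulNmx -[_ *m S1 y *m _ *m N y]mulmxA -/HN.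
  rewrite mulmxBl mul_scalar_mx -!scalemxAr.
  set Y := _ *m _ *m HN; apply/matrixP => i j.
  move: (sigma y) HN Y => s z w; rewrite !mxE; field.
  exact: psi_neq0.
have dr (y : R) : a <= y <= b -> is_derive y 1 r
   (bform (psi y *: (S y *m sigma y)) 1%:M (sigma y *+ 2 + C y *m al y) +
    bform (N y) 1%:M (f1 y *+ 2 + (C y *m (- sigma y - C y *m al y) +
       (B1 y - (phi2 y)%:M) *m al y))).
  move=> yab; have := mxder_bform (dN y yab) (mxder_cst 1%:M y 1)
    (mxderD (mxderD (dsigma y) (dsigma y)) (mxderM (dC y) (dal y yab))).
  have b0 u w : bform u (0 : 'M[R]_n) w = 0 by rewrite /bform mulmx0 mul0mx mxE.
  by rewrite b0 addr0.
have ctau : continuous tau.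
  move=> y; apply: cvgM; first exact: cpsi.
  by apply: cvgB; [exact: cq|exact: continuous_bform].
have [F dF FE] := primitive ab ctau.
have tau_ge0 : 0 <= integ a b tau.
  rewrite FE subr_ge0.
  have ra : r a = 0 by rewrite /r Na bform0l.
  have rb : r b = 0 by rewrite /r Nb bform0l.
  rewrite -[F a]addr0 -ra -[F b]addr0 -rb.
  apply: (mvt_le (ltW ab) (fun y yab => is_deriveDf (dF y yab) (dr y yab))).
  move=> y yab; rewrite NE.
  set s := sigma y; set x := al y; set Sy := S y.
  have ST : Sy^T = Sy := (Sp y).1.
  have b1 u w : bform (Sy *m u) 1%:M w = bform u Sy w.
    by rewrite -{1}ST -bform_mull mulmx1.
  rewrite !bformZl !b1.
  (* The product [Sy *m C y] is symmetric, so [C y] is self-adjoint for the form [Sy]. This lets the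
     terms containing [C] complete a square. *)
  have SC : Sy *m C y = S1 y - phi1 y *: Sy.
    by rewrite /C mulmxBr mulKVmx ?Su// mul_mx_scalar.
  have SCT : (Sy *m C y)^T = Sy *m C y by rewrite SC linearB linearZ /= S1T ST.
  have q0 := q_ge y x; have B0 := B1_le0 y x.
  have sq := posdef_ge0 (s + C y *m x) (Sp y).
  have e1 : bform x Sy (C y *m s) = bform s Sy (C y *m x).
    by rewrite -!bform_mulr bform_tr SCT.
  have e2 : bform x Sy (C y *m (C y *m x)) = bform (C y *m x) Sy (C y *m x).
    by rewrite -bform_mulr -SCT bform_tr trmxK bform_mulr bform_tr ST.
  move: q0 B0 sq; rewrite /tau -/s -/Sy; clearbody s x.
  rewrite [(B1 y - _) *m x]mulmxBl mul_scalar_mx mulmxDr !mulmxN.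
  rewrite [s *+ 2]mulr2n [f1 y *+ 2]mulr2n.
  rewrite !(bformDl, bformDr, bformNl, bformNr, bformZr, bformZl) e1 e2.
  rewrite (bformC (C y *m x) s ST).
  set X1 := bform s Sy s; set X2 := bform s Sy (C y *m x).
  set X3 := bform (C y *m x) Sy (C y *m x); set X4 := bform x Sy (f1 y).
  set X5 := bform x Sy (B1 y *m x); set X6 := bform x Sy x.
  (* Three nonnegative terms: [q_ge] at the vector [al y], the curvature term [- X5], and the square
     of [sigma + C al] in the form [S]. *)
  move=> q0 B0 sq; rewrite [leRHS](_ : _ = psi y * ((q y - 2 * X4 + phi2 y * X6)
    - X5 + (X1 + X2 + (X2 + X3)))); last by ring.
  by apply: mulr_ge0; [exact: ltW|lra].
have cE : continuous (fun y => psi y * (bform (f y) (S y) (f y) - q y)).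
  move=> y; apply: cvgM; first exact: cpsi.
  by apply: cvgB; [exact: continuous_bform|exact: cq].
have cp : mxcont (fun y => psi y *: (S y *m f y)).
  by apply: mxcontZ => //; exact: mxcontM.
have cpv : continuous (fun y => bform v 1%:M (psi y *: (S y *m f y))).
  by apply: continuous_bform => //; exact: mxcont_cst.
have cMv : continuous (fun y => bform v (psi y *: S y) v).
  by apply: continuous_bform => //; exact: mxcont_cst.
rewrite -subr_ge0; apply: le_trans tau_ge0 _.
rewrite (_ : integ a b tau = 2 * bform v 1%:M p - bform v M v -
  integ a b (fun y => psi y * (bform (f y) (S y) (f y) - q y))).
  rewrite lerD2r bform_invmx// -/v.
  have -> : p = M *m v by rewrite /v mulKVmx// posdef_unit.
  rewrite -bform_mulr mul1mx; lra.
rewrite /M -integ_bform// (_ : bform v 1%:M p =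
    integ a b (fun y => bform v 1%:M (psi y *: (S y *m f y)))); last first.
  by rewrite /bform -integ_mulmx// [LHS]mxE.
have c2 : continuous (fun y => 2 * bform v 1%:M (psi y *: (S y *m f y))).
  by move=> y; apply: cvgM; [exact: cvg_cst|exact: cpv].
have c3 : continuous (fun y => 2 * bform v 1%:M (psi y *: (S y *m f y)) -
    bform v (psi y *: S y) v).
  by move=> y; apply: cvgB; [exact: c2|exact: cMv].
rewrite -integZ// -integB// -integB//.
apply: eq_integ => y _; rewrite /tau /sigma.
have ST := (Sp y).1.
rewrite !(bformDl, bformDr, bformNl, bformNr, bformZr, bformZm).
rewrite -[bform v 1%:M _]bform_mulr mul1mx.
by rewrite (bformC (f y) v ST); ring.
Qed.
End BrascampLieb.

(** * Uniform estimates and differentiability *)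

Section UniformEstimates.
Context {R : realType}.

(** Only [x] has to lie in [K]. The second point may leave it, as happens when a parameter in a ball
    is displaced. *)
Lemma compact_unif_continuous (V : normedModType R) (K : set V) (f : V -> R) :
  compact K -> (forall x, K x -> {for x, continuous f}) ->
  forall e : R, 0 < e -> exists2 d : R, 0 < d &
    forall x y, K x -> `|x - y| < d -> `|f x - f y| < e.
Proof.
move=> /compact_near_coveringP cK cf e e0.
have e2 : 0 < e / 2 by rewrite divr_gt0.
have := cK _ (0^'+ : set_system R)
  (fun d x => forall y, `|x - y| < d -> `|f x - f y| < e) _.
have H x : K x -> \forall x' \near x & d \near 0^'+,
    forall y, `|x' - y| < d -> `|f x' - f y| < e.
  move=> Kx; have /cvgrPdist_lt/(_ _ e2)/nbhs_normP[r /= r0 hr] := cf x Kx.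
  have r2 : 0 < r / 2 by rewrite divr_gt0.
  exists (ball x (r / 2), [set d | d < r / 2]).
    split; first exact: nbhsx_ballx.
    exact: nbhs_right_lt.
  move=> [x' d] /= [xx' dr] y x'y; rewrite -ball_normE/= in xx'.
  have h1 : `|f x - f x'| < e / 2.
    by apply: hr => /=; apply: (lt_trans xx'); lra.
  have h2 : `|f x - f y| < e / 2.
    apply: hr => /=; rewrite -(subrK x' x) -addrA.
    by apply: (le_lt_trans (ler_normD _ _)); move: xx' x'y dr => /= *; lra.
  rewrite -(subrK (f x) (f x')) -addrA.
  apply: (le_lt_trans (ler_normD _ _)); rewrite distrC in h1; lra.
move=> /(_ _ H) [d /= d0 hd].
exists (d / 2); first by rewrite divr_gt0.
move=> x y Kx; apply: hd => //=; last by rewrite divr_gt0.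
by rewrite sub0r normrN gtr0_norm ?divr_gt0//; lra.
Qed.

Lemma is_derive_eps (V : normedModType R) (f : V -> R) (x v : V) (l : R) :
  (forall e : R, 0 < e -> exists2 d : R, 0 < d &
    forall h : R, `|h| < d -> `|f (x + h *: v) - f x - h * l| <= e * `|h|) ->
  is_derive x v f l.
Proof.
move=> H.
have C : (fun h => h^-1 *: ((f \o shift x) (h *: v) - f x)) @ 0^' --> l.
  apply/cvgrPdist_le => e e0; have [d d0 hd] := H e e0.
  exists d => //= h; rewrite /= sub0r normrN => hh h0.
  rewrite -[l](mulKf h0) -[_ *: _]/(_ * _) -mulrBr normrM normfV.
  rewrite ler_pdivrMl ?normr_gt0// mulrC distrC [h *: v + x]addrC.
  by rewrite /= [l * h]mulrC [_ * e]mulrC; exact: hd.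
by apply: DeriveDef; [apply/cvg_ex; exists l|exact: cvg_lim].
Qed.

Lemma is_derive_line (V : normedModType R) (f : V -> R) (x v : V) (s l : R) :
  is_derive (x + s *: v) v f l -> is_derive s 1 (fun s => f (x + s *: v)) l.
Proof.
move=> [D E]; have S : (fun h : R => h^-1 *: (((fun s => f (x + s *: v)) \o shift s)
    (h *: (1 : R)) - f (x + s *: v))) =
    (fun h => h^-1 *: ((f \o shift (x + s *: v)) (h *: v) - f (x + s *: v))).
  apply/funext => h /=; rewrite [h *: 1]mulr1 scalerDl.
  by rewrite addrCA.
by apply: DeriveDef; [rewrite /derivable S|rewrite /derive S].
Qed.

Lemma mvt_signed (f df : R -> R) : (forall s : R, is_derive s 1 f (df s)) ->
  forall h, exists2 c, `|c| <= `|h| & f h - f 0 = h * df c.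
Proof.
move=> H h; have [h0|h0|->] := ltgtP h 0; last first.
- by exists 0; rewrite ?subrr ?mul0r.
- have [c /andP[c0 ch] E] := mvt h0 (fun s _ => H s).
  exists c; first by rewrite !gtr0_norm// ltW.
  by rewrite subr0 mulrC in E.
- have [c /andP[hc c0] E] := mvt h0 (fun s _ => H s).
  exists c; first by rewrite !ltr0_norm// lerN2 ltW.
  by move: E; rewrite sub0r => E; rewrite -opprB E; ring.
Qed.
End UniformEstimates.

Section Differentiability.
Context {R : realType} {V : normedModType R}.

Lemma differentiable_eps (f : V -> R) (x : V) : differentiable f x ->
  forall e : R, 0 < e -> exists2 d : R, 0 < d &
    forall h, `|h| < d -> `|f (x + h) - f x - 'd f x h| <= e * `|h|.
Proof.
move=> /diff_locally/eqaddoP df e e0; have /nbhs_normP[d /= d0 hd] := df e e0.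
exists d => // h hh; rewrite -addrA -opprD [x + h]addrC.
by apply: hd => /=; rewrite sub0r normrN.
Qed.

(** Differentiability along [v], uniform on every ball: one step size must serve all points of a
    grid when derivatives are replaced by difference quotients. *)
Definition udiff (v : V) (f f' : V -> R) := forall r e : R, 0 < e ->
  exists2 d : R, 0 < d & forall (h : R) t, `|h| < d -> `|t| <= r ->
    `|f (t + h *: v) - f t - h * f' t| <= e * `|h|.

Lemma udiff_derive (v : V) (f f' : V -> R) t :
  udiff v f f' -> is_derive t v f (f' t).
Proof.
move=> H; apply: is_derive_eps => e e0; have [d d0 hd] := H `|t| e e0.
by exists d => // h hh; exact: hd.
Qed.

End Differentiability.

(** * Averages over a grid *)

Section GridAverage.
Context {R : realType} {m : nat}.
Variables (d : R) (K : nat).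
Hypothesis d_gt0 : 0 < d.
Hypothesis K_gt0 : (0 < K)%N.
Let h := K%:R * d.
Notation e_ k := (delta_mx (0 : 'I_1) k : 'rV[R]_m).
Implicit Types (f g : 'rV[R]_m -> R) (s : seq 'I_m) (t w : 'rV[R]_m).

(** A discrete substitute for the average over a segment of length [h] starting at [t]. Iterated
    over a list of directions it replaces the mean over a cube, without integrals in several
    variables. *)
Definition grid_avg1 k f t := K%:R^-1 * \sum_(i < K) f (t + (i%:R * d) *: e_ k).
Definition grid_avg s f := foldr grid_avg1 f s.
Definition diffq k f t := (f (t + d *: e_ k) - f t) / d.

Let K0 : K%:R != 0 :> R. Proof. by rewrite pnatr_eq0 -lt0n. Qed.
Let h_gt0 : 0 < h. Proof. by rewrite mulr_gt0// ltr0n. Qed.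

Lemma norm_delta_mx_le k : `|e_ k| <= 1.
Proof.
rewrite /Num.norm/= mx_normrE; apply/bigmax_leP; split => // -[i j] _ /=.
by rewrite mxE; case: andP => _ /=; rewrite ?normr0 ?normr1.
Qed.

Lemma grid_avg1D k f g t :
  grid_avg1 k (fun t => f t + g t) t = grid_avg1 k f t + grid_avg1 k g t.
Proof. by rewrite /grid_avg1 big_split mulrDr. Qed.

Lemma grid_avg1Z k f c t :
  grid_avg1 k (fun t => c * f t) t = c * grid_avg1 k f t.
Proof. by rewrite /grid_avg1 -mulr_sumr mulrCA. Qed.

Lemma grid_avgD s f g t :
  grid_avg s (fun t => f t + g t) t = grid_avg s f t + grid_avg s g t.
Proof.
elim: s t => //= k s IH t; rewrite -grid_avg1D; congr grid_avg1.
by apply/funext => z; rewrite IH.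
Qed.

Lemma grid_avgZ s f c t :
  grid_avg s (fun t => c * f t) t = c * grid_avg s f t.
Proof.
elim: s t => //= k s IH t; rewrite -grid_avg1Z; congr grid_avg1.
by apply/funext => z; rewrite IH.
Qed.

Lemma grid_avg_cst s c t : grid_avg s (fun=> c) t = c.
Proof.
elim: s t => //= k s IH t; rewrite /grid_avg1.
under eq_bigr do rewrite IH.
by rewrite sumr_const card_ord -[c *+ K]mulr_natl mulKf.
Qed.

Lemma grid_avg_shift s f w t :
  grid_avg s (fun t => f (t + w)) t = grid_avg s f (t + w).
Proof.
elim: s t => //= k s IH t; rewrite /grid_avg1; congr (_ * _).
by apply: eq_bigr => i _; rewrite IH addrAC.
Qed.

Lemma grid_avg_sum n s (F : 'I_n -> 'rV[R]_m -> R) t :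
  grid_avg s (fun t => \sum_i F i t) t = \sum_i grid_avg s (F i) t.
Proof.
elim: n F => [|n IH] F.
  rewrite big_ord0 (_ : (fun=> _) = fun=> 0) ?grid_avg_cst//.
  by apply/funext => z; rewrite big_ord0.
rewrite big_ord_recl -IH -grid_avgD; congr grid_avg.
by apply/funext => z; rewrite big_ord_recl.
Qed.

Lemma le_grid_avg s f g t :
  (forall t', `|t' - t| <= (size s)%:R * h -> f t' <= g t') ->
  grid_avg s f t <= grid_avg s g t.
Proof.
elim: s t => [|k s IH] t H /=; first by apply: H; rewrite subrr normr0 mul0r.
rewrite /grid_avg1 ler_pM2l ?invr_gt0 ?ltr0n//.
apply: ler_sum => i _; apply: IH => t' ht'; apply: H => /=.
rewrite -(subrK (t + (i%:R * d) *: e_ k) t') -addrA.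
apply: (le_trans (ler_normD _ _)).
rewrite -natr1 mulrDl mul1r lerD// [t + _]addrC addrK normrZ.
rewrite -[leRHS]mulr1 ler_pM ?norm_delta_mx_le//.
by rewrite ger0_norm ?mulr_ge0 ?ler0n ?(ltW d_gt0)// /h ler_pM2r// ler_nat ltnW.
Qed.

Lemma grid_avg_norm s f t c :
  (forall t', `|t' - t| <= (size s)%:R * h -> `|f t'| <= c) ->
  `|grid_avg s f t| <= c.
Proof.
move=> H; rewrite ler_norml -{1}(grid_avg_cst s (- c) t).
rewrite -{2}(grid_avg_cst s c t).
by apply/andP; split; apply: le_grid_avg => t' /H; rewrite ler_norml => /andP[].
Qed.

(** The difference quotient has the step of the grid, so the sum telescopes to a difference over the
    full length [h]. The small denominator [d] is traded for [h]. *)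
Lemma grid_avg1_diffq k f t :
  grid_avg1 k (diffq k f) t = (f (t + h *: e_ k) - f t) / h.
Proof.
rewrite /grid_avg1 /diffq -mulr_suml.
rewrite (eq_bigr (fun i : 'I_K => (fun j : nat => f (t + (j%:R * d) *: e_ k)) i.+1 -
   (fun j : nat => f (t + (j%:R * d) *: e_ k)) i)); last first.
  move=> i _ /=; rewrite -natr1 mulrDl mul1r scalerDl.
  by rewrite addrA.
rewrite -(big_mkord xpredT (fun i => f (t + (i.+1%:R * d) *: e_ k) -
  f (t + (i%:R * d) *: e_ k))) telescope_sumr//.
by rewrite mul0r scale0r addr0 mulrCA -invfM.
Qed.

Lemma grid_avg_diffq s k f t :
  grid_avg s (diffq k f) t = diffq k (grid_avg s f) t.
Proof.
rewrite /diffq -grid_avg_shift mulrC.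
rewrite -mulN1r -grid_avgZ -grid_avgD -grid_avgZ; congr grid_avg.
by apply/funext => z; rewrite mulN1r mulrC.
Qed.

(* Summation by parts: the inner differences telescope along direction [k]. *)
Lemma grid_avg_diffq_le s k f t c : k \in s ->
  (forall t', `|t' - t| <= (size s).+1%:R * h -> `|f t'| <= c) ->
  `|grid_avg s (diffq k f) t| <= 2 * c / h.
Proof.
elim: s t => // j s IH t /=; rewrite in_cons => /predU1P[<-{j}|ks] H.
  rewrite (_ : grid_avg s (diffq k f) = diffq k (grid_avg s f)); last first.
    by apply/funext => z; exact: grid_avg_diffq.
  rewrite grid_avg1_diffq normrM [`|h^-1|]gtr0_norm ?invr_gt0//.
  rewrite ler_pM2r ?invr_gt0// (le_trans (ler_normB _ _))//.
  rewrite mulrDl mul1r; apply: lerD; apply: grid_avg_norm => t' ht'; apply: H.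
    rewrite -(subrK (t + h *: e_ k) t') -addrA (le_trans (ler_normD _ _))//.
    rewrite -[(size s).+2%:R]natr1 [leRHS]mulrDl mul1r lerD//.
      by rewrite (le_trans ht')// ler_pM2r// ler_nat.
    rewrite [t + _]addrC addrK normrZ gtr0_norm//.
    by rewrite -[leRHS]mulr1 ler_pM2l// norm_delta_mx_le.
  by rewrite (le_trans ht')// ler_pM2r// ler_nat ltnW// ltnW.
rewrite -/(grid_avg1 j _ t).
rewrite (_ : grid_avg1 j _ t = grid_avg [:: j] (grid_avg s (diffq k f)) t)//.
apply: grid_avg_norm => t1 ht1; apply: IH => // t' ht'; apply: H.
rewrite -(subrK t1 t') -addrA (le_trans (ler_normD _ _))//.
rewrite -[(size s).+2%:R]natr1 [leRHS]mulrDl mul1r lerD//.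
by rewrite mul1r in ht1.
Qed.
End GridAverage.

(** * Passing a bound on a divergence to a uniform limit *)

Section UniformLimit.
Context {R : realType} {m : nat}.
Notation V := 'rV[R]_m.
Notation e_ k := (delta_mx (0 : 'I_1) k : 'rV[R]_m).

(* A sequence together with its limit: [None] indexes the limit. *)
Definition ucvg (r : R) (f : option nat -> V -> R) := forall e : R, 0 < e ->
  exists N, forall n, (N <= n)%N -> forall t, `|t| <= r ->
    `|f (Some n) t - f None t| <= e.

Lemma uniform_choice (n : nat) (P : 'I_n -> R -> Prop) :
  (forall i, exists2 d : R, 0 < d & forall d' : R, 0 < d' <= d -> P i d') ->
 
  exists2 d : R, 0 < d & forall i, P i d.
Proof.
move=> H; have h i : {d : R | 0 < d /\ forall d', 0 < d' <= d -> P i d'}.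
  by apply/cid; have [d d0 hd] := H i; exists d.
exists (\big[Num.min/1]_i sval (h i)).
  by apply: lt_bigmin => // i _; case: (h i) => d [].
move=> i; apply: (svalP (h i)).2; apply/andP; split; last exact: bigmin_le_cond.
by apply: lt_bigmin => // j _; case: (h j) => d' [].
Qed.

(** On a cube of side [h] with corner [t0], [W k (Some n)] differs from the affine part of the limit
    at [t0] by [O(e * h)], by differentiability of the limit and uniform convergence. Averaged
    difference quotients see only boundary values divided by [h], so they are off by [O(e)],
    although the derivatives [W'] need not converge. *)
Lemma divergence_limit (t0 : V) (W : 'I_m -> option nat -> V -> R)
    (W' : 'I_m -> nat -> V -> R) (c : R) :
  (forall k, differentiable (W k None) t0) ->
  (forall k r, ucvg r (W k)) ->
  (forall k n, udiff (e_ k) (W k (Some n)) (W' k n)) ->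
  (forall e : R, 0 < e -> exists2 rho : R, 0 < rho & exists N, forall n, (N <= n)%N ->
    forall t, `|t - t0| <= rho -> \sum_k W' k n t <= c + e) ->
  \sum_k 'd (W k None) t0 (e_ k) <= c.
Proof.
move=> dW cW uW W'le.
(* One [e] comes from the bound [c + e], one per direction from passing between derivatives and
   difference quotients in [step2], and [2 * (1 + m.+1)] per direction from [step1]. *)
pose C : R := 1 + m%:R + m%:R * (2 * (1 + m.+1%:R)).
have C0 : 0 < C by rewrite /C ltr_wpDr ?mulr_ge0 ?addr_ge0// ltr_pwDl.
suff H e : 0 < e -> \sum_k 'd (W k None) t0 (e_ k) <= c + C * e.
  apply/ler_addgt0Pr => e e0; have := H (e / C) (divr_gt0 e0 C0).
  by rewrite mulrCA mulfV ?mulr1// gt_eqF.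
move=> e0; have [rho rho0 [N hN]] := W'le e e0.
have [d1 d10 hd1] : exists2 d1 : R, 0 < d1 & forall k h, `|h| < d1 ->
    `|W k None (t0 + h) - W k None t0 - 'd (W k None) t0 h| <= e * `|h|.
  apply: uniform_choice => k.
  have [d d0 hd] := differentiable_eps (dW k) e0; exists d => // d' /andP[_ dd'] h hh.
  by apply: hd; exact: lt_le_trans dd'.
pose b := Num.min (Num.min rho 1) (d1 / 2).
have b0 : 0 < b by rewrite !lt_min rho0 ltr01 divr_gt0.
(* The grid together with its translate by [h] in one direction stays within [m.+1 * h = b] of
   [t0]. *)
pose h := b / m.+1%:R.
have h0 : 0 < h by rewrite divr_gt0.
have hb : m.+1%:R * h = b by rewrite mulrCA mulfV ?mulr1// pnatr_eq0.
clearbody h.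
have [n Nn hn] : exists2 n, (N <= n)%N & forall k t, `|t| <= `|t0| + 1 ->
    `|W k (Some n) t - W k None t| <= e * h.
  have g k : {M | forall n, (M <= n)%N -> forall t, `|t| <= `|t0| + 1 ->
      `|W k (Some n) t - W k None t| <= e * h}.
    by apply/cid; apply: cW; rewrite mulr_gt0.
  exists (maxn N (\max_k sval (g k))); first exact: leq_maxl.
  move=> k t ht; have := svalP (g k) (maxn N (\max_k sval (g k))); apply => //.
  by rewrite leq_max (leq_bigmax k) orbT.
have [d2 d20 hd2] : exists2 d2 : R, 0 < d2 & forall k (l : R) t, `|l| < d2 ->
    `|t| <= `|t0| + 1 ->
    `|W k (Some n) (t + l *: e_ k) - W k (Some n) t - l * W' k n t| <= e * `|l|.
  apply: uniform_choice => k.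
  have [d d0 hd] := uW k n (`|t0| + 1) e e0; exists d => // d' /andP[_ dd'] l t hl ht.
  by apply: hd => //; exact: lt_le_trans dd'.
(* The order of choices matters: [n] depends on [h], and [d2] on [n]. The mesh [d = h / K] is
   therefore refined last, with the cube fixed. *)
pose K := (Num.truncn (h / d2)).+1.
have K0 : 0 < K%:R :> R by rewrite ltr0n.
pose d := h / K%:R.
have d0 : 0 < d by rewrite divr_gt0.
have dd2 : d < d2.
  by rewrite ltr_pdivrMr// mulrC -ltr_pdivrMr// truncnS_gt.
have Kd : K%:R * d = h by rewrite mulrCA mulfV ?mulr1// gt_eqF.
pose s := enum 'I_m.
have ss : size s = m by rewrite size_enum_ord.
have near_t0 t : `|t - t0| <= b -> `|t| <= `|t0| + 1.
  move=> ht; rewrite -(subrK t0 t) addrC (le_trans (ler_normD _ _))// lerD2l.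
  by rewrite (le_trans ht)// !ge_min lexx orbT.
have lin k t : diffq d k (fun t => 'd (W k None) t0 (t - t0)) t = 'd (W k None) t0 (e_ k).
  rewrite /diffq addrAC linearD/= addrAC subrr add0r linearZ/=.
  by rewrite -[_ *: _]/(_ * _) mulrAC mulfV ?mul1r// gt_eqF.
have step1 k : 'd (W k None) t0 (e_ k) - 2 * (1 + m.+1%:R) * e <=
    grid_avg d K s (diffq d k (W k (Some n))) t0.
  pose f t := W k (Some n) t - W k None t0 - 'd (W k None) t0 (t - t0).
  have E : diffq d k (W k (Some n)) =
      fun t => 'd (W k None) t0 (e_ k) + diffq d k f t.
    apply/funext => t; rewrite -(lin k t) /diffq /f; field.
    by rewrite gt_eqF.
  rewrite E grid_avgD grid_avg_cst// lerD2l.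
  have : `|grid_avg d K s (diffq d k f) t0| <=
      2 * ((1 + m.+1%:R) * (e * h)) / (K%:R * d).
    apply: grid_avg_diffq_le => //; first by rewrite mem_enum.
    move=> t; rewrite ss Kd hb => ht.
    rewrite (_ : f t = (W k (Some n) t - W k None t) +
      (W k None (t0 + (t - t0)) - W k None t0 - 'd (W k None) t0 (t - t0))); last first.
      by rewrite [t0 + _]addrC subrK /f; ring.
    rewrite (le_trans (ler_normD _ _))// mulrDl mul1r lerD//.
      by apply: hn; exact: near_t0.
    apply: (le_trans (hd1 k _ _)).
      rewrite (le_lt_trans ht)// /b gt_min; apply/orP; right; lra.
    by rewrite mulrCA ler_pM2l// hb.
  rewrite Kd !mulrA mulfK ?gt_eqF// ler_norml => /andP[+ _].
  by apply: le_trans; rewrite lerN2.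
have step2 k : grid_avg d K s (diffq d k (W k (Some n))) t0 <=
    grid_avg d K s (W' k n) t0 + e.
  rewrite -[X in _ <= _ + X](@grid_avg_cst R m d K isT s e t0).
  rewrite -grid_avgD; apply: le_grid_avg => // t; rewrite ss Kd => ht.
  rewrite /diffq ler_pdivrMr// mulrDl.
  have : `|t - t0| <= b.
    by rewrite (le_trans ht)// -hb ler_pM2r// ler_nat.
  move/near_t0 => ht0; have := hd2 k d t; rewrite gtr0_norm// => /(_ dd2 ht0).
  by rewrite ler_norml => /andP[_]; lra.
have step3 : \sum_k grid_avg d K s (W' k n) t0 <= c + e.
  rewrite -grid_avg_sum//.
  apply: (@le_trans _ _ (grid_avg d K s (fun=> c + e) t0)); last by rewrite grid_avg_cst.
  apply: le_grid_avg => // t; rewrite ss Kd => ht; apply: hN => //.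
  rewrite (le_trans ht)//; apply: (@le_trans _ _ b); last by rewrite !ge_min lexx.
  by rewrite -hb ler_pM2r// ler_nat.
have : \sum_k ('d (W k None) t0 (e_ k) - 2 * (1 + m.+1%:R) * e - e) <= c + e.
  apply: le_trans step3; apply: ler_sum => k _.
  by rewrite lerBlDr; exact: le_trans (step1 k) (step2 k).
rewrite !big_split /= !sumr_const card_ord /C.
rewrite -[(- (_ * e)) *+ m]mulr_natl -[(- e) *+ m]mulr_natl.
by move: (\sum_k _) (m%:R) (m.+1%:R) => x y z; clear; lra.
Qed.
End UniformLimit.

(** * Closure properties of uniform convergence on balls *)

Section UniformConvergenceClosure.
Context {R : realType} {m : nat}.
Notation V := 'rV[R]_m.

Lemma compact_norm_ball (r : R) : compact [set t : V | `|t| <= r].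
Proof.
apply: bounded_closed_compact.
  exists r; split; first exact: num_real.
  by move=> M rM t /= tr; rewrite (le_trans tr)// ltW.
apply: (@closed_comp _ _ (fun t : V => `|t|) [set x : R | x <= r]).
  by move=> t _; exact: norm_continuous.
exact: closed_le.
Qed.

Lemma continuous_bounded_ball (f : V -> R) (r : R) : continuous f ->
  exists C, forall t, `|t| <= r -> `|f t| <= C.
Proof.
move=> cf; have : compact (f @` [set t | `|t| <= r]).
  apply: continuous_compact; last exact: compact_norm_ball.
  exact: continuous_subspaceT.
move=> /compact_bounded[C [_ hC]]; exists (C + 1) => t tr.
by apply: (hC (C + 1)); rewrite ?ltrDl//; exists t.
Qed.

(** The bound on the limit makes the property stable under products. Pairing the index with the
    point makes these functions of one variable, to which the closure lemmas for matrix products and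
    inverses apply. *)
Definition bucvg (r : R) (f : option nat * V -> R) :=
  (exists C, forall t, `|t| <= r -> `|f (None, t)| <= C) /\
  ucvg r (fun o t => f (o, t)).

Variable r : R.

Lemma bucvg_cst c : bucvg r (fun=> c).
Proof.
split; first by exists `|c|.
by move=> e e0; exists 0%N => n _ t _; rewrite subrr normr0 ltW.
Qed.

Lemma bucvgD f g : bucvg r f -> bucvg r g -> bucvg r (fun x => f x + g x).
Proof.
move=> [[C1 h1] u1] [[C2 h2] u2]; split.
  exists (C1 + C2) => t tr; rewrite (le_trans (ler_normD _ _))//.
  by rewrite lerD ?h1 ?h2.
move=> e e0; have e2 : 0 < e / 2 by rewrite divr_gt0.
have [N1 H1] := u1 _ e2; have [N2 H2] := u2 _ e2.
exists (maxn N1 N2) => n; rewrite geq_max => /andP[n1 n2] t tr.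
rewrite opprD addrACA (le_trans (ler_normD _ _))//.
by have := H1 n n1 t tr; have := H2 n n2 t tr => /=; lra.
Qed.

Lemma bucvgM f g : bucvg r f -> bucvg r g -> bucvg r (fun x => f x * g x).
Proof.
move=> [[C1 h1] u1] [[C2 h2] u2]; split.
  by exists (C1 * C2) => t tr; rewrite normrM ler_pM ?h1 ?h2.
pose C : R := `|C1| + `|C2| + 2.
have C0 : 0 < C by rewrite /C ltr_pwDr ?addr_ge0.
move=> e e0; pose e' : R := Num.min 1 (e / C).
have e'0 : 0 < e' by rewrite lt_min ltr01 divr_gt0.
have [N1 H1] := u1 _ e'0; have [N2 H2] := u2 _ e'0.
exists (maxn N1 N2) => n; rewrite geq_max => /andP[n1 n2] t tr.
have a1 := H1 n n1 t tr; have a2 := H2 n n2 t tr.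
have b1 : `|f (None, t)| <= `|C1| := le_trans (h1 t tr) (ler_norm _).
have b2 : `|g (None, t)| <= `|C2| := le_trans (h2 t tr) (ler_norm _).
set x := f (Some n, t) in a1 *; set y := f (None, t) in a1 b1 *.
set z := g (Some n, t) in a2 *; set w := g (None, t) in a2 b2 *.
have -> : x * z - y * w = (x - y) * (z - w) + (x - y) * w + y * (z - w) by ring.
have le1 : e' <= 1 by rewrite ge_min lexx.
have leC : e' * C <= e.
  by rewrite -[leRHS](divfK (lt0r_neq0 C0)) ler_pM2r// ge_min lexx orbT.
apply: (@le_trans _ _ (e' * 1 + e' * `|C2| + `|C1| * e')).
  rewrite (le_trans (ler_normD _ _))// lerD//; last by rewrite normrM ler_pM.
  rewrite (le_trans (ler_normD _ _))// lerD//; last by rewrite normrM ler_pM.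
  by rewrite normrM ler_pM// (le_trans a2).
apply: le_trans leC; rewrite /C; lra.
Qed.

Lemma bucvgV f : (forall t, `|t| <= r -> f (None, t) != 0) ->
  (exists C, forall t, `|t| <= r -> `|(f (None, t))^-1| <= C) ->
  bucvg r f -> bucvg r (fun x => (f x)^-1).
Proof.
move=> f0 [C hC] [_ u]; split; first by exists C.
pose D : R := `|C| + 1; have D0 : 0 < D by rewrite ltr_wpDl.
(* The first term keeps the approximating values above half of the lower bound [1 / D] for the
   limit; the second absorbs the product of the two denominators. *)
move=> e e0; pose e' : R := Num.min (1 / (2 * D)) (e / (2 * D ^+ 2)).
have D20 : 0 < 2 * D ^+ 2 by rewrite mulr_gt0// exprn_gt0.
have e'0 : 0 < e' by rewrite lt_min !divr_gt0// mulr_gt0.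
have [N H] := u _ e'0; exists N => n Nn t tr.
have a1 := H n Nn t tr; have a0 := f0 t tr.
set y := f (None, t) in a1 a0 *; set x := f (Some n, t) in a1 *.
have yD : 1 / D <= `|y|.
  rewrite div1r -[`|y|]invrK lef_pV2 ?posrE// ?invr_gt0 ?normr_gt0//.
  rewrite -normfV (le_trans (hC t tr))// (le_trans (ler_norm _))//.
  by rewrite /D lerDl.
have half : 1 / D = 1 / (2 * D) + 1 / (2 * D).
  by field; rewrite gt_eqF.
have xD : 1 / (2 * D) <= `|x|.
  have : `|y| - `|x| <= 1 / (2 * D).
    rewrite (le_trans (lerB_dist _ _))// distrC (le_trans a1)//.
    by rewrite ge_min lexx.
  move: yD; rewrite half; lra.
have x0 : x != 0.
  by rewrite -normr_gt0 (lt_le_trans _ xD)// divr_gt0// mulr_gt0.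
rewrite (_ : x^-1 - y^-1 = (y - x) / (x * y)); last by field; rewrite x0 a0.
rewrite normrM normfV normrM ler_pdivrMr ?mulr_gt0 ?normr_gt0//.
rewrite distrC (le_trans a1)// (@le_trans _ _ (e / (2 * D ^+ 2)))//.
  by rewrite ge_min lexx orbT.
rewrite ler_pM2l// (_ : _^-1 = 1 / (2 * D) * (1 / D)).
  by rewrite ler_pM// ltW// divr_gt0// mulr_gt0.
by field; rewrite gt_eqF.
Qed.

Lemma bucvg_continuous f : continuous (fun t => f (None, t)) ->
  ucvg r (fun o t => f (o, t)) -> bucvg r f.
Proof. by move=> /continuous_bounded_ball H; split. Qed.

Lemma bucvg_mulmx p q s (F : option nat * V -> 'M[R]_(p, q))
    (G : option nat * V -> 'M[R]_(q, s)) :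
  (forall a b, bucvg r (fun x => F x a b)) -> (forall a b, bucvg r (fun x => G x a b)) ->
  forall a b, bucvg r (fun x => (F x *m G x) a b).
Proof. exact: (@closed_mulmx R _ (bucvg r) bucvg_cst bucvgD bucvgM). Qed.

Lemma bucvg_sum (I : Type) (s : seq I) (F : I -> option nat * V -> R) :
  (forall i, bucvg r (F i)) -> bucvg r (fun x => \sum_(i <- s) F i x).
Proof. exact: (@closed_sum R _ (bucvg r) bucvg_cst bucvgD). Qed.

Lemma bucvg_bform n (u v : option nat * V -> 'cV[R]_n) (F : option nat * V -> 'M[R]_n) :
  (forall a b, bucvg r (fun x => u x a b)) ->
  (forall a b, bucvg r (fun x => F x a b)) ->
  (forall a b, bucvg r (fun x => v x a b)) ->
  bucvg r (fun x => bform (u x) (F x) (v x)).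
Proof.
move=> hu hF hv; rewrite /bform; apply: bucvg_mulmx => //; apply: bucvg_mulmx => //.
by move=> a b; rewrite (_ : (fun=> _) = fun x => u x b a)//; apply/funext => x; rewrite mxE.
Qed.

Lemma bucvg_invmx n (F : option nat * V -> 'M[R]_n) :
  (forall a b, bucvg r (fun x => F x a b)) -> (forall x, F x \in unitmx) ->
  (forall a b, continuous (fun t => F (None, t) a b)) ->
  forall a b, bucvg r (fun x => invmx (F x) a b).
Proof.
move=> bF Fu cF a b.
apply: (@closed_invmx R _ (bucvg r) bucvg_cst bucvgD bucvgM) => //.
have det0 x : \det (F x) != 0 by have := Fu x; rewrite unitmxE unitfE.
apply: bucvgV => //.
  apply: continuous_bounded_ball => t.
  exact: (cvgV (det0 (None, t)) (@continuous_det R V n (fun t => F (None, t)) cF t)).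
exact: (@closed_det R _ (bucvg r) bucvg_cst bucvgD bucvgM n F bF).
Qed.

(* Derivatives of convex functions converge with the functions, since they are
   squeezed between difference quotients. *)
Lemma convex_derive_ucvg (v : V) (f f' : option nat -> V -> R) : `|v| <= 1 ->
  (forall o t, is_derive t v (f o) (f' o t)) -> continuous (f' None) ->
  (forall n t (s1 s2 : R), s1 <= s2 ->
    f' (Some n) (t + s1 *: v) <= f' (Some n) (t + s2 *: v)) ->
  ucvg (r + 1) f -> ucvg r f'.
Proof.
move=> v1 df cf' mono uf e e0.
have e2 : 0 < e / 2 by rewrite divr_gt0.
have [d d0 hd] := compact_unif_continuous (@compact_norm_ball (r + 1))
  (fun x _ => cf' x) e2.
pose s : R := Num.min 1 (d / 2).
have s0 : 0 < s by rewrite lt_min ltr01 divr_gt0.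
have s1 : s <= 1 by rewrite ge_min lexx.
have sd : s < d by rewrite gt_min; apply/orP; right; lra.
have svle c : `|c| <= s -> `|c *: v| <= s.
  by move=> cs; rewrite normrZ -[leRHS]mulr1 ler_pM.
(* Two values known up to [e * s / 4] determine a difference quotient of step [s] up to [e / 2]. The
   other half is the oscillation of [f' None] over that step. *)
have e4 : 0 < e * s / 4 by rewrite !(divr_gt0, mulr_gt0).
have [N H] := uf _ e4; exists N => n Nn t tr.
have tr1 c : `|c| <= s -> `|t + c *: v| <= r + 1.
  move=> cs; rewrite (le_trans (ler_normD _ _))// lerD//.
  by rewrite (le_trans (svle c cs)).
have ss : `|s| <= s by rewrite gtr0_norm.
have sn : `|- s| <= s by rewrite normrN.
have H0 := H n Nn t (le_trans tr _); rewrite lerDl ler01 in H0.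
have {}H0 := H0 isT.
have Hs := H n Nn _ (tr1 s ss); have Hn := H n Nn _ (tr1 (- s) sn).
have near_f' c : `|c| <= s -> `|f' None t - f' None (t + c *: v)| < e / 2.
  move=> cs; apply: hd; first by rewrite /= (le_trans tr)// lerDl.
  by rewrite opprD addrA subrr sub0r normrN (le_lt_trans (svle c cs)).
have line o (c : R) : is_derive c 1 (fun s => f o (t + s *: v)) (f' o (t + c *: v)).
  by apply: is_derive_line; exact: df.
have up o := mvt s0 (fun x (_ : 0 <= x <= s) => line o x).
have sneg : - s < 0 by rewrite oppr_lt0.
have dn o := mvt sneg (fun x (_ : - s <= x <= 0) => line o x).
have [c1 /andP[c10 c1s] E1] := up (Some n); have [c2 /andP[c20 c2s] E2] := up None.
have [c3 /andP[c30 c3s] E3] := dn (Some n); have [c4 /andP[c40 c4s] E4] := dn None.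
rewrite scale0r addr0 subr0 in E1; rewrite scale0r addr0 subr0 in E2.
rewrite scale0r addr0 sub0r opprK in E3; rewrite scale0r addr0 sub0r opprK in E4.
have t0E : t = t + 0 *: v by rewrite scale0r addr0.
have M1 := mono n t 0 c1 (ltW c10); have M2 := mono n t c3 0 (ltW c3s).
rewrite -t0E in M1 M2.
have N2 := near_f' c2; have N4 := near_f' c4.
have {}N2 : `|f' None t - f' None (t + c2 *: v)| < e / 2.
  by apply: N2; rewrite gtr0_norm// ltW.
have {}N4 : `|f' None t - f' None (t + c4 *: v)| < e / 2.
  by apply: N4; rewrite ltr0_norm// lerNl ltW.
move: H0 Hs Hn N2 N4; rewrite !ler_norml !ltr_norml.
move=> /andP[H01 H02] /andP[Hs1 Hs2] /andP[Hn1 Hn2] /andP[N21 N22] /andP[N41 N42].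
have U : f' (Some n) t <= f' None t + e.
  apply: (le_trans M1); rewrite -(ler_pM2r s0) -E1 mulrDl.
  have : f' None (t + c2 *: v) * s <= (f' None t + e / 2) * s.
    by rewrite ler_pM2r//; lra.
  rewrite -E2; lra.
have L : f' None t - e <= f' (Some n) t.
  apply: le_trans M2; rewrite -(ler_pM2r s0) -E3 mulrBl.
  have : (f' None t - e / 2) * s <= f' None (t + c4 *: v) * s.
    by rewrite ler_pM2r//; lra.
  rewrite -E4; lra.
by apply/andP; split; lra.
Qed.
End UniformConvergenceClosure.

(** * Passing the Nakano inequality to a uniform limit *)

Section NakanoLimit.
Context {R : realType} {m n : nat}.
Notation V := 'rV[R]_m.
Notation e_ k := (delta_mx (0 : 'I_1) k : 'rV[R]_m).
Variables (G : option nat -> V -> 'M[R]_n) (G1 : 'I_m -> option nat -> V -> 'M[R]_n).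
(** Second derivatives are indexed by [nat], not [option nat]: they belong to the approximants, and
    nothing is assumed about their limit. *)
Variables (G2 : 'I_m -> 'I_m -> nat -> V -> 'M[R]_n).
Hypothesis Gp : forall o t, posdef (G o t).
Hypothesis dG : forall j o t, mxder (G o) (G1 j o t) t (e_ j).
Hypothesis cG : mxcont (G None).
Hypothesis dG1 : forall j t a b, differentiable (fun t => G1 j None t a b) t.
Hypothesis uG1 : forall j k l a b,
  udiff (e_ k) (fun t => G1 j (Some l) t a b) (fun t => G2 j k l t a b).
Hypothesis uG : forall r a b, ucvg r (fun o t => G o t a b).
Hypothesis G2_sym : forall j k l t, G2 j k l t = G2 k j l t.
Hypothesis G2_nakano : forall l t (u : 'I_m -> 'cV[R]_n),
  let w := \sum_j G1 j (Some l) t *m u j in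
  \sum_k \sum_j bform (u k) (G2 j k l t) (u j) <= bform w (invmx (G (Some l) t)) w.

Let H o t := invmx (G o t).
Let Gu o t : G o t \in unitmx. Proof. exact: posdef_unit. Qed.
Let HT o t : (H o t)^T = H o t. Proof. exact: posdef_inv_tr. Qed.

Let G1T j o t : (G1 j o t)^T = G1 j o t.
Proof.
have h := mxder_tr (dG j o t); apply: (mxder_unique h).
by rewrite (_ : (fun z => (G o z)^T) = G o)//; apply/funext => z; rewrite (Gp o z).1.
Qed.

Let bG r a b : bucvg r (fun x => G x.1 x.2 a b).
Proof. by apply: bucvg_continuous; [exact: cG|exact: uG]. Qed.

Let bH r a b : bucvg r (fun x => H x.1 x.2 a b).
Proof.
apply: (@bucvg_invmx R m r n (fun x => G x.1 x.2)) => //.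
Qed.

Let cG1 j : mxcont (G1 j None).
Proof. by move=> a b t; apply: differentiable_continuous; exact: dG1. Qed.

Let H1 j o t := - (H o t *m G1 j o t *m H o t).

Let dH j o t : mxder (H o) (H1 j o t) t (e_ j).
Proof. exact: mxder_inv. Qed.

Let cH : mxcont (H None). Proof. exact: mxcont_invmx. Qed.

Let mxcontN p q (F : V -> 'M[R]_(p, q)) : mxcont F -> mxcont (fun t => - F t).
Proof.
move=> cF a b; rewrite (_ : (fun=> _) = fun t => - F t a b).
  by move=> t; exact: (cvgN (cF a b t)).
by apply/funext => z; rewrite mxE.
Qed.

Let cH1 j : mxcont (H1 j None).
Proof. by apply: mxcontN; do 2 apply: mxcontM => //. Qed.

Let quad_derive j o t x :
  is_derive t (e_ j) (fun t => bform x (H o t) x) (bform x (H1 j o t) x).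
Proof.
have := mxder_bform (mxder_cst x t (e_ j)) (dH j o t) (mxder_cst x t (e_ j)).
by rewrite bform0l bform0r add0r addr0.
Qed.

(* The case of a single nonzero [u j] of the Nakano inequality. *)
Let quad_mono j l t x (s1 s2 : R) : s1 <= s2 ->
  bform x (H1 j (Some l) (t + s1 *: e_ j)) x <=
  bform x (H1 j (Some l) (t + s2 *: e_ j)) x.
Proof.
move=> s12; pose o := Some l.
have dG1l z : mxder (G1 j o) (G2 j j l z) z (e_ j).
  by move=> a b; exact: (udiff_derive z (@uG1 j j l a b)).
pose H2 z := - (H o z *m G1 j o z *m H1 j o z +
  (H o z *m G2 j j l z + H1 j o z *m G1 j o z) *m H o z).
have dH1 z : mxder (H1 j o) (H2 z) z (e_ j).
  move=> a b; rewrite mxE (_ : (fun=> _) = fun z => - (H o z *m G1 j o z *m H o z) a b).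
    by apply: is_deriveN; exact: (mxderM (mxderM (dH j o z) (dG1l z)) (dH j o z)).
  by apply/funext => z'; rewrite mxE.
have dq z : is_derive z (e_ j) (fun z => bform x (H1 j o z) x) (bform x (H2 z) x).
  have := mxder_bform (mxder_cst x z (e_ j)) (dH1 z) (mxder_cst x z (e_ j)).
  by rewrite bform0l bform0r add0r addr0.
apply: (mvt_le s12 (fun s _ => is_derive_line (dq (t + s *: e_ j)))) => s _.
set z := t + s *: e_ j; pose y := H o z *m x.
have := G2_nakano l z (fun k => if k == j then y else 0).
have sum1 (T : zmodType) (F : 'I_m -> T) : (forall k, k != j -> F k = 0) ->
    \sum_k F k = F j.
  by move=> F0; rewrite (bigD1 j)//= [X in _ + X]big1 ?addr0.
rewrite /= [X in _ <= bform X _ _]sum1; last first.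
  by move=> k /negbTE ->; rewrite mulmx0.
rewrite [X in X <= _]sum1; last first.
  by move=> k /negbTE kj; rewrite big1// => i _; rewrite kj bform0l.
rewrite [X in X <= _]sum1; last by move=> k /negbTE ->; rewrite bform0r.
rewrite [X in _ <= bform _ _ X]sum1; last first.
  by move=> k /negbTE ->; rewrite mulmx0.
rewrite !eqxx -/o => nak.
have q0 := posdef_inv_ge0 (G1 j o z *m y) (Gp o z).
(* The Nakano inequality bounds the subtracted term by [bform (G1 y) H (G1 y)], half of the first
   one; the other half is nonnegative. *)
suff -> : bform x (H2 z) x =
    bform (G1 j o z *m y) (H o z) (G1 j o z *m y) * 2 - bform y (G2 j j l z) y.
  by rewrite /H; lra.
have E1 M : bform x (H o z *m M *m H o z) x = bform y M y.
  by rewrite bform_mulr bform_mull HT.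
have E2 : bform y (G1 j o z *m H o z *m G1 j o z) y =
    bform (G1 j o z *m y) (H o z) (G1 j o z *m y).
  by rewrite bform_mulr bform_mull G1T.
have H2E : H2 z = H o z *m (G1 j o z *m H o z *m G1 j o z) *m H o z +
    H o z *m (G1 j o z *m H o z *m G1 j o z) *m H o z - H o z *m G2 j j l z *m H o z.
  rewrite /H2 /H1 mulmxDl mulmxN !mulNmx !mulmxA opprD opprB opprK.
  by rewrite addrA.
rewrite H2E bformDm bformNm bformDm !E1 E2; ring.
Qed.

(** Convexity yields convergence of the quadratic forms of [H1]; polarization recovers the entries
    because [H1] is symmetric. *)
Let uH1 r j a b : ucvg r (fun o t => H1 j o t a b).
Proof.
have uq x : bucvg r (fun z => bform x (H1 j z.1 z.2) x).
  apply: bucvg_continuous => /=.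
    by apply: continuous_bform => //; exact: mxcont_cst.
  apply: (@convex_derive_ucvg R m r (e_ j) (fun o t => bform x (H o t) x)
    (fun o t => bform x (H1 j o t) x)).
  - exact: norm_delta_mx_le.
  - by move=> o t; exact: quad_derive.
  - by apply: continuous_bform => //; exact: mxcont_cst.
  - by move=> l t s1 s2; exact: quad_mono.
  - have [_] := @bucvg_bform R m (r + 1) n (fun=> x) (fun=> x) (fun z => H z.1 z.2)
      (fun a b => bucvg_cst (r + 1) (x a b)) (bH (r + 1))
      (fun a b => bucvg_cst (r + 1) (x a b)).
    by [].
pose e i : 'cV[R]_n := delta_mx i 0.
have eE M i k : bform (e i) M (e k) = M i k.
  by rewrite /bform trmx_delta -rowE -colE !mxE.
have H1T o t : (H1 j o t)^T = H1 j o t.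
  by rewrite /H1 linearN /= !trmx_mul HT G1T mulmxA.
have [_] : bucvg r (fun z => 2^-1 * (bform (e a + e b) (H1 j z.1 z.2) (e a + e b) +
    (-1) * (bform (e a) (H1 j z.1 z.2) (e a) + bform (e b) (H1 j z.1 z.2) (e b)))).
  apply: bucvgM; first exact: bucvg_cst.
  apply: bucvgD => //; apply: bucvgM; first exact: bucvg_cst.
  exact: bucvgD.
rewrite (_ : (fun o t => _) = fun o t => H1 j o t a b)//.
apply/funext => o; apply/funext => t /=.
have sym : H1 j o t b a = H1 j o t a b by rewrite -[in LHS](H1T o t) mxE.
by rewrite !(bformDl, bformDr) !eE sym; field.
Qed.

(** Convexity is available for the inverse [H], so convergence is carried back from it by
    [G1 = - G H1 G]. *)
Let bG1 r j a b : bucvg r (fun x => G1 j x.1 x.2 a b).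
Proof.
have bH1 a' b' : bucvg r (fun x => H1 j x.1 x.2 a' b').
  by apply: bucvg_continuous; [exact: cH1|exact: uH1].
rewrite (_ : (fun=> _) =
    fun x => (-1) * (G x.1 x.2 *m H1 j x.1 x.2 *m G x.1 x.2) a b).
  apply: bucvgM; first exact: bucvg_cst.
  apply: (bucvg_mulmx (F := fun x => G x.1 x.2 *m H1 j x.1 x.2)) => //.
  exact: (bucvg_mulmx (F := fun x => G x.1 x.2)).
apply/funext => x; rewrite /H1 mulmxN mulNmx mxE mulN1r opprK.
by rewrite /H !mulmxA mulmxV// mul1mx -mulmxA mulVmx// mulmx1.
Qed.

(* The divergence of the field with components [G1 j] along [k] and [- G1 k] along
   [j] is zero. *)
Lemma nakano_limit_sym j k t (D2 : 'I_m -> 'I_m -> 'M[R]_n) :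
  (forall j k, mxder (G1 j None) (D2 j k) t (e_ k)) -> D2 j k = D2 k j.
Proof.
move=> dD.
suff le a b j' k' : D2 j' k' a b <= D2 k' j' a b.
  by apply/matrixP => a b; apply/eqP; rewrite eq_le !le.
pose W i o z := (i == k')%:R * G1 j' o z a b - (i == j')%:R * G1 k' o z a b.
pose W' i l z := (i == k')%:R * G2 j' i l z a b - (i == j')%:R * G2 k' i l z a b.
have sumE (c : 'I_m -> R) i0 : \sum_i (i == i0)%:R * c i = c i0.
  rewrite (bigD1 i0)//= big1 ?addr0 ?eqxx ?mul1r// => i /negbTE ->.
  by rewrite mul0r.
have dW i z : differentiable (W i None) z.
  by apply: differentiableB; apply: differentiableM => //; exact: dG1.
have := @divergence_limit R m t W W' 0 (fun i => dW i t).
have -> : \sum_i 'd (W i None) t (e_ i) = D2 j' k' a b - D2 k' j' a b.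
  rewrite -(sumE (fun i => D2 j' i a b) k') -(sumE (fun i => D2 k' i a b) j') -sumrB.
  apply: eq_bigr => i _; rewrite -deriveE//.
  have h : is_derive t (e_ i) (W i None)
     (((i == k')%:R * D2 j' i a b + 0 * G1 j' None t a b) -
     ((i == j')%:R * D2 k' i a b + 0 * G1 k' None t a b)).
    apply: is_deriveBf; apply: is_deriveMf => //; exact: dD.
  by have [_ ->] := h; rewrite !mul0r !addr0.
move=> lim; rewrite -subr_le0; apply: lim => //.
- move=> i r; have [_] : bucvg r (fun x => (i == k')%:R * G1 j' x.1 x.2 a b +
      (- (i == j')%:R) * G1 k' x.1 x.2 a b).
    by apply: bucvgD; apply: bucvgM => //; exact: bucvg_cst.
  rewrite (_ : (fun o t => _) = W i)//.
  by apply/funext => o; apply/funext => z; rewrite /W mulNr.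
- move=> i l r e e0; have e2 : 0 < e / 2 by rewrite divr_gt0.
  have [d1 d10 h1] := @uG1 j' i l a b r _ e2.
  have [d2 d20 h2] := @uG1 k' i l a b r _ e2.
  exists (Num.min d1 d2) => [|h z]; first by rewrite lt_min d10.
  rewrite lt_min => /andP[hd1 hd2] zr.
  have a1 := h1 h z hd1 zr; have a2 := h2 h z hd2 zr.
  rewrite /W /W'; set x1 := G1 j' _ _ a b in a1 *; set x2 := G1 j' _ _ a b in a1 *.
  set y1 := G1 k' _ _ a b in a2 *; set y2 := G1 k' _ _ a b in a2 *.
  set p := G2 _ _ _ _ a b in a1 *; set q := G2 _ _ _ _ a b in a2 *.
  have -> : (i == k')%:R * x1 - (i == j')%:R * y1 -
      ((i == k')%:R * x2 - (i == j')%:R * y2) -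
      h * ((i == k')%:R * p - (i == j')%:R * q) =
      (i == k')%:R * (x1 - x2 - h * p) - (i == j')%:R * (y1 - y2 - h * q) by ring.
  rewrite (le_trans (ler_normB _ _))// !normrM !normr_nat (splitr e) mulrDl lerD//.
    by case: (i == k'); rewrite ?mul1r ?mul0r// mulr_ge0// ltW.
  by case: (i == j'); rewrite ?mul1r ?mul0r// mulr_ge0// ltW.
- move=> e e0; exists 1 => //; exists 0%N => l _ z _; rewrite add0r.
  by rewrite /W' sumrB !sumE G2_sym subrr ltW.
Qed.

(** The right-hand side converges uniformly on balls to a continuous function. Near [t0] and for
    large indices it is at most its limit value at [t0] plus [e], which is the bound that
    [divergence_limit] requires. *)
Lemma nakano_limit t0 (D2 : 'I_m -> 'I_m -> 'M[R]_n) (u : 'I_m -> 'cV[R]_n) :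
  (forall j k, mxder (G1 j None) (D2 j k) t0 (e_ k)) ->
  let w := \sum_j G1 j None t0 *m u j in
  \sum_k \sum_j bform (u k) (D2 j k) (u j) <= bform w (invmx (G None t0)) w.
Proof.
move=> dD /=.
pose W k o z := \sum_j bform (u k) (G1 j o z) (u j).
pose W' k l z := \sum_j bform (u k) (G2 j k l z) (u j).
pose rhs (x : option nat * V) := let w := \sum_j G1 j x.1 x.2 *m u j in
  bform w (H x.1 x.2) w.
have WE k o z : W k o z = \sum_j \sum_a \sum_b (u k a 0 * u j b 0) * G1 j o z a b.
  apply: eq_bigr => j _; rewrite bformE; apply: eq_bigr => a _.
  by apply: eq_bigr => b _; rewrite mulrAC.
have dW k z : differentiable (W k None) z.
  rewrite (_ : W k None = \sum_j \sum_a \sum_b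
      (fun z => (u k a 0 * u j b 0) * G1 j None z a b)).
    do 3 apply: differentiable_sum => ?.
    by apply: differentiableM => //; exact: dG1.
  apply/funext => y; rewrite WE fct_sumE; apply: eq_bigr => j _.
  rewrite fct_sumE; apply: eq_bigr => a _.
  by rewrite fct_sumE.
have b1 r (v : 'cV[R]_n) a b : bucvg r (fun=> v a b) by exact: bucvg_cst.
have bw r a b : bucvg r (fun x => (\sum_j G1 j x.1 x.2 *m u j) a b).
  rewrite (_ : (fun=> _) = fun x => \sum_j (G1 j x.1 x.2 *m u j) a b).
    apply: bucvg_sum => j.
    by apply: (bucvg_mulmx (F := fun x => G1 j x.1 x.2) (G := fun=> u j)).
  by apply/funext => x; rewrite summxE.
have brhs r : bucvg r rhs by exact: bucvg_bform.
have crhs : continuous (fun t => rhs (None, t)).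
  have cw : mxcont (fun t => \sum_j G1 j None t *m u j).
    move=> a b; rewrite (_ : (fun=> _) = fun t => \sum_j (G1 j None t *m u j) a b).
      apply: continuous_sumf => j; apply: (mxcontM (G := fun=> u j)) => //.
      exact: mxcont_cst.
    by apply/funext => x; rewrite summxE.
  exact: continuous_bform.
have := @divergence_limit R m t0 W W' (rhs (None, t0)) (fun k => dW k t0).
have -> : \sum_k 'd (W k None) t0 (e_ k) = \sum_k \sum_j bform (u k) (D2 j k) (u j).
  apply: eq_bigr => k _; rewrite -deriveE//.
  have h : is_derive t0 (e_ k) (W k None) (\sum_j bform (u k) (D2 j k) (u j)).
    apply: is_derive_sumf => j.
    have := mxder_bform (mxder_cst (u k) t0 (e_ k)) (dD j k) (mxder_cst (u j) t0 (e_ k)).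
    by rewrite bform0l bform0r add0r addr0.
  by have [_ ->] := h.
move=> lim; apply: lim.
- move=> k r; have [_] : bucvg r (fun x => W k x.1 x.2).
    by apply: bucvg_sum => j; apply: bucvg_bform => //; exact: bG1.
  by [].
- move=> k l r e e0.
  pose C : R := 1 + \sum_j \sum_a \sum_b `|u k a 0 * u j b 0|.
  have S0 : 0 <= \sum_j \sum_a \sum_b `|u k a 0 * u j b 0|.
    by do 3 (apply: sumr_ge0 => ? _).
  have C0 : 0 < C by rewrite ltr_pwDl.
  have eC : 0 < e / C by rewrite divr_gt0.
  have [d d0 hd] : exists2 d : R, 0 < d & forall j (h : R) z, `|h| < d -> `|z| <= r ->
     forall a b, `|G1 j (Some l) (z + h *: e_ k) a b - G1 j (Some l) z a b -
       h * G2 j k l z a b| <= e / C * `|h|.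
    apply: uniform_choice => j.
    suff [d d0 hd] : exists2 d : R, 0 < d & forall a (h : R) z, `|h| < d -> `|z| <= r ->
     forall b, `|G1 j (Some l) (z + h *: e_ k) a b - G1 j (Some l) z a b -
       h * G2 j k l z a b| <= e / C * `|h|.
      exists d => // d' /andP[_ dd'] h z hh zr a b; apply: hd => //.
      exact: lt_le_trans dd'.
    apply: uniform_choice => a.
    suff [d d0 hd] : exists2 d : R, 0 < d & forall b (h : R) z, `|h| < d -> `|z| <= r ->
     `|G1 j (Some l) (z + h *: e_ k) a b - G1 j (Some l) z a b -
       h * G2 j k l z a b| <= e / C * `|h|.
      exists d => // d' /andP[_ dd'] h z hh zr b; apply: hd => //.
      exact: lt_le_trans dd'.
    apply: uniform_choice => b.
    have [d d0 hd] := @uG1 j k l a b r _ eC.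
    exists d => // d' /andP[_ dd'] h z hh zr; apply: hd => //.
    exact: lt_le_trans dd'.
  exists d => // h z hh zr.
  have W'E : W' k l z = \sum_j \sum_a \sum_b (u k a 0 * u j b 0) * G2 j k l z a b.
    apply: eq_bigr => j _; rewrite bformE; apply: eq_bigr => a _.
    by apply: eq_bigr => b _; rewrite mulrAC.
  rewrite !WE W'E mulr_sumr -!sumrB.
  apply: (@le_trans _ _ (\sum_j \sum_a \sum_b `|u k a 0 * u j b 0| * (e / C * `|h|))).
    rewrite (le_trans (ler_norm_sum _ _ _))//; apply: ler_sum => j _.
    rewrite mulr_sumr -!sumrB.
    rewrite (le_trans (ler_norm_sum _ _ _))//; apply: ler_sum => a _.
    rewrite mulr_sumr -!sumrB.
    rewrite (le_trans (ler_norm_sum _ _ _))//; apply: ler_sum => b _.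
    by rewrite mulrCA -!mulrBr normrM ler_pM//; exact: hd.
  rewrite (_ : \sum_j _ = (\sum_j \sum_a \sum_b `|u k a 0 * u j b 0|) * (e / C * `|h|)).
    rewrite mulrA ler_wpM2r// mulrCA ler_piMr ?(ltW e0)//.
    by rewrite ler_pdivrMr// mul1r lerDr.
  rewrite mulr_suml; apply: eq_bigr => j _; rewrite mulr_suml; apply: eq_bigr => a _.
  by rewrite mulr_suml.
- move=> e e0; have e2 : 0 < e / 2 by rewrite divr_gt0.
  have [_ /(_ _ e2)[N hN]] := brhs (`|t0| + 1).
  have /cvgrPdist_lt/(_ _ e2)/nbhs_normP[d /= d0 hd] := crhs t0.
  exists (Num.min 1 (d / 2)); first by rewrite lt_min ltr01 divr_gt0.
  exists N => l Nl z; rewrite le_min => /andP[z1 zd].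
  have zr : `|z| <= `|t0| + 1.
    by rewrite -(subrK t0 z) addrC (le_trans (ler_normD _ _))// lerD2l.
  have := hN l Nl z zr; rewrite ler_norml => /andP[_ h1].
  have : `|rhs (None, t0) - rhs (None, z)| < e / 2.
    by apply: hd => /=; rewrite distrC; lra.
  rewrite ltr_norml => /andP[h2 _].
  apply: (le_trans (G2_nakano l z u)); rewrite -[leLHS]/(rhs (Some l, z)).
  lra.
Qed.
End NakanoLimit.

(** * Marginals of log-sum-exp weights *)

Section LogSumExp.
Context {R : realType} {p : nat}.
Variable k : R.
Implicit Types (x d : 'I_p.+1 -> R) (W : 'I_p.+1 -> R).

Definition wavg W x : R := (\sum_i x i * W i) / \sum_i W i.
Definition lse_exp W : R := expR (- k * ln (\sum_i W i)).

Lemma sum_weights_gt0 W : (forall i, 0 < W i) -> 0 < \sum_i W i.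
Proof.
by move=> W0; rewrite big_ord_recl ltr_wpDr// sumr_ge0// => i _; exact: ltW.
Qed.

Section OneVariable.
Variables (w : 'I_p.+1 -> R -> R) (d : 'I_p.+1 -> R) (s : R).
Hypothesis w_gt0 : forall i y, 0 < w i y.
Hypothesis dw : forall i, is_derive s 1 (w i) (d i * w i s).

Let Z0 : \sum_i w i s != 0.
Proof. by rewrite gt_eqF// sum_weights_gt0. Qed.

(** The derivative of a weighted average is the covariance of [x] with the logarithmic derivatives
    [d] of the weights. *)
Lemma is_derive_wavg x : is_derive s 1 (fun s => wavg (w^~ s) x)
  (wavg (w^~ s) (fun i => x i * d i) - wavg (w^~ s) x * wavg (w^~ s) d).
Proof.
have dN : is_derive s 1 (fun s => \sum_i x i * w i s) (\sum_i x i * d i * w i s).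
  apply: is_derive_sumf => i.
  have := is_deriveMf (is_derive_cst (x i) s 1) (dw i).
  by rewrite mul0r addr0 mulrA.
have dZ : is_derive s 1 (fun s => \sum_i w i s) (\sum_i d i * w i s).
  exact: is_derive_sumf.
have := is_deriveMf dN (is_deriveVf Z0 dZ); congr is_derive.
by rewrite /wavg; field.
Qed.

Lemma is_derive_lse_exp : is_derive s 1 (fun s => lse_exp (w^~ s))
  (- (k * wavg (w^~ s) d) * lse_exp (w^~ s)).
Proof.
have dZ : is_derive s 1 (fun s => \sum_i w i s) (\sum_i d i * w i s).
  exact: is_derive_sumf.
have Zp : 0 < \sum_i w i s by exact: sum_weights_gt0.
have dln := is_derive1_comp (is_derive1_ln Zp) dZ.
have := is_derive1_comp (is_derive_expR _)
  (is_deriveMf (is_derive_cst (- k) s 1) dln).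
congr is_derive; rewrite /wavg /lse_exp mul0r addr0 /=.
ring.
Qed.
End OneVariable.

Lemma wavg_lin W (J : finType) (c : J -> R) (x : J -> 'I_p.+1 -> R) :
  wavg W (fun i => \sum_j c j * x j i) = \sum_j c j * wavg W (x j).
Proof.
rewrite /wavg; under [in RHS]eq_bigr => j _ do rewrite mulrA mulr_sumr.
rewrite -mulr_suml exchange_big; congr (_ / _); apply: eq_bigr => i _ /=.
by rewrite mulr_suml; apply: eq_bigr => j _; rewrite mulrA.
Qed.

(** The difference of the two sides is the weighted variance of the vectors [b i] in the form
    [S]. *)
Lemma wavg_bform n W (S : 'M[R]_n) (b : 'I_p.+1 -> 'cV[R]_n) :
  (forall i, 0 < W i) -> posdef S ->
  let bb := \sum_i (W i / \sum_i W i) *: b i in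
  bform bb S bb <= wavg W (fun i => bform (b i) S (b i)).
Proof.
move=> W0 Sp /=; have Zp := sum_weights_gt0 W0.
set Z := \sum_i W i in Zp *; set bb := \sum_i _ *: _.
have Z0 : Z != 0 by rewrite gt_eqF.
rewrite -subr_ge0.
have -> : wavg W (fun i => bform (b i) S (b i)) - bform bb S bb =
    \sum_i (W i / Z) * bform (b i - bb) S (b i - bb).
  have E i : W i / Z * bform (b i - bb) S (b i - bb) =
      bform (b i) S (b i) * W i / Z - bform ((W i / Z) *: b i) S bb * 2 +
      W i / Z * bform bb S bb.
    rewrite !(bformDl, bformDr, bformNl, bformNr, bformZl).
    by rewrite (bformC bb (b i) Sp.1); ring.
  under [RHS]eq_bigr => i _ do rewrite E.
  rewrite big_split sumrB /= -!mulr_suml -/Z mulfV// -bform_suml -/bb /wavg -/Z.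
  by ring.
apply: sumr_ge0 => i _; rewrite mulr_ge0 ?posdef_ge0//.
by rewrite divr_ge0// ltW.
Qed.
End LogSumExp.

Section LogSumExpApproximation.
Context {R : realType} {m p n : nat}.
Notation V := 'rV[R]_m.
Notation e_ k := (delta_mx (0 : 'I_1) k : 'rV[R]_m).
Variables (a b k : R) (al ga : 'I_p.+1 -> R) (be : 'I_p.+1 -> 'I_m -> R).
Variables (S S1 B1 : R -> 'M[R]_n).
Hypothesis ab : a < b.
Hypothesis k0 : 0 < k.
Hypothesis Sp : forall y, posdef (S y).
Hypothesis dS : forall y : R, mxder S (S1 y) y 1.
Hypothesis dB : forall y : R, mxder (fun y => invmx (S y) *m S1 y) (B1 y) y 1.
Hypothesis B1_le0 : forall y u, bform u (S y) (B1 y *m u) <= 0.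

Definition weight (z : R * V) i : R :=
  expR (al i * z.1 + \sum_j be i j * z.2 0 j + ga i).
(* [psi], [psi1 j] and [psi2 j l] are [exp (- phi)] and its first two [t]-derivatives
   for [phi = k ln (sum_i weight z i)]. *)
Definition psi z : R := lse_exp k (weight z).
Definition psi1 j z : R := - k * wavg (weight z) (be^~ j) * psi z.
Definition psi2 j l z : R :=
  (k ^+ 2 * wavg (weight z) (be^~ j) * wavg (weight z) (be^~ l) -
   k * (wavg (weight z) (fun i => be i j * be i l) -
        wavg (weight z) (be^~ j) * wavg (weight z) (be^~ l))) * psi z.

Let w0 z i : 0 < weight z i. Proof. exact: expR_gt0. Qed.

Let dweight_t y t l (s : R) i : is_derive s 1 (fun s => weight (y, t + s *: e_ l) i)
  (be i l * weight (y, t + s *: e_ l) i).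
Proof.
have E : (fun s => weight (y, t + s *: e_ l) i) =
   fun s => expR ((al i * y + \sum_j be i j * t 0 j + ga i) + be i l * s).
  apply/funext => s'; rewrite /weight /=; congr expR.
  under eq_bigr => j _ do rewrite !mxE mulrDr eqxx /=.
  rewrite big_split /= (_ : \sum_j be i j * (s' * (j == l)%:R) = be i l * s').
    by ring.
  rewrite (bigD1 l)//= eqxx mulr1 big1 ?addr0// => j /negbTE ->.
  by rewrite !mulr0.
have /= Es := congr1 (fun f => f s) E; rewrite E Es.
have := is_derive1_comp (is_derive_expR _)
  (is_deriveDf (is_derive_cst (al i * y + \sum_j be i j * t 0 j + ga i) s 1)
  (is_deriveMf (is_derive_cst (be i l) s 1) (is_derive_id s 1))).
congr is_derive; rewrite /weight /=; ring.
Qed.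

Let dweight_y t (y : R) i : is_derive y 1 (fun y => weight (y, t) i)
  (al i * weight (y, t) i).
Proof.
have := is_derive1_comp (is_derive_expR _)
  (is_deriveDf (is_deriveDf (is_deriveMf (is_derive_cst (al i) y 1) (is_derive_id y 1))
  (is_derive_cst (\sum_j be i j * t 0 j) y 1)) (is_derive_cst (ga i) y 1)).
congr is_derive; rewrite /weight /=; ring.
Qed.

Lemma is_derive_psi y t l (s : R) :
  is_derive s 1 (fun s => psi (y, t + s *: e_ l)) (psi1 l (y, t + s *: e_ l)).
Proof.
have := @is_derive_lse_exp R p k (fun i s => weight (y, t + s *: e_ l) i) (be^~ l) s
  (fun i y => w0 _ i) (fun i => dweight_t y t l s i).
by rewrite -mulNr.
Qed.

Lemma is_derive_psi1 y t j l (s : R) :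
  is_derive s 1 (fun s => psi1 j (y, t + s *: e_ l)) (psi2 j l (y, t + s *: e_ l)).
Proof.
have h1 := @is_derive_wavg R p (fun i s => weight (y, t + s *: e_ l) i) (be^~ l) s
  (fun i y => w0 _ i) (fun i => dweight_t y t l s i) (be^~ j).
have := is_deriveMf (is_deriveMf (is_derive_cst (- k) s 1) h1) (is_derive_psi y t l s).
congr is_derive; rewrite /psi2 /psi1 /cst; set W := weight _.
by rewrite -[X in wavg X _]/W; ring.
Qed.

Lemma psi2C j l z : psi2 j l z = psi2 l j z.
Proof.
rewrite /psi2 (_ : (fun i => be i j * be i l) = (fun i => be i l * be i j)); first by ring.
by apply/funext => i; rewrite mulrC.
Qed.

Let cweight i : continuous (fun z => weight z i).
Proof.
move=> z; apply: continuous_comp; last exact: continuous_expR.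
apply: cvgD; last exact: cvg_cst.
apply: cvgD; first by apply: cvgM; [exact: cvg_cst|exact: cvg_fst].
have : continuous (fun z : R * V => \sum_j be i j * z.2 0 j).
  apply: continuous_sumf => j y; apply: cvgM; first exact: cvg_cst.
  apply: (@continuous_comp _ _ _ snd (fun t : V => t 0 j)); first exact: cvg_snd.
  exact: coord_continuous.
by apply.
Qed.

Let cZ : continuous (fun z => \sum_i weight z i).
Proof. exact: continuous_sumf. Qed.

Lemma continuous_wavg x : continuous (fun z => wavg (weight z) x).
Proof.
move=> z; apply: cvgM.
  have : continuous (fun z => \sum_i x i * weight z i).
    by apply: continuous_sumf => i y; apply: cvgM; [exact: cvg_cst|exact: cweight].
  by apply.
apply: cvgV; last exact: cZ.
by rewrite gt_eqF// sum_weights_gt0.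
Qed.

Lemma continuous_psi : continuous psi.
Proof.
move=> z; apply: continuous_comp; last exact: continuous_expR.
apply: cvgM; first exact: cvg_cst.
apply: continuous_comp; first exact: cZ.
by apply: continuous_ln; exact: sum_weights_gt0.
Qed.

Lemma continuous_psi1 j : continuous (psi1 j).
Proof.
move=> z; apply: cvgM; last exact: continuous_psi.
by apply: cvgM; [exact: cvg_cst|exact: continuous_wavg].
Qed.

Lemma continuous_psi2 j l : continuous (psi2 j l).
Proof.
have c := continuous_wavg.
move=> z; apply: cvgM; last exact: continuous_psi.
apply: cvgB.
  by apply: cvgM; [apply: cvgM; [exact: cvg_cst|exact: c]|exact: c].
apply: cvgM; first exact: cvg_cst.
by apply: cvgB; [exact: c|apply: cvgM; exact: c].
Qed.

Let cS : mxcont S. Proof. exact: mxder_cont dS. Qed.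

(** By the mean value theorem the error at [y] is [h * g y] times an increment of [F'], which is
    uniformly continuous near the product of [[a, b]] with a ball. *)
Lemma udiff_integ l (F F' : R * V -> R) (g : R -> R) :
  continuous F -> continuous F' -> continuous g ->
  (forall y t (s : R),
    is_derive s 1 (fun s => F (y, t + s *: e_ l)) (F' (y, t + s *: e_ l))) ->
  udiff (e_ l) (fun t => integ a b (fun y => F (y, t) * g y))
    (fun t => integ a b (fun y => F' (y, t) * g y)).
Proof.
move=> cF cF' cg dF r e e0.
have cg' : continuous (fun y => `|g y|).
  by move=> y; apply: cvg_norm; exact: cg.
pose C : R := 1 + integ a b (fun y => `|g y|).
have I0 : 0 <= integ a b (fun y => `|g y|) by apply: integ_ge0.
have C0 : 0 < C by rewrite ltr_pwDl.
have e'0 : 0 < e / C by rewrite divr_gt0.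
have cK := compact_setX (@segment_compact R a b) (@compact_norm_ball R m r).
have [d d0 hd] := compact_unif_continuous cK (fun z _ => cF' z) e'0.
exists d => // h t hd' tr.
have c0 : continuous (fun y => F (y, t) * g y).
  by move=> y; apply: cvgM; [exact: continuous_slice|exact: cg].
have c1 : continuous (fun y => F (y, t + h *: e_ l) * g y).
  by move=> y; apply: cvgM; [exact: continuous_slice|exact: cg].
have c2 : continuous (fun y => F' (y, t) * g y).
  by move=> y; apply: cvgM; [exact: continuous_slice|exact: cg].
have c3 : continuous (fun y => h * (F' (y, t) * g y)).
  by move=> y; apply: cvgM; [exact: cvg_cst|exact: c2].
have c4 : continuous (fun y => F (y, t + h *: e_ l) * g y - F (y, t) * g y).
  by move=> y; apply: cvgB; [exact: c1|exact: c0].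
rewrite -integZ// -integB// -integB//.
apply: (le_trans (integ_norm _ _ _)).
  by move=> y; apply: cvgB; [exact: c4|exact: c3].
apply: (@le_trans _ _ (integ a b (fun y => (e / C * `|h|) * `|g y|))).
  apply: le_integ.
  - by move=> y; apply: cvg_norm; apply: cvgB; [exact: c4|exact: c3].
  - by move=> y; apply: cvgM; [exact: cvg_cst|exact: cg'].
  move=> y yab; rewrite mulrA -!mulrBl normrM ler_wpM2r//.
  have [c ch] := mvt_signed (dF y t) h; rewrite scale0r addr0 => ->.
  rewrite -mulrBr normrM mulrC ler_wpM2r// distrC ltW//; apply: hd.
    by split; rewrite //= in_itv.
  rewrite (_ : (y, t) - _ = (0, - (c *: e_ l))); last first.
    by congr pair; rewrite /= ?subrr// opprD addrA subrr add0r.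
  rewrite prod_normE /= normr0 normrN normrZ.
  rewrite gt_max d0 (le_lt_trans _ hd')//.
  apply: le_trans ch; rewrite -[leRHS]mulr1 ler_wpM2l//.
  exact: norm_delta_mx_le.
rewrite integZ// mulrAC ler_wpM2r// -mulrA ler_piMr ?(ltW e0)//.
by rewrite mulrC ler_pdivrMr// mul1r lerDr.
Qed.

Definition lse_G t := integ_mx a b (fun y => psi (y, t) *: S y).
Definition lse_G1 j t := integ_mx a b (fun y => psi1 j (y, t) *: S y).
Definition lse_G2 j l t := integ_mx a b (fun y => psi2 j l (y, t) *: S y).

Let integ_mxZE (F : R * V -> R) i j :
  (fun t => integ_mx a b (fun y => F (y, t) *: S y) i j) =
  (fun t => integ a b (fun y => F (y, t) * S y i j)).
Proof.
by apply/funext => t; rewrite mxE; apply: eq_integ => y _; rewrite mxE.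
Qed.

Lemma udiff_lse_G l i j : udiff (e_ l) (fun t => lse_G t i j) (fun t => lse_G1 l t i j).
Proof.
rewrite !integ_mxZE; apply: udiff_integ => //.
- exact: continuous_psi.
- exact: continuous_psi1.
- by move=> y t s; exact: is_derive_psi.
Qed.

Lemma udiff_lse_G1 h l i j :
  udiff (e_ l) (fun t => lse_G1 h t i j) (fun t => lse_G2 h l t i j).
Proof.
rewrite !integ_mxZE; apply: udiff_integ => //.
- exact: continuous_psi1.
- exact: continuous_psi2.
- by move=> y t s; exact: is_derive_psi1.
Qed.

Lemma lse_G2C j l t : lse_G2 j l t = lse_G2 l j t.
Proof.
by apply/matrixP => i h; rewrite !mxE; apply: eq_integ => y _; rewrite psi2C.
Qed.

Lemma posdef_lse_G t : posdef (lse_G t).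
Proof.
apply: posdef_integ => //.
  by apply: mxcontZ => //; apply: continuous_slice; exact: continuous_psi.
by move=> y _; apply: posdef_scale => //; exact: expR_gt0.
Qed.

(** For [phi = k ln (sum_i weight z i)], [f] is [sum_j (d_j phi) u_j] and [q] is
    [sum_jl (d_j d_l phi) u_l^T S u_j]. The latter is [k] times the variance of the vectors [v i],
    as second derivatives of [phi] are covariances of slopes. *)
Lemma lse_nakano t (u : 'I_m -> 'cV[R]_n) :
  let w := \sum_j lse_G1 j t *m u j in
  \sum_l \sum_j bform (u l) (lse_G2 j l t) (u j) <= bform w (invmx (lse_G t)) w.
Proof.
pose W y := weight (y, t); pose v i := \sum_j be i j *: u j.
pose E y (x : 'I_p.+1 -> 'cV[R]_n) : 'cV[R]_n := \col_c wavg (W y) (fun i => x i c 0).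
have EE y x : E y x = \sum_i (W y i / \sum_i W y i) *: x i.
  apply/colP => c; rewrite mxE summxE /wavg mulr_suml; apply: eq_bigr => i _.
  by rewrite mxE [RHS]mulrC mulrA.
pose f y := k *: E y v.
pose f1 y := k *: (E y (fun i => al i *: v i) - wavg (W y) al *: E y v).
pose phi1 y := k * wavg (W y) al.
pose phi2 y := k * (wavg (W y) (fun i => al i * al i) - wavg (W y) al * wavg (W y) al).
pose q y := k * (wavg (W y) (fun i => bform (v i) (S y) (v i)) -
  bform (E y v) (S y) (E y v)).
have dwavg x (y : R) : is_derive y 1 (fun y => wavg (W y) x)
    (wavg (W y) (fun i => x i * al i) - wavg (W y) x * wavg (W y) al).
  exact: (@is_derive_wavg R p (fun i y => W y i) al y (fun i y => w0 _ i)
    (fun i => dweight_y t y i) x).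
have cw x : continuous (fun y => wavg (W y) x).
  by apply: (@continuous_slice R V _ (fun z => wavg (weight z) x)); exact: continuous_wavg.
have cE x : mxcont (fun y => E y x).
  move=> c d; rewrite (_ : (fun=> _) = fun y => wavg (W y) (fun i => x i c 0)) //.
  by apply/funext => y; rewrite mxE.
have dpsi (y : R) : is_derive y 1 (fun y => psi (y, t)) (- phi1 y * psi (y, t)).
  exact: (@is_derive_lse_exp R p k (fun i y => W y i) al y (fun i y => w0 _ i)
    (fun i => dweight_y t y i)).
have dphi1 (y : R) : is_derive y 1 phi1 (phi2 y).
  have := is_deriveMf (is_derive_cst k y 1) (dwavg al y).
  by rewrite mul0r addr0.
have df (y : R) : mxder f (f1 y) y 1.
  move=> c d; rewrite !mxE.
  rewrite (_ : (fun=> _) = fun y => k * wavg (W y) (fun i => v i c 0)); last first.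
    by apply/funext => z; rewrite !mxE.
  have := is_deriveMf (is_derive_cst k y 1) (dwavg (fun i => v i c 0) y).
  congr is_derive; rewrite mul0r addr0; congr (k * (_ - _)); last by rewrite mulrC.
  by congr wavg; apply/funext => i; rewrite mxE mulrC.
have cvv : continuous (fun y => wavg (W y) (fun i => bform (v i) (S y) (v i))).
  have vv y' i : bform (v i) (S y') (v i) =
      \sum_(c : 'I_n * 'I_n) S y' c.1 c.2 * (v i c.1 0 * v i c.2 0).
    rewrite bformE pair_bigA; apply: eq_bigr => c _.
    by rewrite /=; ring.
  rewrite (_ : (fun y => _) = fun y => \sum_(c : 'I_n * 'I_n) S y c.1 c.2 *
      wavg (W y) (fun i => v i c.1 0 * v i c.2 0)).
    apply: continuous_sumf => c z.
    by apply: cvgM; [exact: cS|exact: cw].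
  apply/funext => y'; rewrite -wavg_lin; congr wavg; apply/funext => i.
  exact: vv.
have cq : continuous q.
  move=> y; apply: cvgM; first exact: cvg_cst.
  by apply: cvgB; [exact: cvv|exact: continuous_bform].
have wavgD y x x' : wavg (W y) (fun i => x i + x' i) = wavg (W y) x + wavg (W y) x'.
  rewrite /wavg -mulrDl -big_split; congr (_ / _).
  by apply: eq_bigr => i _; rewrite mulrDl.
have wavgB y x x' : wavg (W y) (fun i => x i - x' i) = wavg (W y) x - wavg (W y) x'.
  rewrite /wavg -mulrBl -sumrB; congr (_ / _).
  by apply: eq_bigr => i _; rewrite mulrBl.
have wavgZ y c x : wavg (W y) (fun i => c * x i) = c * wavg (W y) x.
  rewrite /wavg mulrA mulr_sumr; congr (_ / _).
  by apply: eq_bigr => i _; rewrite mulrA.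
have EbformE y x M z : bform z M (E y x) = wavg (W y) (fun i => bform z M (x i)).
  rewrite EE bform_sumr /wavg mulr_suml; apply: eq_bigr => i _.
  by rewrite bformZr mulrC mulrA.
have q_ge y x : 0 <= q y - 2 * bform x (S y) (f1 y) + phi2 y * bform x (S y) x.
  have ST := (Sp y).1.
  (* Joint convexity in [(y, t)] enters here: the expression to bound is [k] times the variance of
     the vectors [v i - al i *: x]. *)
  have := @wavg_bform R p n (W y) (S y) (fun i => v i - al i *: x) (fun i => w0 _ i) (Sp y).
  rewrite /= -EE -subr_ge0 => jensen.
  rewrite (_ : _ + _ = k *
    (wavg (W y) (fun i => bform (v i - al i *: x) (S y) (v i - al i *: x)) -
    bform (E y (fun i => v i - al i *: x)) (S y) (E y (fun i => v i - al i *: x)))).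
    exact: mulr_ge0 (ltW k0) jensen.
  have -> : E y (fun i => v i - al i *: x) = E y v - wavg (W y) al *: x.
    apply/colP => c; rewrite !mxE [wavg _ al * _]mulrC -wavgZ -wavgB; congr wavg.
    by apply/funext => i; rewrite !mxE mulrC [x c 0 * _]mulrC.
  have -> : wavg (W y) (fun i => bform (v i - al i *: x) (S y) (v i - al i *: x)) =
      wavg (W y) (fun i => bform (v i) (S y) (v i)) -
      2 * bform x (S y) (E y (fun i => al i *: v i)) +
      bform x (S y) x * wavg (W y) (fun i => al i * al i).
    rewrite EbformE -!wavgZ -wavgB -wavgD; congr wavg; apply/funext => i.
    rewrite !(bformDl, bformDr, bformNl, bformNr, bformZl, bformZr).
    by rewrite (bformC (v i) x ST); ring.
  rewrite /q /f1 /phi2 !(bformDl, bformDr, bformNl, bformNr, bformZl, bformZr).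
  by rewrite (bformC (E y v) x ST); ring.
have := brascamp_lieb ab Sp dS dB B1_le0 (fun y => expR_gt0 _) dpsi dphi1 df cq q_ge.
set pv := integ_mx a b _.
have EvE y : E y v = \sum_j wavg (W y) (be^~ j) *: u j.
  apply/colP => c; rewrite mxE summxE.
  under [RHS]eq_bigr => j _ do rewrite mxE mulrC.
  rewrite -wavg_lin; congr wavg; apply/funext => i.
  by rewrite summxE; apply: eq_bigr => j _; rewrite mxE mulrC.
have cpsi1 j : mxcont (fun y => psi1 j (y, t) *: S y).
  by apply: mxcontZ => //; apply: continuous_slice; exact: continuous_psi1.
have wE : \sum_j lse_G1 j t *m u j = - pv.
  have cu j : mxcont (fun y => (psi1 j (y, t) *: S y) *m u j).
    by apply: mxcontM => //; exact: mxcont_cst.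
  have cpv : mxcont (fun y => psi (y, t) *: (S y *m f y)).
    apply: mxcontZ; first by apply: continuous_slice; exact: continuous_psi.
    by apply: mxcontM => //; exact: mxder_cont df.
  have M y : \sum_j (psi1 j (y, t) *: S y) *m u j = - (psi (y, t) *: (S y *m f y)).
    rewrite /f EvE -scalemxAr mulmx_sumr !scaler_sumr -sumrN; apply: eq_bigr => j _.
    rewrite -scalemxAl -scalemxAr !scalerA -scaleNr; congr (_ *: _).
    by rewrite /psi1; ring.
  apply/matrixP => c d; rewrite summxE /pv !mxE -mulN1r -integZ//.
  under eq_bigr => j _ do rewrite -integ_mulmxr// mxE.
  rewrite -integ_sum; last by move=> j; exact: cu.
  by apply: eq_integ => y _; rewrite -summxE M mxE mulN1r.
(* This is [d_j d_l exp (- phi) = (d_j phi * d_l phi - d_j d_l phi) * exp (- phi)] contracted with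
   the vectors. *)
have dE y : \sum_l \sum_j bform (u l) (psi2 j l (y, t) *: S y) (u j) =
    psi (y, t) * (bform (f y) (S y) (f y) - q y).
  have QE (c : 'I_m -> R) : bform (\sum_j c j *: u j) (S y) (\sum_j c j *: u j) =
      \sum_l \sum_j c j * c l * bform (u l) (S y) (u j).
    rewrite bform_suml; apply: eq_bigr => l _; rewrite bform_sumr.
    by apply: eq_bigr => j _; rewrite bformZl bformZr mulrA [c l * _]mulrC.
  have PE : wavg (W y) (fun i => bform (v i) (S y) (v i)) =
      \sum_l \sum_j wavg (W y) (fun i => be i j * be i l) * bform (u l) (S y) (u j).
    rewrite pair_bigA /=.
    under [RHS]eq_bigr => c _ do rewrite mulrC.
    rewrite -wavg_lin; congr wavg; apply/funext => i.
    rewrite QE pair_bigA; apply: eq_bigr => c _ /=; exact: mulrC.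
  transitivity ((psi (y, t) * (k ^+ 2 + k)) * \sum_l \sum_j
      wavg (W y) (be^~ j) * wavg (W y) (be^~ l) * bform (u l) (S y) (u j) -
      (psi (y, t) * k) * \sum_l \sum_j
      wavg (W y) (fun i => be i j * be i l) * bform (u l) (S y) (u j)).
    rewrite !mulr_sumr -sumrB; apply: eq_bigr => l _.
    rewrite !mulr_sumr -sumrB; apply: eq_bigr => j _.
    by rewrite bformZm /psi2 -/(W y); ring.
  by rewrite /f /q bformZl bformZr PE EvE QE; ring.
have cpsi2 l j : mxcont (fun y => psi2 j l (y, t) *: S y).
  by apply: mxcontZ => //; apply: continuous_slice; exact: continuous_psi2.
have cb l j : continuous (fun y => bform (u l) (psi2 j l (y, t) *: S y) (u j)).
  by apply: continuous_bform => //; exact: mxcont_cst.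
rewrite /= wE bformNl bformNr opprK; apply: le_trans.
rewrite le_eqVlt; apply/orP; left; apply/eqP.
under eq_bigr => l _ do under eq_bigr => j _ do rewrite -integ_bform//.
under eq_bigr => l _ do rewrite -integ_sum//.
rewrite -integ_sum; last by move=> l; exact: continuous_sumf.
by apply: eq_integ => y _; exact: dE.
Qed.
End LogSumExpApproximation.

(** * Approximation of convex weights *)

Section LogSumExpEnvelope.
Context {R : realType} {m : nat}.
Notation V := 'rV[R]_m.
Notation e_ k := (delta_mx (0 : 'I_1) k : 'rV[R]_m).
Variable phi : R * V -> R.
Hypothesis dphi : forall z, differentiable phi z.
Hypothesis phi_convex : forall (s : R) z w, 0 < s -> s < 1 ->
  phi (w + s *: (z - w)) <= phi w + s * (phi z - phi w).

(** Convexity bounds the increment over a short step [s *: (z - w)] by [s] times the full increment;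
    differentiability identifies it up to [o(s)]. *)
Lemma convex_tangent z w : phi w + 'd phi w (z - w) <= phi z.
Proof.
rewrite -lerBrDl; apply/ler_addgt0Pr => e e0.
pose c : R := `|z - w| + 1; have c0 : 0 < c by rewrite ltr_wpDl.
have ec : 0 < e / c by rewrite divr_gt0.
have [d d0 hd] := differentiable_eps (dphi w) ec.
pose s : R := Num.min (1 / 2) (d / (2 * c)).
have s0 : 0 < s by rewrite lt_min !divr_gt0// mulr_gt0.
have s1 : s < 1 by rewrite gt_min; apply/orP; left; lra.
have zc : `|z - w| <= c by rewrite lerDl.
have sd : `|s *: (z - w)| < d.
  rewrite normrZ gtr0_norm// (@le_lt_trans _ _ (s * c))//; first by rewrite ler_pM2l.
  rewrite -ltr_pdivlMr// gt_min; apply/orP; right.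
  by rewrite ltr_pM2l// ltf_pV2 ?posrE ?mulr_gt0//; lra.
have := hd _ sd; rewrite linearZ /= ler_norml => /andP[h _].
have := phi_convex z w s0 s1 => cvx.
have {}h : s * 'd phi w (z - w) <= s * (phi z - phi w) + e / c * `|s *: (z - w)|.
  rewrite -[s * 'd phi w _]/(s *: _); lra.
rewrite -(ler_pM2l s0) mulrDr (le_trans h)// lerD2l normrZ gtr0_norm//.
rewrite mulrCA ler_pM2l// -mulrA ler_piMr ?(ltW e0)//.
by rewrite mulrC ler_pdivrMr// mul1r.
Qed.

Let cphi : continuous phi.
Proof. by move=> z; apply: differentiable_continuous. Qed.

Let coef_y (w : R * V) : R := 'd phi w (1, 0).
Let coef_t (w : R * V) j : R := 'd phi w (0, e_ j).
Let coef_c (w : R * V) : R := phi w - 'd phi w w.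

Let tangentE z w : phi w + 'd phi w (z - w) =
  coef_y w * z.1 + \sum_j coef_t w j * z.2 0 j + coef_c w.
Proof.
have -> : 'd phi w (z - w) = 'd phi w z - 'd phi w w by rewrite linearB.
have zE : z = z.1 *: (1, 0) + \sum_j z.2 0 j *: ((0, e_ j) : R * V).
  have sE : \sum_j z.2 0 j *: ((0, e_ j) : R * V) = (0, z.2).
    rewrite [in RHS](row_sum_delta z.2).
    elim/big_rec2: _ => // j y1 y2 _ ->.
    by rewrite -[_ *: (_, _)]/(_ *: 0, _ *: _) scaler0 -[_ + (_, _)]/(_ + _, _ + _) addr0.
  rewrite sE; case: z {sE} => y t /=.
  by rewrite -[_ *: (_, _)]/(_ *: _, _ *: _) scaler0 -[_ + (_, _)]/(_ + _, _ + _)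
    addr0 add0r [y *: 1]mulr1.
have -> : 'd phi w z = coef_y w * z.1 + \sum_j coef_t w j * z.2 0 j.
  rewrite {1}zE linearD linear_sum linearZ /= mulrC; congr (_ + _).
  by apply: eq_bigr => j _; rewrite linearZ /= mulrC.
by rewrite /coef_c; lra.
Qed.

(** By compactness finitely many tangents have a maximum within [eta / 2] of [phi] on [K].
    Log-sum-exp exceeds that maximum by at most [k * ln p.+1], and tangents never exceed [phi]. *)
Lemma lse_envelope (K : set (R * V)) (eta : R) : compact K -> 0 < eta ->
  exists p k (al ga : 'I_p.+1 -> R) (be : 'I_p.+1 -> 'I_m -> R), 0 < k /\
    forall z, K z -> expR (- phi z - eta) <= psi k al ga be z <= expR (- phi z + eta).
Proof.
move=> cK eta0; have eta2 : 0 < eta / 2 by rewrite divr_gt0.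
pose L w z := phi w + 'd phi w (z - w).
have cL w : continuous (L w).
  rewrite (_ : L w = fun z => coef_y w * z.1 + \sum_j coef_t w j * z.2 0 j + coef_c w).
    move=> z; apply: cvgD; last exact: cvg_cst.
    apply: cvgD; first by apply: cvgM; [exact: cvg_cst|exact: cvg_fst].
    have : continuous (fun z : R * V => \sum_j coef_t w j * z.2 0 j).
      apply: continuous_sumf => j y; apply: cvgM; first exact: cvg_cst.
      apply: (@continuous_comp _ _ _ snd (fun t : V => t 0 j)); first exact: cvg_snd.
      exact: coord_continuous.
    by apply.
  by apply/funext => z; exact: tangentE.
(* The filter of sufficiently large finite sets of tangency points. Compactness as near covering,
   applied to it, yields one finite family for all of [K]. *)
pose F : set_system (seq (R * V)) :=
  [set A | exists s0 : seq (R * V), forall s : seq (R * V), {subset s0 <= s} -> A s].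
have FF : Filter F.
  split; first by exists [::].
    move=> A B [s1 h1] [s2 h2]; exists (s1 ++ s2) => s hs; split.
      by apply: h1 => x xs; apply: hs; rewrite mem_cat xs.
    by apply: h2 => x xs; apply: hs; rewrite mem_cat xs orbT.
  by move=> A B AB [s0 h]; exists s0 => s hs; apply: AB; exact: h.
have [D hD] : exists D : seq (R * V), forall z, K z ->
    exists2 w, w \in D & phi z - L w z < eta / 2.
  have /compact_near_coveringP cK' := cK.
  have := cK' _ F
    (fun (s : seq (R * V)) z => exists2 w, w \in s & phi z - L w z < eta / 2) FF.
  case=> [z Kz|D hD]; last by exists D => z; exact: hD.
  exists ([set z' | phi z' - L z z' < eta / 2], [set s : seq (R * V) | z \in s]);
    last first.
    by move=> [z' s] /= [h1 h2]; exists z.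
  split; last by exists [:: z] => s; apply; rewrite mem_head.
  apply: open_nbhs_nbhs; split; last by rewrite /= /L subrr linear0 addr0 subrr.
  apply: (@open_comp _ _ (fun z' => phi z' - L z z') [set x | x < eta / 2]).
    by move=> z' _; apply: cvgB; [exact: cphi|exact: cL].
  exact: open_lt.
(* The extra point keeps the family nonempty when [D] is empty; its tangent also lies below
   [phi]. *)
pose s : seq (R * V) := 0 :: D.
pose p := size D; pose w (i : 'I_p.+1) := nth 0 s i.
(* Chosen so that [k * ln p.+1 <= eta]; adding [1] keeps the denominator positive when [p = 0]. *)
pose k := eta / (ln p.+1%:R + 1).
have ln0 : 0 <= ln p.+1%:R :> R by rewrite ln_ge0// ler1n.
have k0 : 0 < k by rewrite divr_gt0// ltr_wpDl.
have kln : k * ln p.+1%:R <= eta.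
  rewrite /k mulrAC ler_pdivrMr ?ltr_wpDl// ler_pM2l// lerDl.
  exact: ler01.
exists p, k, (fun i => coef_y (w i) / k), (fun i => coef_c (w i) / k),
  (fun i j => coef_t (w i) j / k); split => // z Kz.
have WE i : weight (fun i => coef_y (w i) / k) (fun i => coef_c (w i) / k)
    (fun i j => coef_t (w i) j / k) z i = expR (L (w i) z / k).
  rewrite /weight /L tangentE; congr expR; rewrite !mulrDl mulr_suml.
  by congr (_ + _ + _); [exact: mulrAC|apply: eq_bigr => j _; exact: mulrAC].
rewrite /psi /lse_exp; under eq_bigr => i _ do rewrite WE.
set Z := \sum_i _.
have Z0 : 0 < Z by apply: sum_weights_gt0 => i; exact: expR_gt0.
rewrite !ler_expR; suff : phi z - eta <= k * ln Z <= phi z + eta.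
  by move=> /andP[h1 h2]; apply/andP; split; lra.
apply/andP; split.
  have [w0 /= w0D hw0] := hD z Kz.
  have wi : (index w0 s < p.+1)%N by rewrite index_mem in_cons w0D orbT.
  pose i := Ordinal wi.
  have wE : w i = w0 by rewrite /w nth_index// in_cons w0D orbT.
  have : expR (L w0 z / k) <= Z.
    rewrite /Z (bigD1 i)//= wE lerDl sumr_ge0// => j _; exact: expR_ge0.
  rewrite -ler_ln ?posrE ?expR_gt0// expRK => h.
  apply: (@le_trans _ _ (L w0 z)); first by move: hw0; rewrite /=; lra.
  by rewrite mulrC -ler_pdivrMr.
have : Z <= p.+1%:R * expR (phi z / k).
  rewrite /Z -[p.+1 in leRHS]card_ord mulr_natl -sumr_const ler_sum// => i _.
  by rewrite ler_expR ler_pM2r ?invr_gt0//; exact: convex_tangent.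
have p0 : 0 < p.+1%:R :> R by rewrite ltr0n.
have E0 := expR_gt0 (phi z / k).
move=> hZ; have : ln Z <= ln (p.+1%:R * expR (phi z / k)).
  by rewrite ler_ln ?posrE// mulr_gt0.
rewrite lnM ?posrE//.
rewrite expRK -(ler_pM2l k0) mulrDr => /le_trans; apply.
by rewrite [k * (_ / k)]mulrC divfK ?gt_eqF// addrC lerD2l.
Qed.
End LogSumExpEnvelope.

(** * Truncation of integrals to bounded intervals *)

Section IntegralTruncation.
Context {R : realType}.
Notation mu := (@lebesgue_measure R).

Lemma Rintegral_itv_split a b (f : R -> R) : mu.-integrable setT (EFin \o f) ->
  \int[mu]_y f y = integ a b f + \int[mu]_(y in ~` `[a, b]) f y.
Proof.
move=> intf; rewrite -(setUv `[a, b]%classic) Rintegral_setU//.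
- exact: measurableC.
- by rewrite setUv.
- by rewrite disj_set2E setICr.
Qed.

Lemma integrableSf (D : set R) (f : R -> R) : measurable D ->
  mu.-integrable setT (EFin \o f) -> mu.-integrable D (EFin \o f).
Proof. by move=> mD; apply: integrableS. Qed.

Lemma truncation_le a b a' b' (f : R -> R) : a' <= a -> b <= b' ->
  (forall y, 0 <= f y) -> continuous f -> mu.-integrable setT (EFin \o f) ->
  integ a b f <= integ a' b' f.
Proof.
move=> aa bb f0 cf intf; rewrite /integ /Rintegral fine_le//.
- by apply: integrable_fin_num => //; exact: integrableSf.
- by apply: integrable_fin_num => //; exact: integrableSf.
- apply: ge0_subset_integral => //.
  + by apply: measurable_int (integrableSf _ intf).
  + by move=> x _; rewrite lee_fin.
  + by apply: subset_itv; rewrite bnd_simp.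
Qed.

Lemma truncation_cvg (f : R -> R) : (forall y, 0 <= f y) ->
  mu.-integrable setT (EFin \o f) -> forall e : R, 0 < e ->
  exists N : nat, \int[mu]_y f y - integ (- N%:R) N%:R f <= e.
Proof.
move=> f0 intf e e0.
pose F (N : nat) : set R := `[- N%:R, N%:R]%classic.
have ndF : nondecreasing_seq F.
  move=> N1 N2 N12; apply/subsetPset; apply: subset_itv; rewrite bnd_simp ?lerN2 ler_nat//.
have UF : \bigcup_i F i = setT.
  apply/seteqP; split => // x _; exists (Num.truncn `|x|).+1 => //=.
  by rewrite /F /= in_itv /= -ler_norml ltW// truncnS_gt.
have := @ge0_nondecreasing_set_cvg_integral _ (measurableTypeR R) R F (EFin \o f) mu ndF
  (fun i => measurable_itv _)
  (fun i => measurable_int _ (integrableSf (measurable_itv _) intf))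
  (fun i x _ => f0 x).
rewrite UF -(fineK (integrable_fin_num measurableT intf)) => /fine_cvgP[_].
move=> /cvgrPdist_le/(_ _ e0)[N _ hN]; exists N.
by have := hN N (leqnn N); rewrite ler_norml => /andP[_].
Qed.
End IntegralTruncation.

(** * Locally uniform approximation of the marginal *)

Section LogSumExpApproximates.
Context {R : realType} {m n : nat}.
Notation V := 'rV[R]_m.
Notation mu := (@lebesgue_measure R).

Lemma continuous_param_integ a b (F : R * V -> R) (g : R -> R) :
  continuous F -> continuous g -> continuous (fun t => integ a b (fun y => F (y, t) * g y)).
Proof.
move=> cF cg t0; apply/(@cvgrPdist_le _ _ _ (nbhs t0)) => e e0.
have cg' : continuous (fun y => `|g y|).
  by move=> y; apply: cvg_norm; exact: cg.
pose C : R := 1 + integ a b (fun y => `|g y|).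
have I0 : 0 <= integ a b (fun y => `|g y|) by apply: integ_ge0.
have C0 : 0 < C by rewrite ltr_pwDl.
have eC : 0 < e / C by rewrite divr_gt0.
have cK := compact_setX (@segment_compact R a b) (@compact_norm_ball R m `|t0|).
have [d d0 hd] := compact_unif_continuous cK (fun z _ => cF z) eC.
have cs t : continuous (fun y => F (y, t) * g y).
  by move=> y; apply: cvgM; [exact: continuous_slice|exact: cg].
apply: filterS (nbhsx_ballx (t0 : V) d d0) => t; rewrite -ball_normE /= => ht.
rewrite -integB//; apply: (le_trans (integ_norm _ _ _)).
  by move=> y; apply: cvgB; exact: cs.
apply: (@le_trans _ _ (integ a b (fun y => e / C * `|g y|))).
  apply: le_integ.
  - by move=> y; apply: cvg_norm; apply: cvgB; exact: cs.
  - by move=> y; apply: cvgM; [exact: cvg_cst|exact: cg'].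
  move=> y yab; rewrite -mulrBl normrM ler_wpM2r// ltW//; apply: hd.
    by split => /=; rewrite ?in_itv.
  rewrite (_ : (y, t0) - _ = (0, t0 - t)); last first.
    by congr pair; rewrite /= subrr.
  by rewrite prod_normE /= normr0 gt_max d0.
by rewrite integZ// mulrAC ler_pdivrMr// ler_pM2l// lerDr.
Qed.

Variables (phi : R * V -> R) (S : R -> 'M[R]_n) (G : V -> 'M[R]_n).
Hypothesis dphi : forall z, differentiable phi z.
Hypothesis phi_convex : forall (s : R) z w, 0 < s -> s < 1 ->
  phi (w + s *: (z - w)) <= phi w + s * (phi z - phi w).
Hypothesis Sp : forall y, posdef (S y).
Hypothesis cS : mxcont S.
Hypothesis intS : forall t i j,
  mu.-integrable setT (EFin \o (fun y => expR (- phi (y, t)) * S y i j)).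
Hypothesis GE : forall t i j, G t i j = \int[mu]_y (expR (- phi (y, t)) * S y i j).
Hypothesis cG : mxcont G.

Let E z := expR (- phi z).

Let cE : continuous E.
Proof.
move=> z; apply: continuous_comp; last exact: continuous_expR.
by apply: cvgN; apply: differentiable_continuous.
Qed.

Let cslice t i j : continuous (fun y => E (y, t) * S y i j).
Proof.
have cEt : continuous (fun y => E (y, t)) := continuous_slice (t := t) (@cE).
by move=> y; apply: cvgM; [exact: cEt|exact: cS].
Qed.

Let diag_ge0 t i y : 0 <= E (y, t) * S y i i.
Proof. by rewrite mulr_ge0 ?expR_ge0// posdef_diag_ge0. Qed.

Let tail (N : nat) t :=
  \sum_i (G t i i - integ (- N%:R) N%:R (fun y => E (y, t) * S y i i)).

Let tail_term_ge0 a b t i : 0 <= G t i i - integ a b (fun y => E (y, t) * S y i i).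
Proof.
rewrite GE (Rintegral_itv_split a b (intS t i i)) addrC addKr.
by apply: Rintegral_ge0 => y _; exact: diag_ge0.
Qed.

Let tail_term_le a b a' b' t i : a' <= a -> b <= b' ->
  G t i i - integ a' b' (fun y => E (y, t) * S y i i) <=
  G t i i - integ a b (fun y => E (y, t) * S y i i).
Proof.
move=> aa bb; rewrite lerD2l lerN2.
exact: (truncation_le aa bb (diag_ge0 t i) (@cslice t i i) (intS t i i)).
Qed.

(** Dini's argument: the tails are continuous in [t], decrease with [N] because diagonal entries are
    nonnegative, and tend to [0] at each [t], so compactness of the ball makes the convergence
    uniform. *)
Let tail_uniform r e : 0 < e -> exists N, forall t, `|t| <= r -> tail N t <= e.
Proof.
move=> e0; have e2 : 0 < e / 2 by rewrite divr_gt0.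
have /compact_near_coveringP cB := @compact_norm_ball R m r.
have := cB nat eventually (fun N t => tail N t <= e) _.
have H t0 : `|t0| <= r -> \forall t \near t0 & N \near eventually, tail N t <= e.
  move=> _; pose e' : R := e / 2 / n.+1%:R.
  have e'0 : 0 < e' by rewrite divr_gt0.
  have h i : {N : nat |
      G t0 i i - integ (- N%:R) N%:R (fun y => E (y, t0) * S y i i) <= e'}.
    by apply/cid; rewrite GE; apply: truncation_cvg => // y; exact: diag_ge0.
  pose N0 := \max_i sval (h i).
  have tail_mono N1 N2 t : (N1 <= N2)%N -> tail N2 t <= tail N1 t.
    move=> N12; apply: ler_sum => i _; apply: tail_term_le.
      by rewrite lerN2 ler_nat.
    by rewrite ler_nat.
  have t0N : tail N0 t0 <= e / 2.
    apply: (@le_trans _ _ (\sum_(i < n) e')).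
      apply: ler_sum => i _; apply: le_trans (svalP (h i)).
      apply: tail_term_le; first by rewrite lerN2 ler_nat /N0 (leq_bigmax i).
      by rewrite ler_nat /N0 (leq_bigmax i).
    rewrite sumr_const card_ord -[e' *+ n]mulr_natl /e' mulrCA ler_piMr ?(ltW e2)//.
    by rewrite ler_pdivrMr ?ltr0n// mul1r ler_nat.
  have ctail : {for t0, continuous (tail N0)}.
    have : continuous (tail N0).
      apply: continuous_sumf => i t.
      have Q : continuous (fun t => integ (- N0%:R) N0%:R (fun y => E (y, t) * S y i i)).
        by apply: continuous_param_integ; [exact: cE|exact: cS].
      exact: (continuousB (@cG i i t) (Q t)).
    exact.
  have /cvgrPdist_lt/(_ _ e2) near_t0 := ctail.
  exists ([set t | `|tail N0 t0 - tail N0 t| < e / 2], [set N | (N0 <= N)%N]).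
    by split => //=; exists N0.
  move=> [t N] /= [h1 h2]; apply: (le_trans (tail_mono _ _ t h2)).
  by move: h1; rewrite ltr_norml => /andP[h1 _]; lra.
by move=> /(_ _ H)[N _ hN]; exists N; exact: (hN N (leqnn N)).
Qed.

Lemma lse_approximation r e : 0 < e -> exists a b p k (al ga : 'I_p.+1 -> R)
    (be : 'I_p.+1 -> 'I_m -> R), [/\ a < b, 0 < k & forall t, `|t| <= r ->
  forall i j, `|lse_G a b k al ga be S t i j - G t i j| <= e].
Proof.
move=> e0; have e4 : 0 < e / 4 by rewrite divr_gt0.
have [N0 hN0] := tail_uniform r e4.
(* The successor ensures [- b < b] even when [N0 = 0]; a longer interval only shrinks the tail. *)
pose b : R := N0.+1%:R.
have tailb t : `|t| <= r ->
    \sum_i (G t i i - integ (- b) b (fun y => E (y, t) * S y i i)) <= e / 4.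
  move=> tr; apply: le_trans (hN0 t tr); apply: ler_sum => i _.
  by apply: tail_term_le; rewrite ?lerN2 ler_nat.
have [C hC] : exists C, forall t, `|t| <= r -> `|\sum_i G t i i| <= C.
  by apply: continuous_bounded_ball; apply: continuous_sumf => i; exact: cG.
(* A relative error [e / D] in the weight is multiplied by a sum of two diagonal entries of [G], at
   most [2 * (|C| + 1)], and so costs [e / 2]. *)
pose D : R := 4 * (`|C| + 1); have D0 : 0 < D by rewrite mulr_gt0// ltr_wpDl.
have eD : 0 < e / D by rewrite divr_gt0.
have [eta eta0 heta] : exists2 eta : R, 0 < eta & expR eta - 1 <= e / D.
  have /cvgrPdist_lt/(_ _ eD)/nbhs_normP[d /= d0 hd] := @continuous_expR R 0.
  exists (d / 2); first by rewrite divr_gt0.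
  have := hd (d / 2); rewrite expR0 /= sub0r normrN gtr0_norm ?divr_gt0//.
  have d2 : d / 2 < d by lra.
  by move=> /(_ d2); rewrite ltr_norml => /andP[h _]; lra.
have cK := compact_setX (@segment_compact R (- b) b) (@compact_norm_ball R m r).
have [p [k [al [ga [be [k0 hpsi]]]]]] := lse_envelope dphi phi_convex cK eta0.
have ab : - b < b by rewrite gtrN// ltr0n.
exists (- b), b, p, k, al, ga, be; split => // t tr i j.
pose ps y := psi k al ga be (y, t).
have psi_close y : - b <= y <= b -> `|ps y - E (y, t)| <= e / D * E (y, t).
  move=> yb; have /hpsi /andP[h1 h2] : (`[- b, b] `*` [set t : V | `|t| <= r]) (y, t).
    by split => //=; rewrite in_itv.
  rewrite !expRD in h1 h2; rewrite -/(E (y, t)) -/(ps y) in h1 h2.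
  have E0 : 0 < E (y, t) by exact: expR_gt0.
  (* Equivalent to [0 <= (expR eta - 1) ^+ 2]: the single bound on [expR eta - 1] controls the error
     on both sides. *)
  have c : 2 - expR eta <= expR (- eta).
    rewrite expRN; have x0 := expR_gt0 eta.
    rewrite -(ler_pM2r x0) mulVf ?gt_eqF//.
    have : 0 <= (expR eta - 1) ^+ 2 by rewrite sqr_ge0.
    by rewrite expr2; lra.
  have u : E (y, t) * expR eta <= E (y, t) * (1 + e / D) by rewrite ler_pM2l//; lra.
  have l : E (y, t) * (1 - e / D) <= E (y, t) * expR (- eta) by rewrite ler_pM2l//; lra.
  rewrite ler_norml; apply/andP; split; lra.
have cps : continuous ps.
  by apply: continuous_slice; exact: continuous_psi.
have diag_le c : G t c c <= `|C| + 1.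
  have h0 c' : 0 <= G t c' c' by rewrite GE; apply: Rintegral_ge0 => y _; exact: diag_ge0.
  apply: (@le_trans _ _ (\sum_c G t c c)); first by rewrite (bigD1 c)//= lerDl sumr_ge0.
  rewrite (le_trans (ler_norm _))// (le_trans (hC t tr))//.
  by rewrite (le_trans (ler_norm _))// lerDl.
have tail_le c : G t c c - integ (- b) b (fun y => E (y, t) * S y c c) <= e / 4.
  by apply: le_trans (tailb t tr); rewrite (bigD1 c)//= lerDl sumr_ge0.
have part_le c : integ (- b) b (fun y => E (y, t) * S y c c) <= G t c c.
  by have := tail_term_ge0 (- b) b t c; rewrite subr_ge0.
pose I c d := integ (- b) b (fun y => E (y, t) * S y c d).
have near1 : `|lse_G (- b) b k al ga be S t i j - I i j| <= e / 2.
  have c1 : continuous (fun y => ps y * S y i j).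
    by move=> y; apply: cvgM; [exact: cps|exact: cS].
  have -> : lse_G (- b) b k al ga be S t i j = integ (- b) b (fun y => ps y * S y i j).
    by rewrite mxE; apply: eq_integ => y _; rewrite mxE.
  have cii : continuous (fun y => E (y, t) * S y i i + E (y, t) * S y j j).
    by move=> y; apply: cvgD; exact: cslice.
  rewrite -integB//; apply: (le_trans (integ_norm _ _ _)).
    by move=> y; apply: cvgB; [exact: c1|exact: cslice].
  apply: (@le_trans _ _ (integ (- b) b
    (fun y => e / D * (E (y, t) * S y i i + E (y, t) * S y j j)))).
    apply: le_integ.
    - by move=> y; apply: cvg_norm; apply: cvgB; [exact: c1|exact: cslice].
    - by move=> y; apply: cvgM; [exact: cvg_cst|exact: cii].
    move=> y yb; rewrite -mulrBl normrM -mulrDr mulrA.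
    by apply: ler_pM => //; [exact: psi_close|exact: posdef_entry].
  rewrite integZ// integD//.
  apply: (@le_trans _ _ (e / D * ((`|C| + 1) + (`|C| + 1)))).
    rewrite ler_pM2l// lerD//; exact: le_trans (part_le _) (diag_le _).
  rewrite le_eqVlt; apply/orP; left; apply/eqP; rewrite /D; field.
  by rewrite gt_eqF// ltr_wpDl.
have near2 : `|I i j - G t i j| <= e / 2.
  rewrite distrC GE (Rintegral_itv_split (- b) b (intS t i j)) addrC addKr.
  have mC : measurable (~` `[- b, b]%classic : set (measurableTypeR R)).
    by apply: measurableC; exact: measurable_itv.
  apply: (le_trans (le_normr_Rintegral _ _ )) => //; first exact: integrableSf.
  have ic c := integrableSf mC (intS t c c).
  apply: (@le_trans _ _ (\int[mu]_(y in ~` `[- b, b])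
    (E (y, t) * S y i i + E (y, t) * S y j j))).
    apply: le_Rintegral => //.
    - exact: (integrable_norm (integrableSf mC (intS t i j))).
    - by have := integrableD mC (ic i) (ic j); apply: eq_integrable.
    move=> y _; rewrite normrM ger0_norm ?expR_ge0// -mulrDr ler_wpM2l ?expR_ge0//.
    exact: posdef_entry.
  rewrite RintegralD//.
  have tE c : \int[mu]_(y in ~` `[- b, b]) (E (y, t) * S y c c) = G t c c - I c c.
    by rewrite GE (Rintegral_itv_split (- b) b (intS t c c)) addrC addKr.
  rewrite !tE; have := tail_le i; have := tail_le j; rewrite -!/(I _ _); lra.
rewrite -(subrK (I i j) (lse_G _ _ _ _ _ _ _ _ _ _)) -addrA (splitr e).
by rewrite (le_trans (ler_normD _ _))// lerD.
Qed.
End LogSumExpApproximates.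

(** * The theorem for real symmetric matrices *)

Section RealPrekopa.
Context {R : realType} {m n : nat}.
Notation V := 'rV[R]_m.
Notation e_ k := (delta_mx (0 : 'I_1) k : 'rV[R]_m).
Notation mu := (@lebesgue_measure R).
Variables (phi : R * V -> R) (S S1 B1 : R -> 'M[R]_n) (G : V -> 'M[R]_n).
Hypothesis dphi : forall z, differentiable phi z.
Hypothesis phi_convex : forall (s : R) z w, 0 < s -> s < 1 ->
  phi (w + s *: (z - w)) <= phi w + s * (phi z - phi w).
Hypothesis Sp : forall y, posdef (S y).
Hypothesis dS : forall y : R, mxder S (S1 y) y 1.
Hypothesis dB : forall y : R, mxder (fun y => invmx (S y) *m S1 y) (B1 y) y 1.
Hypothesis B1_le0 : forall y u, bform u (S y) (B1 y *m u) <= 0.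
Hypothesis intS : forall t i j,
  mu.-integrable setT (EFin \o (fun y => expR (- phi (y, t)) * S y i j)).
Hypothesis GE : forall t i j, G t i j = \int[mu]_y (expR (- phi (y, t)) * S y i j).

Let cS : mxcont S. Proof. exact: mxder_cont dS. Qed.

Let cslice t : continuous (fun y => expR (- phi (y, t))).
Proof.
apply: (@continuous_slice R V _ (fun z => expR (- phi z))) => z.
apply: continuous_comp; last exact: continuous_expR.
by apply: cvgN; apply: differentiable_continuous.
Qed.

Let integrable_sum_Rintegral (I : Type) (s : seq I) (F : I -> R -> R) :
  (forall i, mu.-integrable setT (EFin \o F i)) ->
  mu.-integrable setT (EFin \o (fun y => \sum_(i <- s) F i y)) /\
  \int[mu]_y (\sum_(i <- s) F i y) = \sum_(i <- s) \int[mu]_y F i y.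
Proof.
move=> iF; elim: s => [|i s [IH1 IH2]].
  rewrite big_nil (_ : (fun=> _) = fun=> 0); last first.
    by apply/funext => y; rewrite big_nil.
  split; first exact: integrable0.
  by rewrite /Rintegral integral0.
rewrite big_cons (_ : (fun y => _) = fun y => F i y + \sum_(i <- s) F i y); last first.
  by apply/funext => y; rewrite big_cons.
split; first exact: (integrableD measurableT (iF i) IH1).
by rewrite RintegralD// IH2.
Qed.

Lemma posdef_marginal t : posdef (G t).
Proof.
split.
  apply/matrixP => i j; rewrite mxE !GE; apply: eq_Rintegral => y _.
  by rewrite -{1}(Sp y).1 mxE.
move=> u u0; pose f y := expR (- phi (y, t)) * bform u (S y) u.
pose F (c : 'I_n * 'I_n) y := (u c.1 0 * u c.2 0) * (expR (- phi (y, t)) * S y c.1 c.2).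
have iF c : mu.-integrable setT (EFin \o F c).
  exact: (integrableZl measurableT _ (intS t c.1 c.2)).
have fE : f = fun y => \sum_(c <- index_enum _) F c y.
  apply/funext => y; rewrite /f bformE pair_bigA mulr_sumr.
  by apply: eq_bigr => c _; rewrite /F /=; ring.
have [intf Hf] := integrable_sum_Rintegral (index_enum _) iF.
have -> : bform u (G t) u = \int[mu]_y f y.
  rewrite fE Hf bformE pair_bigA; apply: eq_bigr => c _ /=.
  rewrite mulrAC GE -RintegralZl//; exact: intS.
(* The integrand is continuous and positive, so its integral over any nontrivial bounded interval is
   already positive; the rest is nonnegative. *)
rewrite -fE in intf; rewrite (Rintegral_itv_split 0 1 intf).
have cf : continuous f.
  have cb : continuous (fun y => bform u (S y) u).
    by apply: continuous_bform => //; exact: mxcont_cst.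
  by move=> y; apply: cvgM; [exact: cslice|exact: cb].
rewrite ltr_pwDl//.
  by apply: integ_gt0 => // y _; rewrite mulr_gt0 ?expR_gt0// (Sp y).2.
by apply: Rintegral_ge0 => y _; rewrite mulr_ge0 ?expR_ge0// posdef_ge0.
Qed.

Variable G1 : 'I_m -> V -> 'M[R]_n.
Hypothesis cG : mxcont G.
Hypothesis dG : forall j t, mxder G (G1 j t) t (e_ j).
Hypothesis dG1 : forall j t a b, differentiable (fun t => G1 j t a b) t.

(** A marginal bundled with its first and second derivatives. Letting the radius [l] grow while the
    error [l.+1^-1] shrinks gives a single sequence that converges uniformly on every ball. *)
Let approximant (l : nat) (X : (V -> 'M[R]_n) * ('I_m -> V -> 'M[R]_n) *
    ('I_m -> 'I_m -> V -> 'M[R]_n)) : Prop :=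
  [/\ (forall t, posdef (X.1.1 t)),
    (forall j a b, udiff (e_ j) (fun t => X.1.1 t a b) (fun t => X.1.2 j t a b)),
    (forall j k a b, udiff (e_ k) (fun t => X.1.2 j t a b) (fun t => X.2 j k t a b)),
    (forall j k t, X.2 j k t = X.2 k j t) &
    (forall t (u : 'I_m -> 'cV[R]_n), let w := \sum_j X.1.2 j t *m u j in
      \sum_k \sum_j bform (u k) (X.2 j k t) (u j) <= bform w (invmx (X.1.1 t)) w) /\
    (forall t, `|t| <= l%:R -> forall i j, `|X.1.1 t i j - G t i j| <= l.+1%:R^-1)].

Let approximants : {X | forall l, approximant l (X l)}.
Proof.
apply: cid; suff /boolp.choice[X hX] : forall l, exists X, approximant l X by exists X.
move=> l; have e0 : 0 < l.+1%:R^-1 :> R by rewrite invr_gt0 ltr0n.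
have [a [b [p [k [al [ga [be [ab k0 close]]]]]]]] :=
  lse_approximation dphi phi_convex Sp cS intS GE cG l%:R e0.
exists (lse_G a b k al ga be S, lse_G1 a b k al ga be S, lse_G2 a b k al ga be S).
split => /=.
- by move=> t; exact: posdef_lse_G.
- by move=> j i h; exact: udiff_lse_G.
- by move=> j c i h; exact: udiff_lse_G1.
- by move=> j c t; exact: lse_G2C.
- by split; [move=> t u; exact: lse_nakano|exact: close].
Qed.

Let GG o t := if o is Some l then (sval approximants l).1.1 t else G t.
Let GG1 j o t := if o is Some l then (sval approximants l).1.2 j t else G1 j t.
Let GG2 j k l t := (sval approximants l).2 j k t.

Let GGp o t : posdef (GG o t).
Proof.
case: o => [l|]; last exact: posdef_marginal.
by have [h _ _ _ _] := svalP approximants l; exact: h.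
Qed.

Let dGG j o t : mxder (GG o) (GG1 j o t) t (e_ j).
Proof.
case: o => [l|]; last exact: dG.
move=> a b; have [_ h _ _ _] := svalP approximants l.
exact: (udiff_derive t (h j a b)).
Qed.

Let uGG1 j k l a b :
  udiff (e_ k) (fun t => GG1 j (Some l) t a b) (fun t => GG2 j k l t a b).
Proof. by have [_ _ h _ _] := svalP approximants l; exact: h. Qed.

Let uGG r a b : ucvg r (fun o t => GG o t a b).
Proof.
move=> e e0; exists (maxn (Num.truncn `|r|).+1 (Num.truncn e^-1)) => l.
rewrite geq_max => /andP[rl el] t tr.
have [_ _ _ _ [_ h]] := svalP approximants l.
apply: le_trans (h t _ a b) _.
  rewrite (le_trans tr)// (le_trans (ler_norm r))// ltW//.
  by rewrite (lt_le_trans (truncnS_gt _))// ler_nat.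
rewrite -[leRHS]invrK lef_pV2 ?posrE ?invr_gt0 ?ltr0n//.
by rewrite ltW// (lt_le_trans (truncnS_gt _))// ler_nat ltnS.
Qed.

Let GG2_sym j k l t : GG2 j k l t = GG2 k j l t.
Proof. by have [_ _ _ h _] := svalP approximants l; exact: h. Qed.

Let GG2_nakano l t (u : 'I_m -> 'cV[R]_n) :
  let w := \sum_j GG1 j (Some l) t *m u j in
  \sum_k \sum_j bform (u k) (GG2 j k l t) (u j) <= bform w (invmx (GG (Some l) t)) w.
Proof. by have [_ _ _ _ [h _]] := svalP approximants l; exact: h. Qed.

(** Inherited from the approximants, whose second derivatives are symmetric by their formula. It
    serves to show that the Nakano sum is real. *)
Lemma marginal_second_derivative_sym t (D2 : 'I_m -> 'I_m -> 'M[R]_n) j k :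
  (forall j k, mxder (G1 j) (D2 j k) t (e_ k)) -> D2 j k = D2 k j.
Proof.
exact: (nakano_limit_sym (G := GG) (G1 := GG1) GGp dGG cG dG1 uGG1 uGG GG2_sym GG2_nakano).
Qed.

Lemma marginal_nakano t (D2 : 'I_m -> 'I_m -> 'M[R]_n) (u : 'I_m -> 'cV[R]_n) :
  (forall j k, mxder (G1 j) (D2 j k) t (e_ k)) ->
  let w := \sum_j G1 j t *m u j in
  \sum_k \sum_j bform (u k) (D2 j k) (u j) <= bform w (invmx (G t)) w.
Proof.
exact: (nakano_limit (G := GG) (G1 := GG1) GGp dGG cG dG1 uGG1 uGG GG2_nakano).
Qed.
End RealPrekopa.

(** * Complex matrices as real matrices of twice the size *)

Local Open Scope sesquilinear_scope.

Section Realification.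
Context {R : realType} {r : nat}.
Implicit Types (M N : 'M[R[i]]_r) (u v : 'cV[R[i]]_r).
Notation re := (map_mx (@complex.Re R)).
Notation im := (map_mx (@complex.Im R)).

(** The real matrix of the linear map [M] on stacked real and imaginary parts: an injective ring
    homomorphism that turns adjoints into transposes. *)
Definition rmx M : 'M[R]_(r + r) := block_mx (re M) (- im M) (im M) (re M).
Definition rcv u : 'cV[R]_(r + r) := col_mx (re u) (im u).

Let ReD (x y : R[i]) : complex.Re (x + y) = complex.Re x + complex.Re y.
Proof. by case: x; case: y. Qed.
Let ImD (x y : R[i]) : complex.Im (x + y) = complex.Im x + complex.Im y.
Proof. by case: x; case: y. Qed.
Let ReM (x y : R[i]) :
  complex.Re (x * y) = complex.Re x * complex.Re y - complex.Im x * complex.Im y.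
Proof. by case: x; case: y. Qed.
Let ImM (x y : R[i]) :
  complex.Im (x * y) = complex.Re x * complex.Im y + complex.Im x * complex.Re y.
Proof. by case: x; case: y. Qed.

Lemma Re_sum (I : Type) (s : seq I) (F : I -> R[i]) :
  complex.Re (\sum_(i <- s) F i) = \sum_(i <- s) complex.Re (F i).
Proof. exact: (big_morph _ ReD). Qed.

Lemma Im_sum (I : Type) (s : seq I) (F : I -> R[i]) :
  complex.Im (\sum_(i <- s) F i) = \sum_(i <- s) complex.Im (F i).
Proof. exact: (big_morph _ ImD). Qed.

Let re_mulmx p q s (M : 'M[R[i]]_(p, q)) (N : 'M[R[i]]_(q, s)) :
  re (M *m N) = re M *m re N - im M *m im N.
Proof.
apply/matrixP => i j; rewrite !mxE Re_sum -sumrB; apply: eq_bigr => k _.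
by rewrite !mxE ReM.
Qed.

Let im_mulmx p q s (M : 'M[R[i]]_(p, q)) (N : 'M[R[i]]_(q, s)) :
  im (M *m N) = re M *m im N + im M *m re N.
Proof.
apply/matrixP => i j; rewrite !mxE Im_sum -big_split; apply: eq_bigr => k _ /=.
by rewrite !mxE ImM.
Qed.

Lemma rmxM M N : rmx (M *m N) = rmx M *m rmx N.
Proof.
rewrite /rmx mulmx_block re_mulmx im_mulmx !mulmxN !mulNmx.
by congr block_mx; rewrite ?opprD// addrC.
Qed.

Lemma rcv_mul M u : rcv (M *m u) = rmx M *m rcv u.
Proof.
by rewrite /rmx /rcv mul_block_col re_mulmx im_mulmx mulNmx [im M *m _ + _]addrC.
Qed.

Lemma rmx1 : rmx 1%:M = 1%:M.
Proof.
rewrite /rmx scalar_mx_block; have i0 : im 1%:M = 0 :> 'M[R]_r.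
  by apply/matrixP => a b; rewrite !mxE; case: (a == b).
have r1 : re 1%:M = 1%:M :> 'M[R]_r.
  by apply/matrixP => a b; rewrite !mxE; case: (a == b).
by rewrite i0 r1 oppr0.
Qed.

Lemma rmx_inj M N : rmx M = rmx N -> M = N.
Proof.
move=> /eq_block_mx[/matrixP E1 _ /matrixP E2 _]; apply/matrixP => a b.
have := E1 a b; have := E2 a b; rewrite !mxE.
by case: (M a b) => x y; case: (N a b) => x' y' /= -> ->.
Qed.

Lemma rmx_unit M : M \in unitmx -> rmx M \in unitmx.
Proof.
move=> Mu; have E : rmx M *m rmx (invmx M) = 1%:M by rewrite -rmxM mulmxV ?rmx1.
by have [] := mulmx1_unit E.
Qed.

Lemma rmx_inv M : M \in unitmx -> invmx (rmx M) = rmx (invmx M).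
Proof.
move=> Mu; have E : rmx M *m rmx (invmx M) = 1%:M by rewrite -rmxM mulmxV ?rmx1.
by rewrite -[RHS](mulKmx (rmx_unit Mu)) E mulmx1.
Qed.

Lemma rmx_conj M : rmx (M ^t*) = (rmx M)^T.
Proof.
rewrite /rmx tr_block_mx; congr block_mx; apply/matrixP => a b; rewrite !mxE;
  by case: (M b a) => x y //=; rewrite opprK.
Qed.

Lemma rcv_surj (w : 'cV[R]_(r + r)) : exists u, rcv u = w.
Proof.
exists (\col_a (usubmx w a 0 +i* dsubmx w a 0)); rewrite -[RHS]vsubmxK.
by congr col_mx; apply/colP => a; rewrite !mxE.
Qed.

Lemma rcv_neq0 u : u != 0 -> rcv u != 0.
Proof.
apply: contra => /eqP; rewrite -(col_mx0 R r r 1) => /eq_col_mx[/colP E1 /colP E2].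
apply/eqP/colP => a; have := E1 a; have := E2 a; rewrite !mxE.
by case: (u a 0) => x y /= -> ->.
Qed.

(** The real form sees only the real part, and the arguments are swapped because [mx_inner]
    conjugates its second one. Vanishing of imaginary parts is obtained separately from
    [mx_innerC]. *)
Lemma Re_mx_inner M u v : complex.Re (mx_inner M u v) = bform (rcv v) (rmx M) (rcv u).
Proof.
rewrite /mx_inner /bform -!mulmxA -rcv_mul; set w := M *m u.
rewrite /rcv tr_col_mx mul_row_col !mxE Re_sum -big_split; apply: eq_bigr => a _ /=.
by rewrite !mxE ReM; case: (v a 0) => x y /=; rewrite mulNr opprK.
Qed.

Lemma mx_innerC M u v : (mx_inner M u v)^* = mx_inner (M ^t*) v u.
Proof.
rewrite /mx_inner; transitivity (((v ^t* *m M *m u) ^t*) 0 0).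
  by rewrite !mxE.
have vv : (v ^t*) ^t* = v by apply/matrixP => a b; rewrite !mxE conjCK.
by rewrite !trmx_mul !map_mxM /= vv mulmxA.
Qed.

Lemma posdef_rmx M : M ^t* = M -> (forall u, u != 0 -> 0 < mx_inner M u u) ->
  posdef (rmx M).
Proof.
move=> MH Mp; split; first by rewrite -rmx_conj MH.
move=> w w0; have [u uE] := rcv_surj w; rewrite -uE -Re_mx_inner.
have u0 : u != 0.
  apply: contra w0 => /eqP u0; rewrite -uE u0 /rcv.
  have -> : re (0 : 'cV_r) = 0 by apply/colP => a; rewrite !mxE.
  have -> : im (0 : 'cV_r) = 0 by apply/colP => a; rewrite !mxE.
  by rewrite col_mx0.
by have := Mp u u0; rewrite ltcE => /andP[_].
Qed.

Lemma inner_gt0_unit M : (forall u, u != 0 -> 0 < mx_inner M u u) -> M \in unitmx.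
Proof.
move=> Mp; rewrite -row_free_unit -kermx_eq0; apply/eqP/row_matrixP => i.
rewrite row0; apply/eqP/negPn/negP => ri0; set w := row i _ in ri0.
have w0 : w ^t* != 0.
  apply: contra ri0 => /eqP/matrixP E; apply/eqP/rowP => a; have := E a 0.
  by rewrite !mxE => /eqP; rewrite conjC_eq0 => /eqP.
have := Mp _ w0; rewrite /mx_inner.
have -> : (w ^t*) ^t* = w by apply/matrixP => a b; rewrite !mxE conjCK.
by rewrite /w -row_mul mulmx_ker row0 mul0mx mxE ltxx.
Qed.
End Realification.

(** * Derivatives of realified matrices *)

Section RealifiedCalculus.
Context {R : realType} {V : normedModType R} {r : nat}.
Implicit Types (g : V -> 'M[R[i]]_r).

Lemma rmx_entry_ind (X : Type) (P : (X -> R) -> Prop) (g : X -> 'M[R[i]]_r) :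
  (forall f, P f -> P (fun x => - f x)) ->
  (forall a b, P (re_entry g a b)) -> (forall a b, P (im_entry g a b)) ->
  forall a b, P (fun x => rmx (g x) a b).
Proof.
move=> PN Pre Pim a b.
case: (split_ordP a) => a' ->; case: (split_ordP b) => b' ->.
- rewrite (_ : (fun=> _) = re_entry g a' b')//.
  by apply/funext => x; rewrite /rmx block_mxEul mxE.
- rewrite (_ : (fun=> _) = fun x => - im_entry g a' b' x); first exact: PN.
  by apply/funext => x; rewrite /rmx block_mxEur !mxE.
- rewrite (_ : (fun=> _) = im_entry g a' b')//.
  by apply/funext => x; rewrite /rmx block_mxEdl mxE.
- rewrite (_ : (fun=> _) = re_entry g a' b')//.
  by apply/funext => x; rewrite /rmx block_mxEdr mxE.
Qed.

Lemma re_entryE (X : Type) (g : X -> 'M[R[i]]_r) a b :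
  re_entry g a b = fun x => rmx (g x) (lshift r a) (lshift r b).
Proof. by apply/funext => x; rewrite /rmx block_mxEul mxE. Qed.

Lemma im_entryE (X : Type) (g : X -> 'M[R[i]]_r) a b :
  im_entry g a b = fun x => rmx (g x) (rshift r a) (lshift r b).
Proof. by apply/funext => x; rewrite /rmx block_mxEdl mxE. Qed.

Lemma mxder_rmx g x v :
  (forall a b, derivable (re_entry g a b) x v) ->
  (forall a b, derivable (im_entry g a b) x v) ->
  mxder (fun z => rmx (g z)) (rmx (mx_derive v g x)) x v.
Proof.
move=> dre dim a b.
case: (split_ordP a) => a' ->; case: (split_ordP b) => b' ->.
- rewrite -re_entryE /rmx block_mxEul !mxE; exact: derivableP.
- rewrite (_ : (fun=> _) = fun x => - im_entry g a' b' x); last first.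
    by apply/funext => z; rewrite /rmx block_mxEur !mxE.
  rewrite /rmx block_mxEur !mxE; apply: is_deriveN; exact: derivableP.
- rewrite -im_entryE /rmx block_mxEdl !mxE; exact: derivableP.
- rewrite (_ : (fun=> _) = re_entry g a' b'); last first.
    by apply/funext => z; rewrite /rmx block_mxEdr mxE.
  rewrite /rmx block_mxEdr !mxE; exact: derivableP.
Qed.

Lemma re_mx_derive g v a b : re_entry (mx_derive v g) a b = 'D_v (re_entry g a b).
Proof. by apply/funext => x; rewrite /re_entry mxE. Qed.

Lemma im_mx_derive g v a b : im_entry (mx_derive v g) a b = 'D_v (im_entry g a b).
Proof. by apply/funext => x; rewrite /im_entry mxE. Qed.

Section TwiceDifferentiable.
Variable g : V -> 'M[R[i]]_r.
Hypothesis g2 : mx_twice_differentiable g.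

Lemma mxder_rmx1 v x : mxder (fun z => rmx (g z)) (rmx (mx_derive v g x)) x v.
Proof.
by apply: mxder_rmx => a b; apply: diff_derivable; have [[h _] [h' _]] := g2 a b.
Qed.

Lemma differentiable_rmx1 v a b x :
  differentiable (fun z => rmx (mx_derive v g z) a b) x.
Proof.
apply: (@rmx_entry_ind V (fun f => differentiable f x)) => {a b}.
- by move=> f; exact: differentiableN.
- by move=> a b; rewrite re_mx_derive; have [[_ h] _] := g2 a b; exact: h.
- by move=> a b; rewrite im_mx_derive; have [_ [_ h]] := g2 a b; exact: h.
Qed.

Lemma mxder_rmx2 v w x : mxder (fun z => rmx (mx_derive v g z))
  (rmx (mx_derive w (mx_derive v g) x)) x w.
Proof.
apply: mxder_rmx => a b; apply: diff_derivable.
  by rewrite re_mx_derive; have [[_ h] _] := g2 a b; exact: h.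
by rewrite im_mx_derive; have [_ [_ h]] := g2 a b; exact: h.
Qed.

Hypothesis gu : forall z, g z \in unitmx.

(** A value of ['D_w] is informative only for derivable entries. Derivability of the entries of
    [g^-1 d_v g] is read off from the product and inverse rules on the real side. *)
Lemma mxder_Theta v w x :
  mxder (fun z => invmx (rmx (g z)) *m rmx (mx_derive v g z)) (rmx (Theta g v w x)) x w.
Proof.
have E : (fun z => invmx (rmx (g z)) *m rmx (mx_derive v g z)) =
    fun z => rmx (invmx (g z) *m mx_derive v g z).
  by apply/funext => z; rewrite rmxM rmx_inv.
have ru z : rmx (g z) \in unitmx by exact: rmx_unit.
have := mxderM (mxder_inv ru (mxder_rmx1 w x)) (mxder_rmx2 v w x).
rewrite E => h; apply: mxder_rmx => a b.
  by rewrite re_entryE; case: (h (lshift r a) (lshift r b)).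
by rewrite im_entryE; case: (h (rshift r a) (lshift r b)).
Qed.

(** Follows from [d_w (g^-1) = - g^-1 (d_w g) g^-1]. It rewrites Nakano log concavity as a
    comparison of second derivatives with products of first derivatives. *)
Lemma rmx_ThetaE v w x : rmx (g x *m Theta g v w x) =
  rmx (mx_derive w (mx_derive v g) x) -
  rmx (mx_derive w g x) *m invmx (rmx (g x)) *m rmx (mx_derive v g x).
Proof.
have ru z : rmx (g z) \in unitmx by exact: rmx_unit.
have h := mxderM (mxder_inv ru (mxder_rmx1 w x)) (mxder_rmx2 v w x).
rewrite rmxM (mxder_unique (mxder_Theta v w x) h) mulmxDr mulKVmx//; congr (_ + _).
by rewrite mulNmx mulmxN -!mulmxA mulKVmx.
Qed.
End TwiceDifferentiable.
End RealifiedCalculus.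

(** * Regularity of the weight and the hermitian case *)

Section MatrixPrekopa.
Context {R : realType} {m r : nat}.
Notation mu := (@lebesgue_measure R).

Lemma convex_function_line (phi : R * 'rV[R]_m -> R) :
  convex_function [set: R^o * 'rV[R]_m] phi ->
  forall (s : R) z w, 0 < s -> s < 1 ->
  phi (w + s *: (z - w)) <= phi w + s * (phi z - phi w).
Proof.
move=> cvx s z w s0 s1.
have := cvx (Itv01 (ltW s0) (ltW s1)) z w (mem_setT _) (mem_setT _).
move=> h; have {}h : phi (s *: z + (1 - s) *: w) <= s * phi z + (1 - s) * phi w := h.
have E : w + s *: (z - w) = s *: z + (1 - s) *: w.
  by rewrite scalerBr scalerBl scale1r addrCA addrA [_ + w]addrC -addrA addrCA.
by rewrite E; apply: (le_trans h); lra.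
Qed.

(** Convexity alone does not give differentiability. It comes from a diagonal entry, positive for
    both metrics: [phi] is the logarithm of that entry of [A] minus that of [g]. A diagonal entry
    exists because [0 < r]. *)
Lemma differentiable_weight (phi : R * 'rV[R]_m -> R) (A : R -> 'M[R[i]]_r)
    (g : R * 'rV[R]_m -> 'M[R[i]]_r) : (0 < r)%N ->
  mx_twice_differentiable g -> mx_twice_differentiable A ->
  (forall y, posdef (rmx (A y))) ->
  (forall y t, g (y, t) = (expR (- phi (y, t)))%:C *: A y) ->
  forall z, differentiable phi z.
Proof.
move=> r0 g2 A2 Ap gE z; pose a := Ordinal r0.
have reA y : 0 < re_entry A a a y.
  rewrite re_entryE; have [_ h] := Ap y.
  have := h (delta_mx (lshift r a) 0); rewrite /bform trmx_delta -rowE -colE !mxE.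
  apply; apply/eqP => /matrixP/(_ (lshift r a) 0); rewrite !mxE !eqxx /= => /eqP.
  by rewrite oner_eq0.
have reg y t : re_entry g a a (y, t) = expR (- phi (y, t)) * re_entry A a a y.
  by rewrite /re_entry gE mxE; case: (A y a a) => x1 x2 /=; rewrite mul0r subr0.
have -> : phi = fun z => ln (re_entry A a a z.1) - ln (re_entry g a a z).
  apply/funext => -[y t]; rewrite reg lnM ?posrE ?expR_gt0// expRK /=.
  by rewrite opprD opprK addrCA subrr addr0.
have dln (x : R) : 0 < x -> differentiable (@ln R) x.
  by move=> x0; apply/derivable1_diffP; have [] := is_derive1_ln x0.
apply: differentiableB.
  apply: (@differentiable_comp _ _ _ _ (fun z => re_entry A a a z.1) (@ln R)).
    apply: (@differentiable_comp _ _ _ _ (fun z : R * 'rV[R]_m => z.1) (re_entry A a a)).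
      by apply: (@linear_differentiable R (R * 'rV[R]_m)%type R fst z) => y; exact: cvg_fst.
    by have [[h _] _] := A2 a a.
  by apply: dln.
apply: (@differentiable_comp _ _ _ _ (re_entry g a a) (@ln R)).
  by have [[h _] _] := g2 a a.
by apply: dln; case: z => y t; rewrite reg mulr_gt0 ?expR_gt0.
Qed.
End MatrixPrekopa.

(* [gtilde_twice_diff] is what makes the conclusion meaningful: log concavity
   is a property of metrics, and convergence of the integrals does not imply
   that [gtilde] is twice differentiable. That [gtilde] is hermitian and
   positive definite is part of the conclusion. *)
Theorem corollary1p3 (R : realType) (m r : nat) (m_gt0 : (0 < m)%N)
    (r_gt0 : (0 < r)%N)
    (phi : R * 'rV[R]_m -> R) (A : R -> 'M[R[i]]_r)
    (g : R * 'rV[R]_m -> 'M[R[i]]_r) (gtilde : 'rV[R]_m -> 'M[R[i]]_r)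
    (g_metric : mx_metric g)
    (gE : forall y t, g (y, t) = (expR (- phi (y, t)))%:C *: A y)
    (phi_convex : convex_function [set: R^o * 'rV[R]_m] phi)
    (A_metric : mx_metric A)
    (ThetaA_le0 : forall (y : R) (u : 'cV[R[i]]_r),
      mx_inner (A y) (Theta A 1 1 y *m u) u <= 0)
    (g_integrable : forall t,
      mx_integrable (fun y => (expR (- phi (y, t)))%:C *: A y))
    (gtildeE : forall t,
      gtilde t = mx_integral (fun y => (expR (- phi (y, t)))%:C *: A y))
    (gtilde_twice_diff : mx_twice_differentiable gtilde) :
  nakano_log_concave gtilde.
Proof.
have [g2 _ _] := g_metric; have [A2 Aherm Apos] := A_metric.
have AH y : (A y) ^t* = A y.
  by have /is_hermitianmxP E := Aherm y; rewrite {2}E expr0 scale1r.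
have Au y : A y \in unitmx := inner_gt0_unit (Apos y).
have Sp y : posdef (rmx (A y)) := posdef_rmx (AH y) (Apos y).
have dphi := differentiable_weight r_gt0 g2 A2 Sp gE.
have cvx := convex_function_line phi_convex.
have dS (y : R) := mxder_rmx1 A2 1 y.
have dB (y : R) := mxder_Theta A2 Au 1 1 y.
have B1_le0 y w : bform w (rmx (A y)) (rmx (Theta A 1 1 y) *m w) <= 0.
  have [u <-] := rcv_surj w; rewrite -rcv_mul -Re_mx_inner.
  by have := ThetaA_le0 y u; rewrite lecE => /andP[].
pose e t y : R := expR (- phi (y, t)).
have reE t a b : re_entry (fun y => (e t y)%:C *: A y) a b =
    fun y => e t y * re_entry A a b y.
  by apply/funext => y; rewrite /re_entry mxE; case: (A y a b) => x1 x2 /=;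
    rewrite mul0r subr0.
have imE t a b : im_entry (fun y => (e t y)%:C *: A y) a b =
    fun y => e t y * im_entry A a b y.
  by apply/funext => y; rewrite /im_entry mxE; case: (A y a b) => x1 x2 /=;
    rewrite mul0r addr0.
pose mu := @lebesgue_measure R.
have both t a b : mu.-integrable setT (EFin \o (fun y => e t y * rmx (A y) a b)) /\
    rmx (gtilde t) a b = \int[mu]_y (e t y * rmx (A y) a b).
  have E1 (a' b' : 'I_r) :
      mu.-integrable setT (EFin \o (fun y => e t y * re_entry A a' b' y)) /\
      complex.Re (gtilde t a' b') = \int[mu]_y (e t y * re_entry A a' b' y).
    by have [h _] := g_integrable t a' b'; rewrite reE in h; split=> //;
      rewrite gtildeE mxE /= reE.
  have E2 (a' b' : 'I_r) :
      mu.-integrable setT (EFin \o (fun y => e t y * im_entry A a' b' y)) /\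
      complex.Im (gtilde t a' b') = \int[mu]_y (e t y * im_entry A a' b' y).
    by have [_ h] := g_integrable t a' b'; rewrite imE in h; split=> //;
      rewrite gtildeE mxE /= imE.
  rewrite /rmx; case: (split_ordP a) => a' ->; case: (split_ordP b) => b' ->.
  - have [h1 h2] := E1 a' b'; rewrite block_mxEul mxE.
    by under eq_fun => y do rewrite block_mxEul mxE.
  - have [h1 h2] := E2 a' b'; rewrite block_mxEur !mxE h2.
    have -> : (fun y => e t y * block_mx (map_mx (@complex.Re R) (A y))
      (- map_mx (@complex.Im R) (A y)) (map_mx (@complex.Im R) (A y))
      (map_mx (@complex.Re R) (A y)) (lshift r a') (rshift r b')) =
      (fun y => -1 * (e t y * im_entry A a' b' y)).
      by apply/funext => y; rewrite block_mxEur !mxE /im_entry mulN1r mulrN.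
    split; last by rewrite RintegralZl// mulN1r.
    by have := integrableZl measurableT (-1) h1; apply: eq_integrable.
  - have [h1 h2] := E2 a' b'; rewrite block_mxEdl mxE.
    by under eq_fun => y do rewrite block_mxEdl mxE.
  - have [h1 h2] := E1 a' b'; rewrite block_mxEdr mxE.
    by under eq_fun => y do rewrite block_mxEdr mxE.
have intS t a b := (both t a b).1; have GE t a b := (both t a b).2.
have Gp t : posdef (rmx (gtilde t)) := posdef_marginal dphi Sp dS intS GE t.
have GH t : (gtilde t) ^t* = gtilde t.
  by apply: rmx_inj; rewrite rmx_conj (Gp t).1.
have Gpos t u : u != 0 -> 0 < mx_inner (gtilde t) u u.
  (* Positivity in [R[i]] includes a vanishing imaginary part, which hermitian symmetry provides. *)
  move=> u0; rewrite ltcE Re_mx_inner (Gp t).2 ?rcv_neq0// andbT eq_sym.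
  have := mx_innerC (gtilde t) u u; rewrite GH.
  by case: (mx_inner _ _ _) => x y [] /=; lra.
have Gu t : gtilde t \in unitmx := inner_gt0_unit (Gpos t).
split; first split => //.
  by move=> t; apply/is_hermitianmxP; rewrite expr0 scale1r GH.
move=> u t.
pose E (j : 'I_m) : 'rV[R]_m := delta_mx 0 j.
pose G1 j t := rmx (mx_derive (E j) gtilde t).
pose D2 j k := rmx (mx_derive (E k) (mx_derive (E j) gtilde) t).
have dG j t' : mxder (fun z => rmx (gtilde z)) (G1 j t') t' (E j).
  exact: mxder_rmx1.
have cG : mxcont (fun z => rmx (gtilde z)).
  move=> a b z; apply: differentiable_continuous.
  apply: (@rmx_entry_ind R r 'rV[R]_m (fun f => differentiable f z)) => {a b}.
  - by move=> f; exact: differentiableN.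
  - by move=> a b; have [[h _] _] := gtilde_twice_diff a b.
  - by move=> a b; have [_ [h _]] := gtilde_twice_diff a b.
have dG1 j t' a b : differentiable (fun t => G1 j t a b) t'.
  exact: differentiable_rmx1.
have dD j k : mxder (G1 j) (D2 j k) t (E k) by exact: mxder_rmx2.
pose K j k := gtilde t *m Theta gtilde (E j) (E k) t.
have KE j k : rmx (K j k) = D2 j k - G1 k t *m invmx (rmx (gtilde t)) *m G1 j t.
  exact: rmx_ThetaE.
have KK j k : K j k = gtilde t *m Theta gtilde (E j) (E k) t by [].
clearbody K D2 G1.
have G1T j : (G1 j t)^T = G1 j t.
  have h := mxder_tr (dG j t); apply: (mxder_unique h).
  rewrite (_ : (fun z => _) = fun z => rmx (gtilde z))//.
  by apply/funext => z; rewrite (Gp z).1.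
have D2sym j k : D2 j k = D2 k j.
  exact: (marginal_second_derivative_sym dphi cvx Sp dS dB B1_le0 intS GE cG dG dG1 _ _ dD).
have D2T j k : (D2 j k)^T = D2 j k.
  have h := mxder_tr (dD j k); apply: (mxder_unique h).
  rewrite (_ : (fun z => _) = G1 j)//; apply/funext => z.
  have h' := mxder_tr (dG j z); apply: (mxder_unique h').
  rewrite (_ : (fun z => _) = fun z => rmx (gtilde z))//.
  by apply/funext => z'; rewrite (Gp z').1.
have KH j k : (K j k) ^t* = K k j.
  apply: rmx_inj; rewrite rmx_conj !KE linearB /= D2T (D2sym k j); congr (_ - _).
  by rewrite !trmx_mul !G1T posdef_inv_tr// mulmxA.
have -> : \sum_j \sum_k mx_inner (gtilde t) (Theta gtilde (E j) (E k) t *m u j) (u k) =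
    \sum_j \sum_k mx_inner (K j k) (u j) (u k).
  by apply: eq_bigr => j _; apply: eq_bigr => k _; rewrite /mx_inner KK !mulmxA.
(* The order on [R[i]] also asks that the sum be real: conjugation exchanges the roles of [j] and
   [k] by [KH]. *)
rewrite lecE; apply/andP; split.
  set x := \sum_j _; have : x^* = x.
    rewrite /x rmorph_sum exchange_big /=; apply: eq_bigr => j _.
    by rewrite rmorph_sum /=; apply: eq_bigr => k _; rewrite mx_innerC KH.
  by case: x => x y [] /=; rewrite eq_sym => h; apply/eqP; lra.
have := marginal_nakano dphi cvx Sp dS dB B1_le0 intS GE cG dG dG1 (fun j => rcv (u j)) dD.
pose w := \sum_j G1 j t *m rcv (u j); rewrite /= -/w => nak.
rewrite Re_sum; under eq_bigr => j _ do rewrite Re_sum.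
under eq_bigr => j _ do under eq_bigr => k _ do rewrite Re_mx_inner KE bformDm bformNm.
(* The products of first derivatives factor through [w] because each [G1 k t] is symmetric. *)
have -> : \sum_j \sum_k (bform (rcv (u k)) (D2 j k) (rcv (u j)) -
    bform (rcv (u k)) (G1 k t *m invmx (rmx (gtilde t)) *m G1 j t) (rcv (u j))) =
    \sum_k \sum_j bform (rcv (u k)) (D2 j k) (rcv (u j)) -
    bform w (invmx (rmx (gtilde t))) w.
  rewrite {1}/w bform_suml exchange_big -sumrB; apply: eq_bigr => k _ /=.
  rewrite sumrB; congr (_ - _); rewrite /w bform_sumr; apply: eq_bigr => j _.
  by rewrite bform_mulr bform_mull G1T.
by rewrite subr_le0.
Qed.
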